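(* Consider the linear control system $\dot x(t)=Ax(t)+B\omega(t)$, $\omega\in\mathcal{U}$, in $\mathbb{R}^d$, with $A\in\mathbb{R}^{d\times d}$, $B\in\mathbb{R}^{d\times m}$, and assume that $(A,B)$ is controllable, $A$ is hyperbolic, and the control range $U$ is a compact neighborhood of the origin in $\mathbb{R}^m$. Let $D$ be the unique control set with nonvoid interior, and let $\lambda_1,\dots,\lambda_r$ be the distinct eigenvalues of $A$ with algebraic multiplicities $d_1,\dots,d_r$. Then for every compact set $K\subset D$ with nonempty interior and every $f\in C(U,\mathbb{R})$, \[ P_{inv}(f,K,D)=\min_{u\in U}f(u)+\sum_{j=1}^r d_j\max\{0,\operatorname{Re}\lambda_j\}. \]
   Context: $\mathcal{U}$ is the set of measurable $\omega:\mathbb{R}\to\mathbb{R}^m$ with $\omega(t)\in U$ a.e.; $\varphi(t,x,\omega)$ denotes the solution with initial value $x$. $A$ hyperbolic means no eigenvalue of $A$ has zero real part. A control set $D$ is a maximal set such that every $x\in D$ admits $\omega$ with $\varphi(t,x,\omega)\in D$ for all $t\ge0$ and $D\subset\overline{\{\varphi(t,x,\omega):t\ge0,\omega\in\mathcal{U}\}}$ for all $x\in D$. Invariance pressure: a set $\mathcal{S}\subset\mathcal{U}$ is $(\tau,K,Q)$-spanning if each $x\in K$ has $\omega\in\mathcal{S}$ with $\varphi([0,\tau],x,\omega)\subset Q$; $a_\tau(f,K,Q)=\inf_{\mathcal{S}}\sum_{\omega\in\mathcal{S}}e^{\int_0^\tau f(\omega(t))dt}$ over $(\tau,K,Q)$-spanning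 $\mathcal{S}$; $P_{inv}(f,K,Q)=\limsup_{\tau\to\infty}\frac1\tau\log a_\tau(f,K,Q)$. *)

(* Defs.v *)
From HB Require Import structures.
From mathcomp Require Import all_boot all_order all_algebra.
From mathcomp Require Import all_classical all_reals all_analysis.
From mathcomp Require Import complex.

Set Implicit Arguments.
Unset Strict Implicit.
Unset Printing Implicit Defensive.

Import Order.TTheory GRing.Theory Num.Theory.
Import numFieldNormedType.Exports.

Local Open Scope classical_set_scope.
Local Open Scope ring_scope.
Local Open Scope complex_scope.

Section LinearControl.
Variables (R : realType) (d m : nat).
Variables (A : 'M[R]_d) (B : 'M[R]_(d, m)).

(* Kalman rank condition: rank [B, AB, ..., A^(d-1) B] = d, i.e. the column
   spaces of A^k B, k < d, span R^d (row spaces of the transposes). *)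
Definition controllable : Prop :=
  \rank (\sum_(k < d) <<(A ^+ k *m B)^T>>)%MS = d.

Definition eigenvalueC (z : R[i]) : Prop :=
  root (map_poly (fun r : R => r%:C) (char_poly A)) z.

Definition hyperbolic : Prop := forall z : R[i], eigenvalueC z -> complex.Re z != 0.

Definition admissible (U : set 'cV[R]_m) (w : R -> 'cV[R]_m) : Prop :=
  (forall i : 'I_m, measurable_fun setT (fun t => w t i ord0)) /\
  {ae (@lebesgue_measure R), forall t, U (w t)}.

(* phi is a (Caratheodory) solution on [0, oo) of x' = A x + B w, x(0) = x0 *)
Definition is_solution (x0 : 'cV[R]_d) (w : R -> 'cV[R]_m)
    (phi : R -> 'cV[R]_d) : Prop :=
  {within `[0, +oo[, continuous phi} /\
  forall t, 0 <= t -> forall i : 'I_d,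
    phi t i ord0 = x0 i ord0 +
      \int[@lebesgue_measure R]_(s in `[0, t]) ((A *m phi s + B *m w s) i ord0).

(* the solution phi(., x0, w) (unique for admissible w, t >= 0) *)
Definition sol (x0 : 'cV[R]_d) (w : R -> 'cV[R]_m) : R -> 'cV[R]_d :=
  [get phi | is_solution x0 w phi].

Definition reach (U : set 'cV[R]_m) (x : 'cV[R]_d) : set 'cV[R]_d :=
  [set y | exists w, admissible U w /\ exists t, 0 <= t /\ y = sol x w t].

Definition control_set_prop (U : set 'cV[R]_m) (D : set 'cV[R]_d) : Prop :=
  (forall x, D x -> exists w, admissible U w /\ forall t, 0 <= t -> D (sol x w t)) /\
  (forall x, D x -> D `<=` closure (reach U x)).

Definition control_set (U : set 'cV[R]_m) (D : set 'cV[R]_d) : Prop :=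
  control_set_prop U D /\
  forall D', control_set_prop U D' -> D `<=` D' -> D' = D.

Definition spanning (U : set 'cV[R]_m) (tau : R) (K Q : set 'cV[R]_d)
    (S : set (R -> 'cV[R]_m)) : Prop :=
  S `<=` admissible U /\
  forall x, K x -> exists2 w, S w & forall t, 0 <= t <= tau -> Q (sol x w t).

Local Open Scope ereal_scope.

Definition a_tau (U : set 'cV[R]_m) (f : 'cV[R]_m -> R) (tau : R)
    (K Q : set 'cV[R]_d) : \bar R :=
  ereal_inf [set \esum_(w in S)
      (expR (\int[@lebesgue_measure R]_(t in `[0, tau]) f (w t)))%:E
    | S in spanning U tau K Q].

Definition inv_pressure (U : set 'cV[R]_m) (f : 'cV[R]_m -> R)
    (K Q : set 'cV[R]_d) : \bar R :=
  limf_esup (fun tau : R => (tau^-1)%:E * lne (a_tau U f tau K Q))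
    (pinfty_nbhs R).

End LinearControl.

(* Main.v *)
(* Write [L] for the sum of the positive parts of the real parts of the
   eigenvalues, [c = min f], and triangularize [A] over the complex numbers.

   Lower bound: hyperbolicity makes [D] bounded, so two points of a ball in [K]
   sharing a control that keeps both in [D] up to time [tau] differ by a vector
   on which [exp(t A)] stays bounded for [t <= tau]. Such vectors occupy a
   fraction [exp(- tau L)] of the ball, so a spanning set has at least
   [const * exp(tau L)] elements, each of weight at least [exp(c tau)].

   Upper bound: let [u0] minimize [f] and let [p] be the [T]-periodic point of the
   control equal to [u0] except on the last unit of each period, where it is [0];
   such a [p] lies in the interior of [D]. About [exp(T (L + eps))] corrections on
   that last unit suffice to steer a whole ball around [p] back into itself, and
   finitely many controls bring [K] into the ball. Concatenating [k] blocks gives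
   [exp(k T (L + eps))] controls whose cost exceeds [c k T] by [O(k)] only, which
   is negligible for large [T]. The trajectories remain in [D], because a
   trajectory between two points of a control set never leaves it.

   Volumes are compared by counting: for a grid of complex points [x + i y], the
   pair of controls of [x] and [y] together with the residue classes of the
   coordinates determines the point. *)
Require Import Defs.
From HB Require Import structures.
From mathcomp Require Import all_boot all_order all_algebra.
From mathcomp Require Import all_classical all_reals all_analysis.
From mathcomp Require Import complex.
From mathcomp Require Import measurable_realfun ring lra.
Import Order.TTheory GRing.Theory Num.Theory.
Import numFieldNormedType.Exports.
Local Open Scope classical_set_scope.
Local Open Scope ring_scope.

Set Implicit Arguments.
Unset Strict Implicit.
Unset Printing Implicit Defensive.

(** A spanning set assigns controls to points in no measurable way, which is why volumes give way to
    counting. The triangularization is complex while states are real: the modes of one real vector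
    cannot be prescribed independently, but those of a pair read as x + i y fill C^d. Both counts
    are made for pairs, and a square root undoes the doubling.

    The lower count loses no epsilon: the first mode in which two grid points differ is not
    disturbed by the others, so its modulus evolves exactly like exp(t Re lambda_j). The upper count
    has to control all modes at once. With the eigenvalues sorted by decreasing real part, a mode is
    forced only by modes of at least its own rate, which are resolved at least as finely, and a
    small extra rate absorbs the coupling.

    That p is interior comes from a path of periodic points joining it to a known interior point.
    Hyperbolicity makes 1 - exp(TA) invertible, so every control on [0, T] has exactly one
    T-periodic point. A control that vanishes at the end of its period leaves room for small
    corrections there, which makes membership in D open and closed along the path. *)

(** * Integral primitives on the half-line and Gronwall inequalities *)

Section LocallyBounded.
Variable R : realType.
Implicit Types (f g F G : R -> R) (a b t T C c : R).
Local Notation mu := (@lebesgue_measure R).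

Definition locally_bounded f := forall T : R, measurable_fun `[0, T] f /\
  exists C : R, forall t : R, 0 <= t <= T -> `|f t| <= C.

(** With measurable controls the differential equation holds only almost everywhere, so derivatives
    are encoded through integrals on [t >= 0]. A locally bounded [f] makes [F] Lipschitz on compact
    intervals, which keeps the product rule elementary. *)
Definition primitive F f := locally_bounded f /\
  forall t : R, 0 <= t -> F t = F 0 + \int[mu]_(s in `[0, t]) f s.

Lemma locally_bounded_integrable f a b : locally_bounded f -> 0 <= a ->
  mu.-integrable `[a, b] (EFin \o f).
Proof.
move=> /(_ b)[mf [C hC]] a0.
have sub : `[a, b] `<=` `[0, b].
  by move=> x /=; rewrite !in_itv/= => /andP[ax ->]; rewrite (le_trans a0).
apply: measurable_bounded_integrable => //.
- by rewrite /= lebesgue_measure_itv/=; case: ifP => _; rewrite ?ltry//= -EFinB ltry.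
- by apply: measurable_funS mf.
- exists C; split; first by rewrite num_real.
  move=> M CM x /sub; rewrite /= in_itv/= => /hC /le_trans; apply; exact: ltW.
Qed.

Lemma locally_bounded_ext f g : (forall t : R, 0 <= t -> f t = g t) ->
  locally_bounded f -> locally_bounded g.
Proof.
move=> fg fP T; have [mf [C hC]] := fP T; split.
  apply: (eq_measurable_fun f) => // x; rewrite inE/= in_itv/= => /andP[x0 _].
  exact: fg.
by exists C => t tT; rewrite -fg ?hC//; case/andP: tT.
Qed.

Lemma locally_boundedD f g : locally_bounded f -> locally_bounded g ->
  locally_bounded (fun t => f t + g t).
Proof.
move=> fP gP T; have [mf [C hC]] := fP T; have [mg [C' hC']] := gP T; split.
  exact: measurable_funD.
exists (C + C') => t tT; apply: (le_trans (ler_normD _ _)).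
by apply: lerD; [exact: hC|exact: hC'].
Qed.

Lemma locally_boundedM f g : locally_bounded f -> locally_bounded g ->
  locally_bounded (fun t => f t * g t).
Proof.
move=> fP gP T; have [mf [C hC]] := fP T; have [mg [C' hC']] := gP T; split.
  exact: measurable_funM.
exists (C * C') => t tT; rewrite normrM.
by apply: ler_pM => //; [exact: hC|exact: hC'].
Qed.

Lemma locally_bounded_cst c : locally_bounded (fun=> c).
Proof. by move=> T; split; [exact: measurable_cst|exists `|c|]. Qed.

Lemma locally_boundedZ c f : locally_bounded f -> locally_bounded (fun t => c * f t).
Proof. by move=> fP; apply: locally_boundedM => //; exact: locally_bounded_cst. Qed.

Lemma locally_bounded_sum (I : Type) (r : seq I) (f : I -> R -> R) :
  (forall i, locally_bounded (f i)) -> locally_bounded (fun t => \sum_(i <- r) f i t).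
Proof.
move=> fP; elim: r => [|i r IH].
  by apply: locally_bounded_ext (locally_bounded_cst 0) => t _; rewrite big_nil.
by apply: locally_bounded_ext (locally_boundedD (fP i) IH) => t _; rewrite big_cons.
Qed.

Lemma continuous_itv_bounded f T : {within `[0, T], continuous f} ->
  exists C : R, forall t : R, 0 <= t <= T -> `|f t| <= C.
Proof.
move=> cf; have [T0|T0] := leP 0 T; last first.
  by exists 0 => t /andP[t0 tT]; have := le_lt_trans (le_trans t0 tT) T0; rewrite ltxx.
have cn : {within `[0, T], continuous (fun x => `|f x|)}.
  by move=> x; apply: continuous_comp; [exact: cf|exact: norm_continuous].
have [c _ hc] := EVT_max T0 cn.
by exists `|f c| => t tT; apply: hc; rewrite in_itv.
Qed.

Lemma continuous_locally_bounded f : {within `[0, +oo[, continuous f} ->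
  locally_bounded f.
Proof.
move=> cf T.
have cT : {within `[0, T], continuous f}.
  by apply: continuous_subspaceW cf => x /=; rewrite !in_itv/= andbT => /andP[].
split; last exact: continuous_itv_bounded.
by apply: subspace_continuous_measurable_fun.
Qed.

Lemma Rintegral_split f a b : locally_bounded f -> 0 <= a <= b ->
  \int[mu]_(s in `[0, b]) f s =
  \int[mu]_(s in `[0, a]) f s + \int[mu]_(s in `[a, b]) f s.
Proof.
move=> fP /andP[a0 ab].
have i0 := locally_bounded_integrable b fP (lexx 0).
have := Rintegral_itvB (x := a) i0; rewrite !bnd_simp => /(_ a0 ab) h.
rewrite -[in RHS]Rintegral_itv_obnd_cbnd -?h; last first.
  apply: integrableS (locally_bounded_integrable b fP a0) => //.
  by move=> x /=; rewrite !in_itv/= => /andP[/ltW -> ->].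
by rewrite addrC subrK.
Qed.

Lemma Rintegral_cst_itv (a b c : R) : a <= b ->
  \int[mu]_(s in `[a, b]) c = c * (b - a).
Proof.
move=> ab; rewrite Rintegral_cst//= lebesgue_measure_itv/= lte_fin.
case: ltP => //= ba; congr (_ * _); apply/esym/eqP.
by rewrite subr_eq0 eq_le ba.
Qed.

Lemma Rintegral_bound f a b C : locally_bounded f -> 0 <= a <= b ->
  (forall s : R, a <= s <= b -> `|f s| <= C) ->
  `|\int[mu]_(s in `[a, b]) f s| <= C * (b - a).
Proof.
move=> fP /andP[a0 ab] hC.
have i0 := locally_bounded_integrable b fP a0.
apply: (le_trans (le_normr_Rintegral _ i0)) => //.
rewrite -(@Rintegral_cst_itv a b)//; apply: le_Rintegral => //.
- exact: integrable_norm.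
- exact: locally_bounded_integrable (locally_bounded_cst C) a0.
Qed.

Lemma primitive_increment F f a b : primitive F f -> 0 <= a <= b ->
  F b - F a = \int[mu]_(s in `[a, b]) f s.
Proof.
move=> [fP FE] ab; have /andP[a0 le_ab] := ab.
rewrite FE ?(le_trans a0)// (FE a)// (Rintegral_split fP ab); ring.
Qed.

Lemma primitive_lipschitz F f T C : primitive F f ->
  (forall t : R, 0 <= t <= T -> `|f t| <= C) ->
  forall a b : R, 0 <= a <= b -> b <= T -> `|F b - F a| <= C * (b - a).
Proof.
move=> Ff hC a b ab bT; rewrite (primitive_increment Ff ab).
apply: Rintegral_bound => //; first by case: Ff.
move=> s /andP[as_ sb]; apply: hC; case/andP: ab => a0 _.
by rewrite (le_trans a0)//= (le_trans sb).
Qed.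

Lemma primitive_within_continuous F f : primitive F f ->
  {within `[0, +oo[, continuous F}.
Proof.
move=> Ff; have [fP _] := Ff.
apply/subspace_continuousP => x; rewrite /= in_itv/= andbT => x0.
have [_ [C hC]] := fP (x + 1).
have C0 : 0 <= C by apply: le_trans (hC 0 _); rewrite // lexx/= addr_ge0.
apply/cvgrPdist_le => e e0; rewrite near_withinE.
exists (Num.min 1 (e / (C + 1))) => /=.
  by rewrite lt_min ltr01/= divr_gt0// ltr_pwDr.
move=> y /= xy; rewrite in_itv/= andbT => y0.
move: xy; rewrite lt_min => /andP[xy1 xye].
have yx1 : y <= x + 1.
  by rewrite -lerBlDl (le_trans (ler_norm _))// distrC ltW.
have Lip : `|F x - F y| <= C * `|x - y|.
  have [xy|/ltW yx] := leP x y.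
    rewrite distrC (distrC x) (ger0_norm (_ : 0 <= y - x)) ?subr_ge0//.
    by apply: (primitive_lipschitz Ff hC) => //; rewrite x0.
  rewrite (ger0_norm (_ : 0 <= x - y)) ?subr_ge0//.
  by apply: (primitive_lipschitz Ff hC) => //; rewrite ?y0// lerDl.
apply: (le_trans Lip); apply: (@le_trans _ _ (C * (e / (C + 1)))).
  by rewrite ler_wpM2l// ltW.
rewrite mulrCA ger_pMr// ler_pdivrMr ?mul1r ?lerDl//; exact: ltr_pwDr.
Qed.

Lemma primitive_locally_bounded F f : primitive F f -> locally_bounded F.
Proof. by move/primitive_within_continuous/continuous_locally_bounded. Qed.

Lemma primitive_ext F G f g : (forall t : R, 0 <= t -> F t = G t) ->
  (forall t : R, 0 <= t -> f t = g t) -> primitive F f -> primitive G g.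
Proof.
move=> FG fg [fP FE]; split; first exact: locally_bounded_ext fP.
move=> t t0; rewrite -!FG// FE//; congr (_ + _).
by apply: eq_Rintegral => s; rewrite inE/= in_itv/= => /andP[s0 _]; exact: fg.
Qed.

Lemma primitiveD F G f g : primitive F f -> primitive G g ->
  primitive (fun t => F t + G t) (fun t => f t + g t).
Proof.
move=> [fP FE] [gP GE]; split; first exact: locally_boundedD.
move=> t t0; rewrite FE// GE// RintegralD//; first ring.
  exact: locally_bounded_integrable.
exact: locally_bounded_integrable.
Qed.

Lemma primitive_cst c : primitive (fun=> c) (fun=> 0).
Proof.
split; first exact: locally_bounded_cst.
by move=> t t0; rewrite Rintegral_cst_itv// mul0r addr0.
Qed.

Lemma primitiveZ c F f : primitive F f ->
  primitive (fun t => c * F t) (fun t => c * f t).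
Proof.
move=> [fP FE]; split; first exact: locally_boundedZ.
move=> t t0; rewrite FE// RintegralZl//; first ring.
exact: locally_bounded_integrable.
Qed.

Lemma primitive_sum (I : Type) (r : seq I) (F f : I -> R -> R) :
  (forall i, primitive (F i) (f i)) ->
  primitive (fun t => \sum_(i <- r) F i t) (fun t => \sum_(i <- r) f i t).
Proof.
move=> FP; elim: r => [|i r IH].
  by apply: primitive_ext (primitive_cst 0) => t _; rewrite big_nil.
by apply: primitive_ext (primitiveD (FP i) IH) => t _; rewrite big_cons.
Qed.

(** On a subdivision of [0, T] into n + 1 equal pieces the increments add up to at most C T^2 / (n +
    1). This replaces the argument that a function with zero derivative is constant. *)
Lemma quadratic_increment_cst G T C : 0 <= T ->
  (forall a b : R, 0 <= a <= b -> b <= T -> `|G b - G a| <= C * (b - a) ^+ 2) ->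
  G T = G 0.
Proof.
move=> T0 hG.
have step n k : (k <= n.+1)%N ->
    `|G (T * (k%:R / n.+1%:R)) - G 0| <= k%:R * (C * (T / n.+1%:R) ^+ 2).
  have nn : 0 < n.+1%:R :> R by rewrite ltr0n.
  elim: k => [|k IH] kn; first by rewrite !mul0r mulr0 subrr normr0.
  have -> : G (T * (k.+1%:R / n.+1%:R)) - G 0 =
      (G (T * (k%:R / n.+1%:R)) - G 0) +
      (G (T * (k.+1%:R / n.+1%:R)) - G (T * (k%:R / n.+1%:R))) by ring.
  apply: (le_trans (ler_normD _ _)).
  have -> : k.+1%:R * (C * (T / n.+1%:R) ^+ 2) =
      k%:R * (C * (T / n.+1%:R) ^+ 2) + C * (T / n.+1%:R) ^+ 2.
    by rewrite -[in LHS]natr1; ring.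
  apply: lerD; first by apply: IH; exact: ltnW.
  have -> : T / n.+1%:R = T * (k.+1%:R / n.+1%:R) - T * (k%:R / n.+1%:R).
    by rewrite -mulrBr -mulrBl -(natr1 k) addrAC subrr add0r mul1r.
  apply: hG.
    by rewrite mulr_ge0 ?divr_ge0//= ler_wpM2l// ler_pM2r ?invr_gt0// ler_nat.
  by rewrite ler_piMr// ler_pdivrMr// mul1r ler_nat.
have main n : `|G T - G 0| <= C * T ^+ 2 / n.+1%:R.
  have nn : n.+1%:R != 0 :> R by rewrite pnatr_eq0.
  have := step n n.+1 (leqnn _).
  rewrite divff// mulr1 => /le_trans; apply.
  by rewrite expr_div_n [leLHS](_ : _ = C * T ^+ 2 / n.+1%:R)//; field.
apply/eqP; rewrite -subr_eq0 -normr_eq0; apply/eqP/le_anti/andP; split => //.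
apply/ler_addgt0Pr => e e0; rewrite add0r.
have [n hn] : exists n : nat, `|C * T ^+ 2| / e <= n%:R.
  exists (Num.truncn (`|C * T ^+ 2| / e)).+1.
  by rewrite ltW// truncnS_gt.
apply: (le_trans (main n)); rewrite ler_pdivrMr ?ltr0n//.
apply: (le_trans (ler_norm _)).
rewrite [leRHS]mulrC -ler_pdivrMr//; apply: (le_trans hn).
by rewrite ler_nat.
Qed.

(** The increment of [F G] over [a, b] is the integral of [G b * f + F a * g]. Freezing these
    factors at the endpoints costs O(b - a) pointwise, hence O((b - a)^2) after integration, so the
    difference of the two sides is constant. *)
Lemma primitiveM F G f g : primitive F f -> primitive G g ->
  primitive (fun t => F t * G t) (fun t => f t * G t + F t * g t).
Proof.
move=> Ff Gg; have [fP FE] := Ff; have [gP GE] := Gg.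
have FP := primitive_locally_bounded Ff; have GP := primitive_locally_bounded Gg.
have hP := locally_boundedD (locally_boundedM fP GP) (locally_boundedM FP gP).
split=> // T T0.
set h := (fun t => _ + _) in hP *.
have [_ [C hC]] := fP T; have [_ [C' hC']] := gP T.
have C0 : 0 <= C by apply: le_trans (hC 0 _); rewrite // lexx T0.
have C'0 : 0 <= C' by apply: le_trans (hC' 0 _); rewrite // lexx T0.
pose K t := F t * G t - \int[mu]_(s in `[0, t]) h s.
suff : K T = K 0.
  by rewrite /K set_itv1 Rintegral_set1 subr0 => <-; rewrite subrK.
apply: (@quadratic_increment_cst _ _ (2 * C * C')) => // a b ab bT.
have /andP[a0 leab] := ab.
have -> : K b - K a = (F b * G b - F a * G a) - \int[mu]_(s in `[a, b]) h s.
  rewrite /K (Rintegral_split hP ab); ring.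
have -> : F b * G b - F a * G a = \int[mu]_(s in `[a, b]) (G b * f s + F a * g s).
  rewrite RintegralD//; last 2 first.
  - exact: locally_bounded_integrable (locally_boundedZ _ fP) a0.
  - exact: locally_bounded_integrable (locally_boundedZ _ gP) a0.
  rewrite !RintegralZl//; last 2 first.
  - exact: locally_bounded_integrable.
  - exact: locally_bounded_integrable.
  rewrite -(primitive_increment Ff ab) -(primitive_increment Gg ab); ring.
have pP : locally_bounded (fun s => G b * f s + F a * g s).
  by apply: locally_boundedD; apply: locally_boundedZ.
rewrite -RintegralB//; last 2 first.
- exact: locally_bounded_integrable.
- exact: locally_bounded_integrable.
rewrite expr2 mulrA; apply: Rintegral_bound => //.
  apply: locally_bounded_ext (locally_boundedD pP (locally_boundedZ (-1) hP)) => t _.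
  by rewrite mulN1r.
move=> s /andP[as_ sb].
have s0 : 0 <= s by exact: le_trans as_.
have -> : G b * f s + F a * g s - h s = f s * (G b - G s) - g s * (F s - F a).
  by rewrite /h; ring.
apply: (le_trans (ler_normB _ _)); rewrite !normrM.
have -> : 2 * C * C' * (b - a) = C * (C' * (b - a)) + C' * (C * (b - a)) by ring.
apply: lerD; apply: ler_pM => //.
- by apply: hC; rewrite s0 (le_trans sb).
- apply: (le_trans (primitive_lipschitz Gg hC' _ bT)); rewrite ?s0//.
  by rewrite ler_wpM2l// lerD2l lerN2.
- by apply: hC'; rewrite s0 (le_trans sb).
- apply: (le_trans (primitive_lipschitz Ff hC _ (le_trans sb bT))); rewrite ?a0//.
  by rewrite ler_wpM2l// lerD2r.
Qed.

Lemma primitive_C1 F f : (forall t : R, is_derive t 1 F (f t)) -> continuous f ->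
  primitive F f.
Proof.
move=> dF cf; have fP : locally_bounded f.
  by apply: continuous_locally_bounded; exact: continuous_subspaceT.
split=> // t; rewrite le_eqVlt => /predU1P[<-|t0].
  by rewrite set_itv1 Rintegral_set1 addr0.
have cF : continuous F.
  by move=> x; apply: differentiable_continuous; apply/derivable1_diffP; case: (dF x).
have -> : \int[mu]_(s in `[0, t]) f s = F t - F 0.
  rewrite /Rintegral (continuous_FTC2 t0 (F := F))//.
  - exact: continuous_subspaceT.
  - split.
    + by move=> x _; case: (dF x).
    + by apply: cvg_at_right_filter; exact: cF.
    + by apply: cvg_at_left_filter; exact: cF.
  - by move=> x _; rewrite derive1E; case: (dF x).
by rewrite addrC subrK.
Qed.

Lemma primitive_nonincreasing F f t : primitive F f -> 0 <= t ->
  (forall s : R, 0 <= s <= t -> f s <= 0) -> F t <= F 0.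
Proof.
move=> [fP FE] t0 f0; rewrite FE// gerDl.
apply: (@le_trans _ _ (\int[mu]_(s in `[0, t]) 0)).
  apply: le_Rintegral => //; first exact: locally_bounded_integrable.
  exact: locally_bounded_integrable (locally_bounded_cst 0) _.
by rewrite Rintegral_cst_itv// mul0r.
Qed.

Lemma primitive_expR a : primitive (fun t => expR (a * t)) (fun t => a * expR (a * t)).
Proof.
apply: primitive_C1 => [t|t].
  have := is_derive1_comp (f := expR) (g := fun t => a * t) (x := t).
  have d1 : is_derive t 1 (fun t0 : R => a * t0) a.
    have := @is_deriveZ R R^o R^o id a t 1 1 _.
    by rewrite [a *: 1]mulr1; apply.
  by move=> /(_ _ _ _ d1); rewrite mulrC; apply; exact: is_derive_expR.
apply: cvgM; first exact: cvg_cst.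
apply: (@continuous_comp _ _ _ (fun t => a * t) expR); last exact: continuous_expR.
by apply: cvgM; [exact: cvg_cst|exact: cvg_id].
Qed.

(* The differential form of Gronwall's inequality: [e^(-at) Q] is nonincreasing. *)
Lemma gronwall_le a Q q t : primitive Q q -> 0 <= t ->
  (forall s : R, 0 <= s <= t -> q s <= a * Q s) -> Q t <= expR (a * t) * Q 0.
Proof.
move=> Qq t0 hq.
have := primitive_nonincreasing (primitiveM (primitive_expR (- a)) Qq) t0.
rewrite mulr0 expR0 mul1r => /(_ _) h.
have : expR (- a * t) * Q t <= Q 0.
  apply: h => s st.
  have -> : - a * expR (- a * s) * Q s + expR (- a * s) * q s =
    expR (- a * s) * (q s - a * Q s) by ring.
  by rewrite mulr_ge0_le0 ?expR_ge0// subr_le0 hq.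
by rewrite mulNr expRN mulrC ler_pdivrMr ?expR_gt0// mulrC.
Qed.

Lemma gronwall_ge a Q q t : primitive Q q -> 0 <= t ->
  (forall s : R, 0 <= s <= t -> a * Q s <= q s) -> expR (a * t) * Q 0 <= Q t.
Proof.
move=> Qq t0 hq.
have := @gronwall_le a (fun t => -1 * Q t) (fun t => -1 * q t) t (primitiveZ (-1) Qq) t0.
rewrite !mulN1r mulrN lerN2; apply => s st.
by rewrite !mulN1r mulrN lerN2 hq.
Qed.

End LocallyBounded.

(** * Maximum norm and entrywise limits of matrices *)

Section MatrixNorm.
Variable R : realType.

Lemma mx_entry_le m n (M : 'M[R]_(m, n)) i j : `|M i j| <= `|M|.
Proof.
by rewrite [`|M|]mx_normrE; exact: (le_bigmax _ (fun ij => `|M ij.1 ij.2|) (i, j)).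
Qed.

Lemma mx_norm_leP m n (M : 'M[R]_(m, n)) (c : R) : 0 <= c ->
  reflect (forall i j, `|M i j| <= c) (`|M| <= c).
Proof.
move=> c0; apply: (iffP idP) => [Mc i j|Mc].
  exact: le_trans (mx_entry_le _ _ _) Mc.
by rewrite [`|M|]mx_normrE; apply/bigmax_leP; split=> // -[i j] _; exact: Mc.
Qed.

Lemma mulmx_norm_le m n p (M : 'M[R]_(m, n)) (N : 'M[R]_(n, p)) :
  `|M *m N| <= n%:R * `|M| * `|N|.
Proof.
apply/mx_norm_leP => [|i j]; first by rewrite !mulr_ge0.
rewrite mxE; apply: (le_trans (ler_norm_sum _ _ _)).
apply: (@le_trans _ _ (\sum_(k < n) `|M| * `|N|)).
  apply: ler_sum => k _; rewrite normrM.
  by apply: ler_pM => //; exact: mx_entry_le.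
by rewrite sumr_const card_ord -(mulr_natl (_ * _)) mulrA.
Qed.

Lemma cvg_mxP (T : Type) (F : set_system T) (FF : Filter F) m n
    (f : T -> 'M[R]_(m, n)) (M : 'M[R]_(m, n)) :
  (forall i j, f x i j @[x --> F] --> M i j) -> f x @[x --> F] --> M.
Proof.
move=> h; apply/cvgrPdist_le => e e0.
have : \forall x \near F, forall ij : 'I_m * 'I_n, `|M ij.1 ij.2 - f x ij.1 ij.2| <= e.
  apply: filter_forall => -[i j] /=.
  by have /cvgrPdist_le := h i j; apply.
apply: filterS => x hx; apply/mx_norm_leP => [|i j]; first exact: ltW.
by rewrite !mxE; exact: (hx (i, j)).
Qed.

Lemma cvg_bigsum (T I : Type) (F : set_system T) (FF : Filter F) (r : seq I)
    (f : I -> T -> R) (l : I -> R) :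
  (forall i, f i x @[x --> F] --> l i) ->
  \sum_(i <- r) f i x @[x --> F] --> \sum_(i <- r) l i.
Proof.
move=> h; elim: r => [|i r IH].
  by rewrite big_nil; under eq_fun do rewrite big_nil; exact: cvg_cst.
by rewrite big_cons; under eq_fun do rewrite big_cons; exact: cvgD.
Qed.

End MatrixNorm.

(** * The matrix exponential as an entrywise power series *)

Section MatrixExponential.
Variables (R : realType) (d : nat) (A : 'M[R]_d).

Lemma mx_exp_bound k i j : `|(A ^+ k) i j| <= (d%:R * `|A| + 1) ^+ k.
Proof.
have a0 : 0 <= d%:R * `|A| :> R by rewrite mulr_ge0.
elim: k i j => [|k IH] i j.
  by rewrite !expr0 mxE; case: (i == j); rewrite ?normr1 ?normr0.
rewrite exprS mxE; apply: (le_trans (ler_norm_sum _ _ _)).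
apply: (@le_trans _ _ (\sum_(l < d) `|A| * (d%:R * `|A| + 1) ^+ k)).
  apply: ler_sum => l _; rewrite normrM.
  by apply: ler_pM => //; exact: mx_entry_le.
rewrite sumr_const card_ord -(mulr_natl (_ * _)) mulrA exprS.
by rewrite ler_wpM2r ?exprn_ge0 ?lerDl ?addr_ge0.
Qed.

(** Coefficients of the entry (i, j) of A^p exp(tA): [p] counts the derivatives already taken. *)
Definition mexp_coeff p i j k := (A ^+ (k + p)) i j / k`!%:R.

Lemma mexp_diffs p i j : pseries_diffs (mexp_coeff p i j) = mexp_coeff p.+1 i j.
Proof.
apply/funext => k; rewrite /pseries_diffs /mexp_coeff addSnnS mulrCA factS natrM.
by rewrite invfM mulVKf ?pnatr_eq0.
Qed.

Lemma mexp_cvg p i j x : cvgn (pseries (mexp_coeff p i j) x).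
Proof.
apply: normed_cvg; set a := d%:R * `|A| + 1.
have a0 : 0 <= a by rewrite addr_ge0// mulr_ge0.
apply: (@series_le_cvg _ _ (fun k => a ^+ p * exp_coeff (a * `|x|) k)).
- by move=> k; exact: normr_ge0.
- by move=> k; rewrite mulr_ge0 ?exprn_ge0// exp_coeff_ge0// mulr_ge0.
- move=> k; rewrite /= /mexp_coeff /exp_coeff/= !normrM normfV normr_nat normrX.
  rewrite exprMn mulrAC !mulrA ler_wpM2r ?invr_ge0// ler_wpM2r ?exprn_ge0//.
  by rewrite -exprD addnC; exact: mx_exp_bound.
- rewrite (_ : series _ = a ^+ p \*: series (exp_coeff (a * `|x|))).
    by apply: is_cvgMr; exact: is_cvg_series_exp_coeff.
  apply/funext => n; rewrite /series /= [RHS]mulr_sumr.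
  by apply: eq_bigr => k _.
Qed.

Definition mexp t : 'M[R]_d := \matrix_(i, j) limn (pseries (mexp_coeff 0 i j) t).

Lemma mexp_diff_lim i j t :
  limn (pseries (mexp_coeff 1 i j) t) = (A *m mexp t) i j.
Proof.
apply: cvg_lim => //; rewrite mxE.
rewrite (_ : pseries _ t = fun n => \sum_(l < d) A i l * pseries (mexp_coeff 0 l j) t n).
  apply: cvg_bigsum => l; apply: cvgMr; rewrite mxE; exact: mexp_cvg.
apply/funext => n; rewrite /pseries /series /=.
under [RHS]eq_bigr do rewrite mulr_sumr.
rewrite exchange_big/=; apply: eq_bigr => k _.
rewrite /mexp_coeff addn1 exprS mxE mulrAC mulr_suml.
rewrite mulr_suml; apply: eq_bigr => l _.
by rewrite addn0; ring.
Qed.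

(** Factoring the derivative series on the right instead of the left; comparing the two
    factorizations shows that [A] commutes with its exponential. *)
Lemma mexp_diff_lim' i j t :
  limn (pseries (mexp_coeff 1 i j) t) = (mexp t *m A) i j.
Proof.
apply: cvg_lim => //; rewrite mxE.
rewrite (_ : pseries _ t = fun n => \sum_(l < d) A l j * pseries (mexp_coeff 0 i l) t n).
  apply: cvg_bigsum => l; rewrite mulrC; apply: cvgMr; rewrite mxE; exact: mexp_cvg.
apply/funext => n; rewrite /pseries /series /=.
under [RHS]eq_bigr do rewrite mulr_sumr.
rewrite exchange_big/=; apply: eq_bigr => k _.
rewrite /mexp_coeff addn1 exprSr mxE mulrAC mulr_suml.
rewrite mulr_suml; apply: eq_bigr => l _.
by rewrite addn0; ring.
Qed.

Lemma mexp_commute t : A *m mexp t = mexp t *m A.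
Proof. by apply/matrixP => i j; rewrite -mexp_diff_lim mexp_diff_lim'. Qed.

Lemma is_derive_mexp i j (t : R) : is_derive t 1 (fun t => mexp t i j) ((A *m mexp t) i j).
Proof.
rewrite -mexp_diff_lim -mexp_diffs.
have -> : (fun t => mexp t i j) = fun t => limn (pseries (mexp_coeff 0 i j) t).
  by apply/funext => s; rewrite mxE.
apply: (@pseries_snd_diffs _ _ (`|t| + 1)).
- exact: mexp_cvg.
- by rewrite mexp_diffs; exact: mexp_cvg.
- by rewrite !mexp_diffs; exact: mexp_cvg.
- by rewrite [ltRHS]ger0_norm ?ltrDl// addr_ge0.
Qed.

Lemma continuous_mexp_entry i j : continuous (fun t => mexp t i j).
Proof.
move=> t; apply: differentiable_continuous; apply/derivable1_diffP.
by case: (is_derive_mexp i j t).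
Qed.

Lemma mexp0 : mexp 0 = 1%:M.
Proof.
apply/matrixP => i j; rewrite !mxE; apply: cvg_lim => //.
rewrite -(cvg_shiftS (pseries _ _)).
rewrite (_ : [sequence _]_n = cst (i == j)%:R); first exact: cvg_cst.
apply/funext => n; rewrite /pseries /series /= big_nat_recl// big1.
  by rewrite /mexp_coeff expr0 mulr1 fact0 divr1 addr0 mxE.
by move=> k _; rewrite exprS mul0r mulr0.
Qed.

End MatrixExponential.

(** * Matrix primitives and the group law of the exponential *)

Section MatrixPrimitive.
Variable R : realType.

Definition mprimitive m n (F f : R -> 'M[R]_(m, n)) :=
  forall i j, primitive (fun t => F t i j) (fun t => f t i j).

Lemma mprimitiveM m n p (F f : R -> 'M[R]_(m, n)) (G g : R -> 'M[R]_(n, p)) :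
  mprimitive F f -> mprimitive G g ->
  mprimitive (fun t => F t *m G t) (fun t => f t *m G t + F t *m g t).
Proof.
move=> Ff Gg i j.
have := primitive_sum (index_enum 'I_n) (fun k => primitiveM (Ff i k) (Gg k j)).
apply: primitive_ext => t _; rewrite !mxE//.
by rewrite big_split/=.
Qed.

Lemma mprimitive_cst m n (M : 'M[R]_(m, n)) : mprimitive (fun=> M) (fun=> 0).
Proof.
by move=> i j; apply: primitive_ext (primitive_cst (M i j)) => t _; rewrite ?mxE.
Qed.

Lemma mprimitive_ext m n (F G f g : R -> 'M[R]_(m, n)) :
  (forall t : R, 0 <= t -> F t = G t) -> (forall t : R, 0 <= t -> f t = g t) ->
  mprimitive F f -> mprimitive G g.
Proof.
by move=> FG fg h i j; apply: primitive_ext (h i j) => t t0; rewrite ?FG ?fg.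
Qed.

Lemma mprimitive_mexp d (A : 'M[R]_d) : mprimitive (mexp A) (fun t => A *m mexp A t).
Proof.
move=> i j; apply: primitive_C1 => [t|]; first exact: is_derive_mexp.
move=> t; under eq_fun do rewrite mxE.
apply: cvg_bigsum => k; apply: cvgMr; exact: continuous_mexp_entry.
Qed.

Lemma mprimitive_mexpN d (A : 'M[R]_d) :
  mprimitive (fun t => mexp A (- t)) (fun t => - (A *m mexp A (- t))).
Proof.
move=> i j; apply: primitive_C1 => [t|].
  have := is_derive1_comp (f := fun t => mexp A t i j) (g := -%R) (x := t).
  move=> /(_ _ _ (is_derive_mexp A i j _)) h.
  have /h : is_derive t 1 (-%R : R -> R) (- 1).
    exact: is_deriveNid.
  by rewrite mulrN1 [in X in _ -> X]mxE.
move=> t; under eq_fun do rewrite mxE [in X in - X]mxE.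
apply: cvgN; apply: cvg_bigsum => k; apply: cvgMr.
apply: (@continuous_comp _ _ _ -%R (fun t => mexp A t k j)).
  exact: opp_continuous.
exact: continuous_mexp_entry.
Qed.

Lemma mprimitive0_cst m n (F f : R -> 'M[R]_(m, n)) (t : R) : mprimitive F f -> 0 <= t ->
  (forall s : R, 0 <= s -> f s = 0) -> F t = F 0.
Proof.
move=> Ff t0 f0; apply/matrixP => i j; have [_ ->//] := Ff i j.
rewrite (_ : \int[_]_(s in _) _ = \int[lebesgue_measure]_(s in `[0, t]) 0).
  by rewrite Rintegral_cst_itv// mul0r addr0.
by apply: eq_Rintegral => s; rewrite inE/= in_itv/= => /andP[s0 _]; rewrite f0// mxE.
Qed.

(** The product has derivative zero by commutation. Primitives see only [t >= 0]; the other sign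
    follows by exchanging [t] and [- t]. *)
Lemma mexpNK_ge0 d (A : 'M[R]_d) (t : R) : 0 <= t -> mexp A t *m mexp A (- t) = 1%:M.
Proof.
move=> t0.
rewrite (mprimitive0_cst (mprimitiveM (mprimitive_mexp A) (mprimitive_mexpN A)))//.
  by rewrite oppr0 mexp0 mulmx1.
by move=> s _; rewrite mulmxN mexp_commute mulmxA addrN.
Qed.

Lemma mexpNK d (A : 'M[R]_d) (t : R) : mexp A t *m mexp A (- t) = 1%:M.
Proof.
have [/mexpNK_ge0//|/ltW] := leP 0 t.
rewrite -oppr_ge0 => /(mexpNK_ge0 A); rewrite opprK.
exact: mulmx1C.
Qed.

Lemma mexpKN d (A : 'M[R]_d) (t : R) : mexp A (- t) *m mexp A t = 1%:M.
Proof. exact/mulmx1C/mexpNK. Qed.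

(** The product of exp(-tA) and exp((s + t)A) has derivative zero in t. *)
Lemma mexpD_ge0 d (A : 'M[R]_d) (s t : R) : 0 <= t ->
  mexp A (s + t) = mexp A t *m mexp A s.
Proof.
move=> t0.
have dsh : mprimitive (fun t => mexp A (s + t)) (fun t => A *m mexp A (s + t)).
  move=> i j; apply: primitive_C1 => [u|].
    have := is_derive1_comp (f := fun t => mexp A t i j) (g := fun t => s + t) (x := u).
    move=> /(_ _ _ (is_derive_mexp A i j _)) h.
    have /h : is_derive u 1 (fun t => s + t) (1 : R).
      have := @is_deriveD _ _ _ (cst s) id u 1 0 1 (is_derive_cst _ _ _) (is_derive_id _ _).
      by rewrite add0r.
    by rewrite mulr1.
  move=> u; under eq_fun do rewrite mxE.
  apply: cvg_bigsum => k; apply: cvgMr.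
  apply: (@continuous_comp _ _ _ (fun t => s + t) (fun t => mexp A t k j)).
    by apply: cvgD; [exact: cvg_cst|exact: cvg_id].
  exact: continuous_mexp_entry.
have := mprimitive0_cst (mprimitiveM (mprimitive_mexpN A) dsh) t0.
rewrite oppr0 mexp0 addr0 mul1mx => <-.
  by rewrite mulmxA mexpNK mul1mx.
by move=> u _; rewrite mulNmx mulmxA mexp_commute addNr.
Qed.

Lemma mexpD d (A : 'M[R]_d) (s t : R) : mexp A (s + t) = mexp A t *m mexp A s.
Proof.
have [/mexpD_ge0//|/ltW] := leP 0 t.
rewrite -oppr_ge0 => /(mexpD_ge0 A (s + t)); rewrite addrK => ->.
by rewrite mulmxA mexpNK mul1mx.
Qed.

End MatrixPrimitive.

(** * Translation invariance of Lebesgue measure and integral *)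

Section Translation.
Variable R : realType.
Local Notation mu := (@lebesgue_measure R).

Lemma measurable_translation (t : R) :
  measurable_fun setT (fun x : measurableTypeR R => (t + x : measurableTypeR R)).
Proof.
apply: continuous_measurable_fun => x.
by apply: cvgD; [exact: cvg_cst|exact: cvg_id].
Qed.

Lemma lebesgue_measure_translation (t : R) (X : set R) : measurable X ->
  pushforward mu ((fun x => t + x) : _ -> measurableTypeR R) X = mu X.
Proof.
move=> mX; apply/esym/lebesgue_measure_unique => //=.
  exact: measurable_translation.
move=> _ _ [[a b]] _ <-; rewrite /pushforward/=.
rewrite (_ : _ @^-1` _ = `]a - t, b - t]%classic); last first.
  by apply/seteqP; split => x /=; rewrite !in_itv/= ltrBlDl lerBrDl.
rewrite !lebesgue_measure_itv/= !lte_fin ltrD2r; case: ifP => // _.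
by rewrite -!EFinB; congr (_%:E); ring.
Qed.

Lemma ae_imply (P Q : R -> Prop) : (forall x, P x -> Q x) ->
  {ae mu, forall x, P x} -> {ae mu, forall x, Q x}.
Proof. by move=> PQ; apply: negligibleS => x nQ Px; exact/nQ/PQ. Qed.

Lemma ae_imply2 (P P' Q : R -> Prop) : (forall x, P x -> P' x -> Q x) ->
  {ae mu, forall x, P x} -> {ae mu, forall x, P' x} -> {ae mu, forall x, Q x}.
Proof.
move=> PQ hP hP'; apply: negligibleS (negligibleU hP hP') => x nQ.
by apply/not_andP => -[Px P'x]; apply/nQ/PQ.
Qed.

Lemma ae_translation (t : R) (P : R -> Prop) : {ae mu, forall x, P x} ->
  {ae mu, forall x, P (t + x)}.
Proof.
move=> [N [mN N0 PN]]; exists ((fun x => t + x) @^-1` N); split.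
- rewrite -[_ @^-1` _]setTI; exact: (measurable_translation t).
- by rewrite -[RHS]N0; exact: lebesgue_measure_translation.
- by move=> x; exact: PN.
Qed.

Lemma ae_eq_Rintegral (D : set R) (f g : R -> R) : measurable D ->
  measurable_fun D f -> measurable_fun D g -> {ae mu, forall x, D x -> f x = g x} ->
  \int[mu]_(x in D) f x = \int[mu]_(x in D) g x.
Proof.
move=> mD mf mg fg; rewrite /Rintegral; congr fine.
apply: ae_eq_integral => //.
- exact/measurable_EFinP.
- exact/measurable_EFinP.
- by apply: ae_imply fg => x /= h /h ->.
Qed.

Lemma Rintegral_translation (f : R -> R) (t s : R) : locally_bounded f ->
  0 <= t -> 0 <= s ->
  \int[mu]_(x in `[t, t + s]) f x = \int[mu]_(x in `[0, s]) f (t + x).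
Proof.
move=> fP t0 s0; have mt := measurable_translation t.
pose D := [set` `[t, t + s]] : set R.
have mD : measurable D by exact: measurable_itv.
have int_f : mu.-integrable D (EFin \o f) by exact: locally_bounded_integrable.
pose g := f \_ D.
have mf : measurable_fun D f by apply/measurable_EFinP; exact: measurable_int int_f.
have mg : measurable_fun setT g by apply/(measurable_restrictT f mD).
have pre : (fun x => t + x) @^-1` D = `[0, s]%classic.
  apply/seteqP; split => x /=; rewrite /D/= !in_itv/=.
    by rewrite lerDl lerD2l.
  by rewrite lerDl lerD2l.
have gE : (fun x => f (t + x)) \_ `[0, s] = g \o (fun x => t + x).
  apply/funext => x; rewrite /g /patch/= -pre.
  by rewrite (_ : (x \in (fun x => t + x) @^-1` D) = (t + x \in D)) ?in_setE.
rewrite Rintegral_mkcond [RHS]Rintegral_mkcond gE /Rintegral; congr fine.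
rewrite -[RHS](@integral_pushforward _ _ (measurableTypeR R) (measurableTypeR R) R
  (fun x => t + x) mt mu setT (EFin \o g))//.
- apply: eq_measure_integral => //= X mX _.
  by rewrite lebesgue_measure_translation.
- exact/measurable_EFinP.
- rewrite preimage_setT -[_ \o _]/(EFin \o (g \o (fun x => t + x))) -gE.
  rewrite (_ : EFin \o _ = (EFin \o (fun x => f (t + x))) \_ `[0, s]); last first.
    by apply/funext => x; rewrite /patch/=; case: ifP.
  apply/integrable_restrict => //=; rewrite ?setTI.
  apply: measurable_bounded_integrable => //.
  + by rewrite /= lebesgue_measure_itv/=; case: ifP => _; rewrite ?ltry//= -EFinB ltry.
  + rewrite -pre; apply: (@measurable_comp _ _ _ _ _ _ D) => //.
      by move=> _ [x xD <-].
    exact: measurable_funS mt.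
  + have [_ [C hC]] := fP (t + s); exists C; split; first by rewrite num_real.
    move=> M CM x /=; rewrite in_itv/= => /andP[x0 xs].
    by apply: le_trans (hC _ _) (ltW CM); rewrite addr_ge0//= lerD2l.
Qed.

End Translation.

(** * Controls: truncation, shift and concatenation *)

Section Controls.
Variables (R : realType) (m : nat).
Implicit Types (w v : R -> 'cV[R]_m).
Local Notation mu := (@lebesgue_measure R).

Definition control w := (forall i, measurable_fun setT (fun t => w t i ord0)) /\
  exists C, {ae mu, forall t, `|w t| <= C}.

Definition bounded_control w := (forall i, measurable_fun setT (fun t => w t i ord0)) /\
  exists C : R, forall t, `|w t| <= C.

Lemma bounded_control_control w : bounded_control w -> control w.
Proof. by move=> [mw [C hC]]; split => //; exists C; exact: aeW. Qed.

(** Clamping every coordinate to [-|C|, |C|] alters [w] on a null set only. Admissible controls are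
    merely essentially bounded, whereas the calculus of primitives asks for a bound at every time;
    solutions do not see the change. *)
Lemma truncate_control w C : (forall i, measurable_fun setT (fun t => w t i ord0)) ->
  {ae mu, forall t, `|w t| <= C} ->
  exists w', [/\ forall i, measurable_fun setT (fun t => w' t i ord0),
    forall t, `|w' t| <= `|C| & {ae mu, forall t, w t = w' t}].
Proof.
move=> mw hC.
exists (fun t => \col_i Num.max (- `|C|) (Num.min `|C| (w t i ord0))); split=> [i|t|].
- under eq_fun do rewrite mxE.
  by apply: measurable_maxr => //; apply: measurable_minr.
- apply/mx_norm_leP => // i j; rewrite mxE ler_norml.
  by rewrite le_max lexx/= ge_max ge_min lexx/= andbT ge0_cp// oppr_le0.
apply: ae_imply hC => t hC; apply/matrixP => i j; rewrite ord1 mxE.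
have := le_trans (mx_entry_le (w t) i ord0) (le_trans hC (ler_norm C)).
by rewrite ler_norml => /andP[h1 h2]; rewrite (min_idPr h2) (max_idPr h1).
Qed.

Lemma control_truncate w : control w ->
  exists2 w', bounded_control w' & {ae mu, forall t, w t = w' t}.
Proof.
move=> [mw [C hC]]; have [w' [mw' bw' ww']] := truncate_control mw hC.
by exists w' => //; split=> //; exists `|C|.
Qed.

Lemma bounded_control_locally_bounded w i : bounded_control w ->
  locally_bounded (fun t => w t i ord0).
Proof.
move=> [mw [C hC]] T; split.
  apply: measurable_funS (mw i) => //.
by exists C => t _; exact: le_trans (mx_entry_le _ _ _) (hC t).
Qed.

Definition shift_control (t : R) w := fun r => w (t + r).

Definition concat_control (t : R) w v := fun r => if r < t then w r else v (r - t).

Lemma control_shift t w : control w -> control (shift_control t w).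
Proof.
move=> [mw [C hC]]; split => [i|].
  by apply: (measurableT_comp (mw i)); exact: measurable_translation.
by exists C; exact: ae_translation hC.
Qed.

Lemma measurable_concat (t : R) (f g : R -> R) : measurable_fun setT f ->
  measurable_fun setT g ->
  measurable_fun setT (fun r : R => if r < t then f r else g (r - t)).
Proof.
move=> mf mg.
apply: measurable_fun_if => //.
- by apply: measurable_fun_ltr.
- exact: measurable_funS mf.
- apply: (measurable_funS (E := setT)) => //.
  rewrite (_ : (fun r => g (r - t)) = g \o (fun r => - t + r)).
    by apply: measurableT_comp => //; exact: measurable_translation.
  by apply/funext => r /=; rewrite addrC.
Qed.

Lemma control_concat t w v : control w -> control v -> control (concat_control t w v).
Proof.
move=> [mw [C hC]] [mv [C' hC']]; split => [i|].
  rewrite (_ : (fun r => _) = fun r : R => if r < t then w r i ord0 else v (r - t) i ord0).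
    exact: (measurable_concat t (mw i) (mv i)).
  by apply/funext => r; rewrite /concat_control; case: ifP.
exists (Num.max C C'); have := ae_translation (- t) hC'.
apply: ae_imply2 hC => r h1 h2; rewrite /concat_control; case: ifP => _.
  by rewrite le_max h1.
by rewrite addrC le_max h2 orbT.
Qed.

Lemma admissible_concat (U : set 'cV[R]_m) t w v : admissible U w -> admissible U v ->
  admissible U (concat_control t w v).
Proof.
move=> [mw hw] [mv hv]; split => [i|].
  rewrite (_ : (fun r => _) = fun r : R => if r < t then w r i ord0 else v (r - t) i ord0).
    exact: (measurable_concat t (mw i) (mv i)).
  by apply/funext => r; rewrite /concat_control; case: ifP.
have := ae_translation (- t) hv.
apply: ae_imply2 hw => r h1 h2; rewrite /concat_control; case: ifP => // _.
by rewrite addrC.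
Qed.

Lemma admissible_shift (U : set 'cV[R]_m) t w : admissible U w ->
  admissible U (shift_control t w).
Proof.
move=> [mw hw]; split => [i|].
  by apply: (measurableT_comp (mw i)); exact: measurable_translation.
exact: ae_translation hw.
Qed.

Lemma admissible_control (U : set 'cV[R]_m) w : compact U -> admissible U w -> control w.
Proof.
move=> /compact_bounded[C [_ hC]] [mw hw]; split => //.
by exists (C + 1); apply: ae_imply hw => t; apply: hC; rewrite ltrDl.
Qed.

Lemma control_cst c : bounded_control (fun=> c).
Proof. by split => [i|]; [exact: measurable_cst|exists `|c|]. Qed.

End Controls.

(** * Variation of constants: existence, uniqueness and cocycle property *)

Section Flow.
Variables (R : realType) (d m : nat) (A : 'M[R]_d) (B : 'M[R]_(d, m)).
Implicit Types (w v : R -> 'cV[R]_m) (x : 'cV[R]_d).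
Local Notation mu := (@lebesgue_measure R).

Lemma within_continuous_entry (D : set R) p q (phi : R -> 'M[R]_(p, q)) i j :
  {within D, continuous phi} -> {within D, continuous (fun t => phi t i j)}.
Proof.
move=> cphi; apply/subspace_continuousP => s Ds.
have /subspace_continuousP/(_ s Ds) h := cphi.
apply: (@cvg_comp _ _ _ phi (fun M : 'M[R]_(p, q) => M i j) _ _ _ h); exact: coord_continuous.
Qed.

Lemma ord1_ord0 (j : 'I_1) : j = ord0.
Proof. by apply/val_inj; case: j => -[]. Qed.

Definition forcing w (s : R) : 'cV[R]_d := mexp A (- s) *m (B *m w s).

(** The variation-of-constants formula: an explicit function with which the solution picked by
    choice in [sol] is identified for [t >= 0]. *)
Definition flow x w (t : R) : 'cV[R]_d :=
  mexp A t *m (x + \col_i \int[mu]_(s in `[0, t]) forcing w s i ord0).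

Lemma forcing_sum w s i : forcing w s i ord0 =
  \sum_(k < m) (mexp A (- s) *m B) i k * w s k ord0.
Proof. by rewrite /forcing mulmxA mxE. Qed.

Lemma locally_bounded_mexpN p (N : 'M[R]_(d, p)) i j :
  locally_bounded (fun s => (mexp A (- s) *m N) i j).
Proof.
have := primitive_locally_bounded
  (mprimitiveM (mprimitive_mexpN A) (mprimitive_cst N) i j).
by apply: locally_bounded_ext.
Qed.

Lemma measurable_forcing w t i : (forall i, measurable_fun setT (fun t => w t i ord0)) ->
  measurable_fun (`[0, t] : set R) (fun s => forcing w s i ord0).
Proof.
move=> mw; rewrite (_ : (fun s => _) = fun s => \sum_(k < m) (mexp A (- s) *m B) i k * w s k ord0); last first.
  by apply/funext => s; rewrite forcing_sum.
apply: measurable_sum => k; apply: measurable_funM.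
  by have [] := locally_bounded_mexpN B i k t.
exact: measurable_funS (mw k).
Qed.

Lemma flow_ae_eq x w v t : control w -> control v -> {ae mu, forall s, w s = v s} ->
  flow x w t = flow x v t.
Proof.
move=> [mw _] [mv _] wv; rewrite /flow; congr (_ *m (_ + _)).
apply/colP => i; rewrite !mxE; apply: ae_eq_Rintegral => //.
- exact: measurable_forcing.
- exact: measurable_forcing.
- by apply: ae_imply wv => s; rewrite /forcing => ->.
Qed.

Lemma flow0 x w : flow x w 0 = x.
Proof.
rewrite /flow mexp0 mul1mx (_ : \col__ _ = 0) ?addr0//.
by apply/colP => i; rewrite !mxE set_itv1 Rintegral_set1.
Qed.

Lemma locally_bounded_forcing w i : bounded_control w ->
  locally_bounded (fun s => forcing w s i ord0).
Proof.
move=> bw; apply: (@locally_bounded_ext _ (fun s => \sum_(k < m) (mexp A (- s) *m B) i k * w s k ord0)).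
  by move=> t _; rewrite forcing_sum.
apply: locally_bounded_sum => k; apply: locally_boundedM.
  exact: locally_bounded_mexpN.
exact: bounded_control_locally_bounded.
Qed.

Lemma mprimitive_flow x w : bounded_control w ->
  mprimitive (flow x w) (fun t => A *m flow x w t + B *m w t).
Proof.
move=> bw.
have pf : mprimitive (fun t => x + \col_i \int[mu]_(s in `[0, t]) forcing w s i ord0) (forcing w).
  move=> i j; rewrite (ord1_ord0 j); split; first exact: locally_bounded_forcing.
  by move=> t t0; rewrite !mxE set_itv1 Rintegral_set1 addr0.
apply: mprimitive_ext (mprimitiveM (mprimitive_mexp A) pf) => // t _.
by rewrite /forcing [in X in _ + X]mulmxA mexpNK mul1mx mulmxA.
Qed.

Lemma mprimitive_is_solution x w phi : mprimitive phi (fun t => A *m phi t + B *m w t) ->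
  phi 0 = x -> is_solution A B x w phi.
Proof.
move=> pF F0; split.
  apply/subspace_continuousP => t t0; apply: cvg_mxP => i j.
  by have /subspace_continuousP := primitive_within_continuous (pF i j); apply.
by move=> t t0 i; have [_ ->//] := pF i ord0; rewrite F0.
Qed.

Lemma is_solution_ae_eq x w v phi : control w -> control v ->
  {ae mu, forall s, w s = v s} -> is_solution A B x w phi -> is_solution A B x v phi.
Proof.
move=> [mw _] [mv _] wv [cphi phiE]; split=> // t t0 i; rewrite phiE//; congr (_ + _).
have bphi k : locally_bounded (fun t => phi t k ord0).
  exact/continuous_locally_bounded/within_continuous_entry.
have mF (u : R -> 'cV[R]_m) : (forall i, measurable_fun setT (fun t => u t i ord0)) ->
    measurable_fun (`[0, t] : set R) (fun s => (A *m phi s + B *m u s) i ord0).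
  move=> mu; apply: (eq_measurable_fun
    (fun s => \sum_k A i k * phi s k ord0 + \sum_k B i k * u s k ord0)).
    by move=> s _; rewrite !mxE.
  apply: measurable_funD; apply: measurable_sum => k; apply: measurable_funM => //.
    by have [] := bphi k t.
  exact: measurable_funS (mu k).
apply: ae_eq_Rintegral => //; [exact: mF|exact: mF|].
by apply: ae_imply wv => s ->.
Qed.

Lemma flow_is_solution x w : control w -> is_solution A B x w (flow x w).
Proof.
move=> cw; have [w' bw' ww'] := control_truncate cw.
have cw' := bounded_control_control bw'.
have -> : flow x w = flow x w' by apply/funext => t; exact: flow_ae_eq.
apply: (is_solution_ae_eq cw' cw); first by apply: ae_imply ww' => s ->.
by apply: mprimitive_is_solution; [exact: mprimitive_flow|exact: flow0].
Qed.

(** Multiplication by exp(-tA) cancels the linear term, leaving a function with derivative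
    [forcing], which its initial value determines. *)
Lemma is_solution_flow x w phi t : control w -> is_solution A B x w phi -> 0 <= t ->
  phi t = flow x w t.
Proof.
move=> cw sphi t0; have [w' bw' ww'] := control_truncate cw.
have cw' := bounded_control_control bw'.
have [cphi phiE] := is_solution_ae_eq cw cw' ww' sphi.
have bphi i : locally_bounded (fun t => phi t i ord0).
  exact/continuous_locally_bounded/within_continuous_entry.
have pphi : mprimitive phi (fun t => A *m phi t + B *m w' t).
  move=> i j; rewrite (ord1_ord0 j); split.
    apply: (@locally_bounded_ext _ (fun t => \sum_k A i k * phi t k ord0 + \sum_k B i k * w' t k ord0)).
      by move=> s _; rewrite !mxE.
    apply: locally_boundedD; apply: locally_bounded_sum => k; apply: locally_boundedZ => //.
    exact: bounded_control_locally_bounded.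
  by move=> s s0; rewrite phiE// (phiE 0)// set_itv1 Rintegral_set1 addr0.
have pE : mprimitive (fun s => mexp A (- s) *m phi s) (forcing w').
  apply: mprimitive_ext (mprimitiveM (mprimitive_mexpN A) pphi) => // s _.
  by rewrite mulmxDr mulNmx mulmxA mexp_commute addrA addNr add0r.
have -> : phi t = mexp A t *m (mexp A (- t) *m phi t) by rewrite mulmxA mexpNK mul1mx.
rewrite (flow_ae_eq x t cw cw' ww') /flow; congr (_ *m _); apply/colP => i.
have [_ ->//] := pE i ord0; rewrite oppr0 mexp0 mul1mx phiE// set_itv1 Rintegral_set1 addr0.
by rewrite !mxE.
Qed.

Lemma sol_flow x w t : control w -> 0 <= t -> sol A B x w t = flow x w t.
Proof.
move=> cw t0; apply: is_solution_flow => //.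
by apply: (@xgetPex _ _ [set phi | is_solution A B x w phi]); exists (flow x w); exact: flow_is_solution.
Qed.

Lemma flow_affine x w t : flow x w t = mexp A t *m x + flow 0 w t.
Proof. by rewrite /flow add0r mulmxDr. Qed.

Lemma flowB x y w t : flow x w t - flow y w t = mexp A t *m (x - y).
Proof. by rewrite flow_affine (flow_affine y) opprD addrACA subrr addr0 mulmxBr. Qed.

(** The interval is half-open for the sake of concatenation: [concat_control t] already follows its
    second control at time [t]. *)
Lemma flow_local x w v t : control w -> control v ->
  (forall s : R, 0 <= s < t -> w s = v s) -> flow x w t = flow x v t.
Proof.
move=> cw cv wv.
have [w' bw' ww'] := control_truncate cw.
have [v' bv' vv'] := control_truncate cv.
rewrite (flow_ae_eq x t cw (bounded_control_control bw') ww').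
rewrite (flow_ae_eq x t cv (bounded_control_control bv') vv').
rewrite /flow; congr (_ *m (_ + _)); apply/colP => i; rewrite !mxE.
have iw := locally_bounded_integrable t (locally_bounded_forcing i bw') (lexx 0).
have iv := locally_bounded_integrable t (locally_bounded_forcing i bv') (lexx 0).
have sub : `[0, t[ `<=` (`[0, t] : set R).
  by move=> s /=; rewrite !in_itv/= => /andP[-> /ltW].
rewrite -!Rintegral_itv_bndo_bndc; [|exact: integrableS iv|exact: integrableS iw].
apply: ae_eq_Rintegral => //.
- by have [mf _] := locally_bounded_forcing i bw' t; apply: measurable_funS mf.
- by have [mf _] := locally_bounded_forcing i bv' t; apply: measurable_funS mf.
- apply: (fun h => ae_imply2 h ww' vv') => s h1 h2 /=; rewrite in_itv/= => st.
  by rewrite /forcing -h1 -h2 wv.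
Qed.

Lemma locally_bounded_shift (f : R -> R) (t : R) : 0 <= t -> locally_bounded f ->
  locally_bounded (fun s => f (t + s)).
Proof.
move=> t0 fP T; have [mf [C hC]] := fP (t + T).
have sub s : 0 <= s <= T -> 0 <= t + s <= t + T.
  by move=> /andP[s0 sT]; rewrite addr_ge0//= lerD2l.
split; last by exists C => s /sub/hC.
apply: (@measurable_comp _ _ _ _ _ _ `[0, t + T]) => //.
  by move=> _ [s + <-]; rewrite /= !in_itv/=; exact: sub.
exact: measurable_funS (measurable_translation t).
Qed.

Lemma flow_shift x w (t s : R) : control w -> 0 <= t -> 0 <= s ->
  flow x w (t + s) = flow (flow x w t) (shift_control t w) s.
Proof.
move=> cw t0 s0; have [w' bw' ww'] := control_truncate cw.
have cw' := bounded_control_control bw'.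
rewrite !(flow_ae_eq _ _ cw cw' ww').
have cs := control_shift t cw; have cs' := control_shift t cw'.
rewrite (flow_ae_eq _ _ cs cs' (ae_translation t ww')).
apply: (@is_solution_flow _ _ (fun s => flow x w' (t + s))) => //.
apply: mprimitive_is_solution; last by rewrite addr0.
move=> i j; have pF := mprimitive_flow x bw' i j; split.
  by case: pF => bF _; exact: (locally_bounded_shift t0 bF).
move=> r r0; have [bF _] := pF.
rewrite -(Rintegral_translation bF)// -(primitive_increment pF) ?t0 ?lerDl//.
by rewrite addr0 addrCA subrr addr0.
Qed.

Lemma flow_concat_left x w v (t s : R) : control w -> control v -> s <= t ->
  flow x (concat_control t w v) s = flow x w s.
Proof.
move=> cw cv st; apply: flow_local => //; first exact: control_concat.
by move=> r /andP[_ rs]; rewrite /concat_control (lt_le_trans rs st).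
Qed.

Lemma flow_concat_right x w v (t s : R) : control w -> control v -> 0 <= t -> 0 <= s ->
  flow x (concat_control t w v) (t + s) = flow (flow x w t) v s.
Proof.
move=> cw cv t0 s0; have cc := control_concat t cw cv.
rewrite flow_shift// flow_concat_left//; apply: flow_local => //.
  exact: control_shift.
move=> r /andP[r0 _]; rewrite /shift_control /concat_control.
by rewrite ltNge lerDl r0/= addrC addKr.
Qed.

Lemma continuous_flow_state w t : continuous (fun x => flow x w t).
Proof.
move=> x; apply: (cvg_mxP (nbhs_filter x)) => i j; rewrite flow_affine mxE.
under eq_fun do rewrite flow_affine mxE.
apply: cvgD; last exact: cvg_cst.
rewrite mxE; under eq_fun do rewrite mxE.
apply: cvg_bigsum => k; apply: cvgMr; exact: coord_continuous.
Qed.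

End Flow.

(** * Triangularization with a prescribed diagonal *)

Section Triangularization.
Variable F : fieldType.

Lemma char_poly_similar n (A M V : 'M[F]_n) : V \in unitmx -> V *m A = M *m V ->
  char_poly M = char_poly A.
Proof.
move=> uV VA; pose W := map_mx (@polyC F) V.
have WA : W *m char_poly_mx A = char_poly_mx M *m W.
  rewrite /char_poly_mx mulmxBr mulmxBl -!map_mxM VA; congr (_ - _).
  by rewrite -scalar_mxC.
have W0 : \det W != 0.
  by rewrite det_map_mx polyC_eq0 -unitfE; move: uV; rewrite unitmxE.
apply: (mulIf W0); rewrite /char_poly -det_mulmx -WA det_mulmx mulrC //.
Qed.

(** A row eigenvector for the first listed eigenvalue becomes the first basis row, so the conjugated
    matrix has first row (z, 0); induction treats the lower right block. The order of the diagonal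
    is free, and the eigenvalues will be sorted by real part. *)
Lemma triangularize n (A : 'M[F]_n) (s : seq F) :
  char_poly A = \prod_(z <- s) ('X - z%:P) ->
  exists P T : 'M[F]_n, [/\ P \in unitmx, P *m A = T *m P,
    forall i j : 'I_n, (i < j)%N -> T i j = 0 & forall i : 'I_n, T i i = s`_i].
Proof.
elim: n A s => [|n IH] A s cA.
  exists 1%:M, A; split; [exact: unitmx1|by rewrite mul1mx mulmx1|by case|by case].
case: s cA => [|z s] cA.
  have := size_char_poly A; rewrite cA big_nil size_poly1 => //.
have /eigenvalueP[v vA v0] : eigenvalue A z.
  by rewrite eigenvalue_root_char cA big_cons rootM root_XsubC eqxx.
(* [row_ebase v] is invertible and its first row is a nonzero multiple of [v]. *)
pose V : 'M[F]_(1 + n) := row_ebase v.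
have uV : V \in unitmx by exact: row_ebase_unit.
pose V0 := usubmx V.
have [c c0 vE] : exists2 c, c != 0 & v = c *: V0.
  have := mulmx_ebase v; have -> : \rank v = 1%N by rewrite rank_rV v0.
  rewrite -[row_ebase v]/V -{1}(vsubmxK V) (_ : pid_mx 1 = row_mx 1%:M 0 :> 'M[F]_(1, 1 + n)); last first.
    apply/matrixP => i j; rewrite !mxE ord1; case: splitP => k jk; rewrite mxE.
      by rewrite !ord1 jk !ord1.
    by rewrite jk.
  have -> : col_ebase v *m row_mx 1%:M 0 *m col_mx (usubmx V) (dsubmx V) = (col_ebase v) 0 0 *: V0.
    rewrite -mulmxA (@mul_row_col _ 1 1 n) mul1mx mul0mx addr0.
    by rewrite [col_ebase v in LHS]mx11_scalar mul_scalar_mx.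
  move=> <-; eexists; last by [].
  apply: contraNneq v0 => h; rewrite -(mulmx_ebase v) [col_ebase v]mx11_scalar h.
  by rewrite (_ : 0%:M = 0) ?mul0mx//; apply/matrixP => i j; rewrite !mxE mul0rn.
have V0A : V0 *m A = z *: V0.
  apply: (scalerI c0); rewrite scalerA mulrC -scalerA -vE -vA vE.
  by rewrite -scalemxAl.
pose M : 'M[F]_(1 + n) := V *m A *m invmx V.
have VA : V *m A = M *m V by rewrite mulmxKV.
have uM : usubmx M = row_mx z%:M 0.
  rewrite /M -mulmxA -{1}(vsubmxK V) mul_col_mx col_mxKu mulmxA V0A -scalemxAl.
  have -> : V0 *m invmx V = row_mx 1%:M 0.
    have : V *m invmx V = 1%:M by rewrite mulmxV.
    rewrite -{1}(vsubmxK V) mul_col_mx -[RHS]/(@scalar_mx F (1 + n) 1) scalar_mx_block.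
    by rewrite /block_mx => /eq_col_mx[].
  by rewrite scale_row_mx scaler0 scalemx1.
pose N := dlsubmx M; pose Q := drsubmx M.
have ME : M = block_mx z%:M 0 N Q.
  by rewrite -[LHS]vsubmxK uM /block_mx; congr col_mx; rewrite /N /Q hsubmxK.
have cQ : char_poly Q = \prod_(z <- s) ('X - z%:P).
  have := char_poly_similar uV VA; rewrite cA big_cons /char_poly.
  have -> : char_poly_mx M = block_mx ('X - z%:P)%:M 0 (- map_mx polyC N) (char_poly_mx Q).
    rewrite /char_poly_mx ME -[X in X - _]/(@scalar_mx {poly F} (1 + n) 'X).
    rewrite map_block_mx scalar_mx_block opp_block_mx add_block_mx map_mx0 oppr0 addr0 add0r.
    by congr block_mx; apply/matrixP => i j; rewrite !mxE rmorphMn mulrnBl.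
  rewrite (@det_lblock _ 1) det_scalar1 => /mulfI; apply.
  by rewrite polyXsubC_eq0.
have [P [T [uP PQ Tlow Tdiag]]] := IH Q s cQ.
pose P1 : 'M[F]_(1 + n) := block_mx 1%:M 0 0 P.
pose T1 : 'M[F]_(1 + n) := block_mx z%:M 0 (P *m N) T.
exists (P1 *m V), T1; split.
- rewrite unitmx_mul uV andbT unitmxE /P1 (@det_ublock _ 1) det1 mul1r.
  by rewrite -unitmxE.
- rewrite -mulmxA VA [LHS]mulmxA [RHS]mulmxA; congr (_ *m V).
  rewrite -/M ME /P1 /T1 !(@mulmx_block _ 1 n 1 n 1 n) !mulmx0 !mul0mx !mul1mx !mulmx1 ?addr0 ?add0r.
  by rewrite PQ.
- move=> i j; rewrite /T1; case: (@split_ordP 1 n i) => k ->; case: (@split_ordP 1 n j) => l ->.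
  + by rewrite !ord1.
  + by rewrite (@block_mxEur _ 1 n 1 n) mxE.
  + by rewrite !ord1.
  + by rewrite (@block_mxEdr _ 1 n 1 n) /= !add1n ltnS; exact: Tlow.
- move=> i; rewrite /T1; case: (@split_ordP 1 n i) => k ->.
  + by rewrite (@block_mxEul _ 1 n 1 n) !mxE eqxx ord1.
  + by rewrite (@block_mxEdr _ 1 n 1 n) Tdiag.
Qed.

End Triangularization.

(** * Complex scalar equations: trapping and exact growth *)

Section ComplexFunctions.
Variable R : realType.
Local Open Scope complex_scope.
Local Notation C := R[i].
Local Notation cn := (@ComplexField.Normc.normc R).
Implicit Types (z w : C).

Lemma cn_ge0 z : 0 <= cn z.
Proof. by case: z => a b; exact: sqrtr_ge0. Qed.

Lemma cn_sqr z : cn z ^+ 2 = complex.Re z ^+ 2 + complex.Im z ^+ 2.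
Proof. by case: z => a b; rewrite /= sqr_sqrtr// addr_ge0 ?sqr_ge0. Qed.

Lemma cn_le_sqr z (c : R) : 0 <= c -> (cn z <= c) = (complex.Re z ^+ 2 + complex.Im z ^+ 2 <= c ^+ 2).
Proof. by move=> c0; rewrite -cn_sqr ler_sqr// nnegrE cn_ge0. Qed.

Lemma cn_real (r : R) : cn r%:C = `|r|.
Proof. by rewrite /= expr0n addr0 sqrtr_sqr. Qed.

Lemma Re_le_cn z : `|complex.Re z| <= cn z.
Proof. by case: z => a b /=; rewrite -sqrtr_sqr ler_wsqrtr// lerDl sqr_ge0. Qed.

Lemma Im_le_cn z : `|complex.Im z| <= cn z.
Proof. by case: z => a b /=; rewrite -sqrtr_sqr ler_wsqrtr// lerDr sqr_ge0. Qed.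

Lemma cn_le_ReIm z : cn z <= `|complex.Re z| + `|complex.Im z|.
Proof.
rewrite cn_le_sqr ?addr_ge0// sqrrD !real_normK ?num_real//.
by rewrite addrAC lerDl mulrn_wge0// mulr_ge0.
Qed.

Lemma cn_sum (I : Type) (r : seq I) (p : pred I) (f : I -> C) :
  cn (\sum_(i <- r | p i) f i) <= \sum_(i <- r | p i) cn (f i).
Proof.
elim/big_rec2: _ => [|i x y _ h]; first by rewrite ComplexField.Normc.normc0.
by apply: le_trans (le_normcD _ _) _; rewrite lerD2l.
Qed.

Lemma Re_conj_mul z w : `|complex.Re (conjc z * w)| <= cn z * cn w.
Proof.
apply: (le_trans (Re_le_cn _)); rewrite ComplexField.Normc.normcM.
by rewrite (_ : cn (conjc z) = cn z)//; case: z => a b /=; rewrite sqrrN.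
Qed.

Definition cprimitive (Z z : R -> C) :=
  primitive (fun t => complex.Re (Z t)) (fun t => complex.Re (z t)) /\
  primitive (fun t => complex.Im (Z t)) (fun t => complex.Im (z t)).

Lemma cprimitive_ext (Z Z' z z' : R -> C) : (forall t : R, 0 <= t -> Z t = Z' t) ->
  (forall t : R, 0 <= t -> z t = z' t) -> cprimitive Z z -> cprimitive Z' z'.
Proof.
by move=> h h' [p q]; split; [apply: primitive_ext p|apply: primitive_ext q] => t t0;
  rewrite ?h ?h'.
Qed.

Lemma cprimitiveD (Z z Y y : R -> C) : cprimitive Z z -> cprimitive Y y ->
  cprimitive (fun t => Z t + Y t) (fun t => z t + y t).
Proof.
move=> [p q] [p' q']; split.
- apply: primitive_ext (primitiveD p p') => t _ /=; by case: (Z t) (Y t) (z t) (y t) => ? ? [? ?] [? ?] [? ?].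
- apply: primitive_ext (primitiveD q q') => t _ /=; by case: (Z t) (Y t) (z t) (y t) => ? ? [? ?] [? ?] [? ?].
Qed.

Lemma cprimitiveM (Z z Y y : R -> C) : cprimitive Z z -> cprimitive Y y ->
  cprimitive (fun t => Z t * Y t) (fun t => z t * Y t + Z t * y t).
Proof.
move=> [p q] [p' q']; split.
- have := primitiveD (primitiveM p p') (primitiveZ (-1) (primitiveM q q')).
  by apply: primitive_ext => t _; case: (Z t) (Y t) (z t) (y t) => ? ? [? ?] [? ?] [? ?]; rewrite /=; simpc; ring.
- have := primitiveD (primitiveM p q') (primitiveM q p').
  by apply: primitive_ext => t _; case: (Z t) (Y t) (z t) (y t) => ? ? [? ?] [? ?] [? ?]; rewrite /=; simpc; ring.
Qed.

Lemma cprimitive_cst c : cprimitive (fun=> c) (fun=> 0).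
Proof. by split; apply: primitive_cst. Qed.

Lemma cprimitive_real F f : primitive F f -> cprimitive (fun t => (F t)%:C) (fun t => (f t)%:C).
Proof. by move=> p; split => //; exact: primitive_cst. Qed.

Lemma cprimitiveZ c (Z z : R -> C) : cprimitive Z z -> cprimitive (fun t => c * Z t) (fun t => c * z t).
Proof.
move=> p; apply: cprimitive_ext (cprimitiveM (cprimitive_cst c) p) => // t _.
by rewrite mul0r add0r.
Qed.

Lemma cprimitive_sum (I : Type) (r : seq I) (Z z : I -> R -> C) :
  (forall i, cprimitive (Z i) (z i)) ->
  cprimitive (fun t => \sum_(i <- r) Z i t) (fun t => \sum_(i <- r) z i t).
Proof.
move=> p; elim: r => [|i r IH].
  by apply: cprimitive_ext (cprimitive_cst 0) => t _; rewrite big_nil.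
by apply: cprimitive_ext (cprimitiveD (p i) IH) => t _; rewrite big_cons.
Qed.

Lemma primitive_cn2 (Z z : R -> C) : cprimitive Z z ->
  primitive (fun t => cn (Z t) ^+ 2) (fun t => 2 * complex.Re (conjc (Z t) * z t)).
Proof.
move=> [p q]; apply: primitive_ext (primitiveD (primitiveM p p) (primitiveM q q)) => t _.
  by rewrite cn_sqr !expr2.
by case: (Z t) (z t) => a b [a' b']; rewrite /=; simpc; ring.
Qed.

Lemma primitive_shift (F f : R -> R) (t : R) : primitive F f -> 0 <= t ->
  primitive (fun s => F (t + s)) (fun s => f (t + s)).
Proof.
move=> pF t0; have [bF _] := pF; split; first exact: locally_bounded_shift.
move=> r r0.
rewrite -(Rintegral_translation bF)// -(primitive_increment pF) ?t0 ?lerDl//.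
by rewrite addr0 addrCA subrr addr0.
Qed.

Lemma Re_conj_mulD z (l g : C) :
  complex.Re (conjc z * (l * z + g)) = complex.Re l * cn z ^+ 2 + complex.Re (conjc z * g).
Proof. by rewrite cn_sqr; case: z l g => a b [c e] [f h]; rewrite /=; simpc; ring. Qed.

(* If [z' = l z + g] then [(|z|^2)' <= - e (|z|^2 - c^2)], as [2 c |z| <= c^2 + |z|^2]. *)
Lemma trap_stable (Z z g : R -> C) (l : C) (e c T : R) : 0 < e -> 0 <= c ->
  cprimitive Z z ->
  (forall t : R, 0 <= t <= T -> z t = l * Z t + g t /\ cn (g t) <= e * c) ->
  complex.Re l <= - e -> cn (Z 0) <= c ->
  forall t : R, 0 <= t <= T -> cn (Z t) <= c.
Proof.
move=> e0 c0 p hz le Z0 t /andP[t0 tT].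
have pq := primitiveD (primitive_cn2 p) (primitive_cst (- c ^+ 2)).
rewrite -ler_sqr ?nnegrE ?cn_ge0// -subr_le0.
apply: (le_trans (gronwall_le (a := - e) pq t0 _)).
  move=> s /andP[s0 st]; rewrite addr0.
  have [-> gs] := hz s (introT andP (conj s0 (le_trans st tT))).
  rewrite Re_conj_mulD.
  have h1 := le_trans (ler_norm _) (Re_conj_mul (Z s) (g s)).
  have h2 : cn (Z s) * cn (g s) <= cn (Z s) * (e * c) by rewrite ler_wpM2l// cn_ge0.
  have h3 : complex.Re l * cn (Z s) ^+ 2 <= - e * cn (Z s) ^+ 2 by rewrite ler_wpM2r ?sqr_ge0.
  have h4 : 0 <= e * (cn (Z s) - c) ^+ 2 by rewrite mulr_ge0 ?sqr_ge0// ltW.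
  move: h1 h2 h3 h4; set q := cn (Z s); set r := complex.Re (conjc _ * _).
  set b := cn (g s); set L := complex.Re l * _ => h1 h2 h3 h4.
  nra.
by rewrite mulr_ge0_le0 ?expR_ge0// subr_le0 ler_sqr ?nnegrE ?cn_ge0.
Qed.

(** Here (|z|^2 - c^2)' >= e (|z|^2 - c^2), so an excess over the radius [c] at some time would
    persist until [T]. *)
Lemma trap_unstable (Z z g : R -> C) (l : C) (e c T : R) : 0 < e -> 0 <= c ->
  cprimitive Z z ->
  (forall t : R, 0 <= t <= T -> z t = l * Z t + g t /\ cn (g t) <= e * c) ->
  e <= complex.Re l -> cn (Z T) <= c ->
  forall t : R, 0 <= t <= T -> cn (Z t) <= c.
Proof.
move=> e0 c0 p hz le ZT t /andP[t0 tT].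
have := primitive_shift (primitiveD (primitive_cn2 p) (primitive_cst (- c ^+ 2))) t0.
move=> pq; have Tt : 0 <= T - t by rewrite subr_ge0.
rewrite -ler_sqr ?nnegrE ?cn_ge0// -subr_le0.
have := gronwall_ge (a := e) pq Tt; rewrite addr0 (addrC t) subrK => /(_ _) h.
rewrite -(pmulr_rle0 _ (expR_gt0 (e * (T - t)))); apply: (le_trans (h _)); last first.
  by rewrite subr_le0 ler_sqr ?nnegrE ?cn_ge0.
move=> u /andP[u0 ut]; rewrite addr0; set s := t + u.
have [-> gs] : z s = l * Z s + g s /\ cn (g s) <= e * c.
  by apply: hz; rewrite /s addr_ge0//= -lerBrDl.
rewrite Re_conj_mulD.
have h1 : - complex.Re (conjc (Z s) * g s) <= cn (Z s) * cn (g s).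
  by apply: le_trans (Re_conj_mul (Z s) (g s)); rewrite -normrN ler_norm.
have h2 : cn (Z s) * cn (g s) <= cn (Z s) * (e * c) by rewrite ler_wpM2l// cn_ge0.
have h3 : e * cn (Z s) ^+ 2 <= complex.Re l * cn (Z s) ^+ 2 by rewrite ler_wpM2r ?sqr_ge0.
have h4 : 0 <= e * (cn (Z s) - c) ^+ 2 by rewrite mulr_ge0 ?sqr_ge0// ltW.
move: h1 h2 h3 h4; set q := cn (Z s); set r := complex.Re (conjc _ * _).
set b := cn (g s); set L := complex.Re l * _ => h1 h2 h3 h4.
nra.
Qed.

Lemma cn2_exponential (Z z : R -> C) (l : C) (T : R) : cprimitive Z z -> 0 <= T ->
  (forall t : R, 0 <= t <= T -> z t = l * Z t) ->
  cn (Z T) ^+ 2 = expR (2 * complex.Re l * T) * cn (Z 0) ^+ 2.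
Proof.
move=> p T0 hz; have pq := primitive_cn2 p.
have E s : 0 <= s <= T -> 2 * complex.Re (conjc (Z s) * z s) = 2 * complex.Re l * cn (Z s) ^+ 2.
  move=> sT; rewrite hz// -[l * _]addr0 Re_conj_mulD mulr0.
  by rewrite -[complex.Re 0]/0 addr0 mulrA.
apply/le_anti/andP; split.
  by apply: (gronwall_le pq T0) => s sT; rewrite E.
by apply: (gronwall_ge pq T0) => s sT; rewrite E.
Qed.

End ComplexFunctions.

(** * Modes: coordinates in the triangularizing frame *)

Section Modes.
Variables (R : realType) (d : nat).
Local Open Scope complex_scope.
Local Notation C := R[i].
Local Notation cn := (@ComplexField.Normc.normc R).
Variables (A : 'M[R]_d) (P T : 'M[C]_d).
Hypothesis PA : P *m map_mx (real_complex R) A = T *m P.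
Hypothesis Tlow : forall i j : 'I_d, (i < j)%N -> T i j = 0.

Definition mode (x : 'cV[R]_d) j : C := (P *m map_mx (real_complex R) x) j ord0.

Lemma modeD x y j : mode (x + y) j = mode x j + mode y j.
Proof. by rewrite /mode map_mxD mulmxDr mxE. Qed.

Lemma modeB x y j : mode (x - y) j = mode x j - mode y j.
Proof. by rewrite /mode map_mxB mulmxBr !mxE. Qed.

Lemma mode_mul x j : mode (A *m x) j = \sum_k T j k * mode x k.
Proof. by rewrite /mode map_mxM mulmxA PA -mulmxA mxE. Qed.

Lemma cprimitive_mode (phi psi : R -> 'cV[R]_d) j : mprimitive phi psi ->
  cprimitive (fun t => mode (phi t) j) (fun t => mode (psi t) j).
Proof.
move=> p.
have := cprimitive_sum (index_enum 'I_d)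
  (fun k => cprimitiveZ (P j k) (cprimitive_real (p k ord0))).
by apply: cprimitive_ext => t _; rewrite /mode mxE; apply: eq_bigr => k _; rewrite mxE.
Qed.

Lemma cn_mode_le x j : cn (mode x j) <= (\sum_i \sum_k cn (P i k)) * `|x|.
Proof.
rewrite /mode mxE; apply: (le_trans (cn_sum _ _ _)).
have h : \sum_k cn (P j k) <= \sum_i \sum_k cn (P i k).
  rewrite [leRHS](bigD1 j)//= lerDl; apply: sumr_ge0 => i _.
  by apply: sumr_ge0 => k _; exact: cn_ge0.
apply: le_trans (ler_wpM2r (normr_ge0 _) h); rewrite mulr_suml.
apply: ler_sum => k _; rewrite ComplexField.Normc.normcM mxE cn_real.
by rewrite ler_wpM2l ?cn_ge0// mx_entry_le.
Qed.

Lemma lower_sum (z : 'I_d -> C) j :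
  \sum_k T j k * z k = T j j * z j + \sum_(k < d | (k < j)%N) T j k * z k.
Proof.
rewrite (bigD1 j)//=; congr (_ + _).
rewrite [LHS](bigID (fun k : 'I_d => (k < j)%N))/= [X in _ + X]big1 ?addr0.
  by apply: eq_bigl => k; rewrite -(inj_eq val_inj) neq_ltn; case: ltngtP.
move=> k /andP[kj]; rewrite -leqNgt leq_eqVlt eq_sym => /predU1P[/val_inj E|jk].
  by rewrite E eqxx in kj.
by rewrite Tlow// mul0r.
Qed.

(** Weights L^(j+1) with ratio L = (S + G)/e + 1, where S bounds the coupling coefficients: the
    earlier modes and the forcing together contribute at most (S + G) L^j <= e L^(j+1). *)
Lemma mode_constants (e G : R) : 0 < e -> 0 <= G ->
  exists c : nat -> R, (forall j, 1 <= c j) /\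
    forall j : 'I_d, \sum_(k < d | (k < j)%N) cn (T j k) * c k + G <= e * c j.
Proof.
move=> e0 G0; pose S := \sum_i \sum_k cn (T i k).
have S0 : 0 <= S by apply: sumr_ge0 => i _; apply: sumr_ge0 => k _; exact: cn_ge0.
pose L := (S + G) / e + 1.
have L1 : 1 <= L by rewrite lerDr divr_ge0 ?addr_ge0// ltW.
exists (fun j => L ^+ j.+1); split => [j|j]; first exact: exprn_ege1.
have hS : \sum_(k < d | (k < j)%N) cn (T j k) * L ^+ k.+1 <= S * L ^+ j.
  apply: (@le_trans _ _ ((\sum_k cn (T j k)) * L ^+ j)); last first.
    rewrite ler_wpM2r ?exprn_ge0 ?(le_trans ler01)// /S [leRHS](bigD1 j)//= lerDl.
    by apply: sumr_ge0 => i _; apply: sumr_ge0 => k _; exact: cn_ge0.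
  rewrite mulr_suml big_mkcond/=; apply: ler_sum => k _; case: ifP => kj.
    by rewrite ler_wpM2l ?cn_ge0// ler_weXn2l.
  by rewrite mulr_ge0 ?cn_ge0 ?exprn_ge0 ?(le_trans ler01).
have hG : G <= G * L ^+ j by rewrite ler_peMr// exprn_ege1.
apply: (le_trans (lerD hS hG)); rewrite -mulrDl exprS mulrA.
rewrite ler_wpM2r ?exprn_ge0 ?(le_trans ler01)//.
by rewrite /L mulrDr mulr1 mulrCA divff ?gt_eqF// mulr1 lerDl ltW.
Qed.

(* The modes with [Re < 0] are controlled by their initial value, those with [Re > 0] by their
   final value, inductively since the [j]-th mode is forced by the previous ones only. *)
Lemma modes_trapped (e G tau : R) (c : nat -> R) (phi g : R -> 'cV[R]_d) :
  0 < e -> 0 <= tau -> (forall j, 1 <= c j) ->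
  (forall j : 'I_d, \sum_(k < d | (k < j)%N) cn (T j k) * c k + G <= e * c j) ->
  (forall j, e <= `|complex.Re (T j j)|) ->
  mprimitive phi (fun t => A *m phi t + g t) ->
  (forall (t : R) j, 0 <= t <= tau -> cn (mode (g t) j) <= G) ->
  (forall j, complex.Re (T j j) < 0 -> cn (mode (phi 0) j) <= c j) ->
  (forall j, 0 < complex.Re (T j j) -> cn (mode (phi tau) j) <= c j) ->
  forall j (t : R), 0 <= t <= tau -> cn (mode (phi t) j) <= c j.
Proof.
move=> e0 tau0 c1 hc he p hg h0 h1.
have c0 k : 0 <= c k by apply: le_trans (c1 k).
suff h n (j : 'I_d) : (j < n)%N -> forall t : R, 0 <= t <= tau -> cn (mode (phi t) j) <= c j.
  by move=> j t; apply: (h j.+1).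
elim: n j => [//|n IH] j jn.
have pj := cprimitive_mode j p.
pose F t := \sum_(k < d | (k < j)%N) T j k * mode (phi t) k + mode (g t) j.
have hF t : 0 <= t <= tau -> mode (A *m phi t + g t) j = T j j * mode (phi t) j + F t /\
    cn (F t) <= e * c j.
  move=> ttau; split; first by rewrite modeD mode_mul lower_sum addrA.
  apply: (le_trans (le_normcD _ _)); apply: le_trans (hc j); apply: lerD; last exact: hg.
  apply: (le_trans (cn_sum _ _ _)); apply: ler_sum => k kj.
  rewrite ComplexField.Normc.normcM ler_wpM2l ?cn_ge0//; apply: IH => //.
  by rewrite (leq_trans kj)// -ltnS.
have := he j; have [Rj|Rj] := ltP (complex.Re (T j j)) 0.
  rewrite ltr0_norm// lerNr => Rj'; apply: (trap_stable e0 (c0 j) pj hF Rj'); exact: h0.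
rewrite ger0_norm// => Rj'; apply: (trap_unstable e0 (c0 j) pj hF Rj'); apply: h1.
exact: lt_le_trans e0 Rj'.
Qed.

Definition modal_system (z : 'I_d -> R -> C) :=
  forall j, cprimitive (z j) (fun t => \sum_k T j k * z k t).

Lemma modal_system_mexp x : modal_system (fun j t => mode (mexp A t *m x) j).
Proof.
move=> j; have := cprimitive_mode j (mprimitiveM (mprimitive_mexp A) (mprimitive_cst x)).
by apply: cprimitive_ext => // t _; rewrite mulmx0 addr0 -mulmxA mode_mul.
Qed.

Lemma modal_system_comb z y (a : C) : modal_system z -> modal_system y ->
  modal_system (fun j t => z j t + a * y j t).
Proof.
move=> hz hy j; apply: cprimitive_ext (cprimitiveD (hz j) (cprimitiveZ a (hy j))) => // t _.
rewrite mulr_sumr -big_split/=; apply: eq_bigr => k _; ring.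
Qed.

(** Modes that vanish initially together with all their predecessors vanish for ever, so the j-th
    equation is left without forcing and its modulus grows exactly exponentially. *)
Lemma modal_leading z (j : 'I_d) t : modal_system z -> 0 <= t ->
  (forall k : 'I_d, (k < j)%N -> z k 0 = 0) ->
  cn (z j t) ^+ 2 = expR (2 * complex.Re (T j j) * t) * cn (z j 0) ^+ 2.
Proof.
move=> hz; elim: {j}(nat_of_ord j).+1 {-2}j (ltnSn j) t => [//|n IH] j jn t t0 z0.
apply: (cn2_exponential (hz j) t0) => s /andP[s0 _].
rewrite lower_sum big1 ?addr0// => k kj.
have : cn (z k s) ^+ 2 = 0.
  rewrite (IH k)//; first by rewrite z0// ComplexField.Normc.normc0 expr0n mulr0.
    by rewrite (leq_trans kj)// -ltnS.
  by move=> l lk; apply: z0; exact: ltn_trans kj.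
by move/eqP; rewrite sqrf_eq0 => /eqP/ComplexField.Normc.eq0_normc ->; rewrite mulr0.
Qed.

(** The positive part appears because contracting directions need no refinement in time. The surplus
    [e] makes the renormalized mode contract at rate at least [e], which absorbs the coupling. *)
Definition growth_rate (e : R) (j : 'I_d) := Num.max 0 (complex.Re (T j j)) + e.

(* [y j t = exp (- mu_j t) * z j t] is forced by less than [e c_j r exp (- tau mu_j)],
   because [mu_k >= mu_j] for [k <= j]. *)
Lemma modal_growth z (e r tau : R) (c : nat -> R) : modal_system z -> 0 < e -> 0 <= r ->
  0 <= tau -> (forall j, 1 <= c j) ->
  (forall j : 'I_d, \sum_(k < d | (k < j)%N) cn (T j k) * c k <= e * c j) ->
  (forall j k : 'I_d, (j <= k)%N -> complex.Re (T k k) <= complex.Re (T j j)) ->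
  (forall j, cn (z j 0) <= c j * r * expR (- (tau * growth_rate e j))) ->
  forall j, cn (z j tau) <= c j * r.
Proof.
move=> hz e0 r0 tau0 c1 hc hmono hz0.
have c0 k : 0 <= c k by apply: le_trans (c1 k).
pose mu := growth_rate e; pose y (j : 'I_d) (t : R) := (expR (- mu j * t))%:C * z j t.
pose b (j : 'I_d) := c j * r * expR (- (tau * mu j)).
have b0 j : 0 <= b j by rewrite !mulr_ge0 ?expR_ge0.
have py j : cprimitive (y j) (fun t => (- mu j * expR (- mu j * t))%:C * z j t +
    (expR (- mu j * t))%:C * (\sum_k T j k * z k t)).
  exact: cprimitiveM (cprimitive_real (primitive_expR (- mu j))) (hz j).
suff h n (j : 'I_d) : (j < n)%N -> forall t : R, 0 <= t <= tau -> cn (y j t) <= b j.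
  move=> j; have := h j.+1 j (ltnSn _) tau; rewrite lexx tau0 => /(_ isT).
  rewrite /y ComplexField.Normc.normcM cn_real ger0_norm ?expR_ge0// /b mulrC mulNr mulrC (mulrC _ tau).
  by rewrite [leLHS]mulrC ler_pM2r ?expR_gt0.
elim: n j => [//|n IH] j jn t ttau.
pose F t := (expR (- mu j * t))%:C * \sum_(k < d | (k < j)%N) T j k * z k t.
apply: (@trap_stable _ (y j) _ F (T j j - (mu j)%:C) e _ tau e0 (b0 j) (py j)) => //; last 2 first.
- have -> : complex.Re (T j j - (mu j)%:C) = complex.Re (T j j) - mu j by case: (T j j).
  by rewrite /mu /growth_rate opprD addrA gerDr subr_le0 le_max lexx orbT.
- by rewrite /y mulr0 expR0 mul1r; exact: hz0.
move=> {ttau}s /andP[s0 stau]; split.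
  rewrite lower_sum /y /F mulNr rmorphN rmorphM/=; ring.
rewrite /F ComplexField.Normc.normcM cn_real ger0_norm ?expR_ge0//.
apply: (@le_trans _ _ ((\sum_(k < d | (k < j)%N) cn (T j k) * c k) * (r * expR (- (tau * mu j))))); last first.
  rewrite /b -!mulrA mulrA; rewrite ler_wpM2r ?mulr_ge0 ?expR_ge0//.
apply: le_trans (ler_wpM2l (expR_ge0 _) (cn_sum _ _ _)) _.
rewrite mulr_sumr mulr_suml; apply: ler_sum => k kj.
rewrite ComplexField.Normc.normcM mulrCA -mulrA ler_wpM2l ?cn_ge0//.
have := IH k (leq_trans kj jn) s; rewrite s0 stau => /(_ isT).
rewrite /y /b ComplexField.Normc.normcM cn_real ger0_norm ?expR_ge0// => hk.
have -> : expR (- mu j * s) = expR ((mu k - mu j) * s) * expR (- mu k * s).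
  by rewrite -expRD; congr expR; ring.
rewrite -mulrA; apply: (le_trans (ler_wpM2l (expR_ge0 _) hk)).
rewrite mulrCA -expRD -mulrA ler_wpM2l// ler_wpM2l//.
rewrite ler_expR.
have mkj : mu j <= mu k.
  rewrite lerD2r ge_max le_max lexx/= le_max hmono ?orbT//; exact: ltnW.
have : s * (mu k - mu j) <= tau * (mu k - mu j) by rewrite ler_wpM2r ?subr_ge0.
rewrite !mulrBr; lra.
Qed.

End Modes.

(** * Controllability Gramian and steering with small controls *)

Section Steering.
Variables (R : realType) (d m : nat) (A : 'M[R]_d) (B : 'M[R]_(d, m)).
Local Notation mu := (@lebesgue_measure R).

Lemma unitmx_inj (F : fieldType) n (M : 'M[F]_n) :
  (forall x : 'cV[F]_n, M *m x = 0 -> x = 0) -> M \in unitmx.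
Proof.
move=> h; rewrite -unitmx_tr -row_free_unit -kermx_eq0; apply/eqP/row_matrixP => i.
rewrite row0 -[LHS]trmxK; have := h (row i (kermx M^T))^T.
move=> ->; first by rewrite trmx0.
by rewrite -{1}[M]trmxK -trmx_mul -row_mul mulmx_ker row0 trmx0.
Qed.

Lemma primitive_locally_cst (F f : R -> R) (t eta c : R) : primitive F f ->
  {for t, continuous f} -> 0 < t < eta ->
  (forall s : R, 0 < s < eta -> F s = c) -> f t = 0.
Proof.
move=> [fP FE] cf /andP[t0 teta] Fc.
have iF := locally_bounded_integrable eta fP (lexx 0).
have [_ <-] := continuous_FTC1_closed teta iF t0 cf.
have H : \forall s \near t,
    (fun s => \int[mu]_(r in `[0, s]) f r : R^o) s = (cst (c - F 0) : R -> R^o) s.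
  near=> s.
  have s0 : 0 < s by near: s; exact: lt_nbhsr.
  have seta : s < eta by near: s; exact: lt_nbhsl.
  by rewrite /cst -(Fc s) ?s0// FE ?ltW// [RHS]addrC addKr.
by rewrite derive1E (near_eq_derive _ H) derive_cst.
Unshelve. all: by end_near.
Qed.

Definition impulse (s : R) : 'M[R]_(d, m) := mexp A (- s) *m B.

Lemma continuous_mulmx_entry p q r (F : R -> 'M[R]_(p, q)) (G : R -> 'M[R]_(q, r)) :
  (forall i j, continuous (fun t => F t i j)) -> (forall i j, continuous (fun t => G t i j)) ->
  forall i j, continuous (fun t => (F t *m G t) i j).
Proof.
move=> cF cG i j t.
have -> : (fun t => (F t *m G t) i j) = fun t => \sum_k F t i k * G t k j.
  by apply/funext => s; rewrite mxE.
rewrite /continuous_at.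
by apply: cvg_bigsum => k; apply: cvgM; [exact: cF|exact: cG].
Qed.

Lemma continuous_cst_entry p q (M : 'M[R]_(p, q)) i j : continuous (fun _ : R => M i j).
Proof. by move=> t; exact: cvg_cst. Qed.

Lemma continuous_mexpN i j : continuous (fun t => mexp A (- t) i j).
Proof.
move=> t; apply: (@continuous_comp _ _ _ -%R (fun t => mexp A t i j)).
  exact: opp_continuous.
exact: continuous_mexp_entry.
Qed.

Lemma continuous_impulse i j : continuous (fun t => impulse t i j).
Proof.
apply: continuous_mulmx_entry => k l; first exact: continuous_mexpN.
exact: continuous_cst_entry.
Qed.

Definition gramian (t : R) : 'M[R]_d :=
  \matrix_(i, j) \int[mu]_(s in `[0, t]) (impulse s *m (impulse s)^T) i j.

Lemma mprimitive_gramian : mprimitive gramian (fun s => impulse s *m (impulse s)^T).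
Proof.
move=> i j; split.
  apply: continuous_locally_bounded; apply: continuous_subspaceT.
  apply: continuous_mulmx_entry => k l; first exact: continuous_impulse.
  by under eq_fun do rewrite mxE; exact: continuous_impulse.
by move=> t t0; rewrite !mxE set_itv1 Rintegral_set1 add0r.
Qed.

Lemma controllable_orthogonal (q : 'rV[R]_d) : controllable A B ->
  (forall k, q *m (A ^+ k *m B) = 0) -> q = 0.
Proof.
rewrite /controllable => ctrl qAB.
set S := (\sum_(k < d) _)%MS in ctrl.
have SK : (S <= kermx q^T)%MS.
  apply/sumsmx_subP => k _; rewrite genmxE; apply/sub_kermxP.
  by rewrite -trmx_mul qAB trmx0.
have : (1%:M <= kermx q^T)%MS.
  apply: submx_trans SK; rewrite sub1mx /row_full; exact/eqP.
by move/sub_kermxP; rewrite mul1mx => /(congr1 trmx); rewrite trmxK trmx0.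
Qed.

(** If W x = 0, the nondecreasing function x^T W(r) x vanishes on [0, eta], hence so does its
    derivative, the squared length of x^T exp(-sA) B. Differentiating repeatedly gives x^T exp(-sA)
    A^k B = 0 for all k, and the Kalman condition forces x = 0. *)
Lemma gramian_unit (eta : R) : controllable A B -> 0 < eta -> gramian eta \in unitmx.
Proof.
move=> ctrl eta0; apply: unitmx_inj => x Wx.
pose g k (s : R) : 'rV[R]_m := x^T *m (mexp A (- s) *m (A ^+ k *m B)).
have pg k : mprimitive (g k) (fun s => - g k.+1 s).
  have := mprimitiveM (mprimitive_cst x^T)
    (mprimitiveM (mprimitive_mexpN A) (mprimitive_cst (A ^+ k *m B))).
  apply: mprimitive_ext => // t _.
  rewrite mul0mx add0r mulmx0 addr0 mulNmx mulmxN /g exprS -[A * _]/(A *m _).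
  by rewrite mexp_commute !mulmxA.
have cg k i j : continuous (fun s => g k s i j).
  apply: continuous_mulmx_entry => u v; first exact: continuous_cst_entry.
  apply: continuous_mulmx_entry => u' v'; first exact: continuous_mexpN.
  exact: continuous_cst_entry.
have g0 s : 0 < s < eta -> g 0 s = 0.
  move=> s_eta.
  pose h (r : R) := (g 0 r *m (g 0 r)^T) ord0 ord0.
  pose H (r : R) := (x^T *m (gramian r *m x)) ord0 ord0.
  have pH : primitive H h.
    have := mprimitiveM (mprimitive_cst x^T) (mprimitiveM mprimitive_gramian (mprimitive_cst x)) ord0 ord0.
    apply: primitive_ext => // r _; rewrite mul0mx add0r mulmx0 addr0 /h /g expr0 mul1mx.
    by rewrite !trmx_mul trmxK !mulmxA.
  have h_ge0 r : 0 <= h r.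
    by rewrite /h mxE; apply: sumr_ge0 => k _; rewrite [X in _ * X]mxE -expr2 sqr_ge0.
  have Hmono a b : 0 <= a <= b -> H a <= H b.
    move=> ab; rewrite -subr_ge0 (primitive_increment pH ab).
    by apply: Rintegral_ge0.
  have H0 : H 0 = 0.
    rewrite /H (_ : gramian 0 = 0) ?mul0mx ?mulmx0 ?mxE//.
    by apply/matrixP => i j; rewrite !mxE set_itv1 Rintegral_set1.
  have Heta : H eta = 0 by rewrite /H Wx mulmx0 mxE.
  have HE r : 0 < r < eta -> H r = 0.
    move=> /andP[r0 reta]; apply/le_anti/andP; split.
      by rewrite -Heta Hmono// (ltW r0) ltW.
    by rewrite -[leLHS]H0 Hmono// lexx ltW.
  have : h s = 0.
    apply: (primitive_locally_cst pH _ s_eta HE).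
    apply: continuous_mulmx_entry => u v; first exact: cg.
    by under eq_fun do rewrite mxE; exact: cg.
  rewrite /h mxE => /eqP; rewrite psumr_eq0 => [/allP hs|k _]; last first.
    by rewrite [X in _ * X]mxE -expr2 sqr_ge0.
  apply/rowP => k; rewrite [RHS]mxE; have := hs k (mem_index_enum _).
  by rewrite [X in _ * X]mxE -expr2 sqrf_eq0 => /eqP.
have gk k s : 0 < s < eta -> g k s = 0.
  elim: k s => [|k IH] s s_eta; first exact: g0.
  apply/rowP => j; rewrite [RHS]mxE.
  have := primitive_locally_cst (pg k ord0 j) _ s_eta.
  move=> /(_ 0) h; apply/eqP; rewrite -oppr_eq0; apply/eqP.
  suff : (- g k.+1 s) ord0 j = 0 by rewrite [LHS]mxE.
  apply: h; last by move=> r r_eta; rewrite IH// mxE.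
  have -> : (fun t => (- g k.+1 t) ord0 j) = fun t => - (g k.+1 t ord0 j).
    by apply/funext => t; rewrite mxE.
  by apply: continuousN; exact: cg.
(* The identities hold on the open interval only, so they are used at its midpoint. *)
have q0 : x^T *m mexp A (- (eta / 2)) = 0.
  apply: controllable_orthogonal => // k; rewrite -mulmxA; apply: gk.
  by rewrite divr_gt0//= ltr_pdivrMr// ltr_pMr// ltr1n.
apply: trmx_inj; rewrite trmx0 -[LHS]mulmx1 -(mexpKN A (eta / 2)) mulmxA q0.
by rewrite mul0mx.
Qed.

(** The minimum-energy control, the transpose of [impulse s] applied to W^-1 exp(-eta A) c. It
    depends linearly on the target, which gives the bound proportional to [|c|]. *)
Lemma steering (eta : R) : controllable A B -> 0 < eta ->
  exists2 k : R, 0 < k & forall c : 'cV[R]_d, exists v : R -> 'cV[R]_m,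
    [/\ bounded_control v, forall s, `|v s| <= k * `|c| & flow A B 0 v eta = c].
Proof.
move=> ctrl eta0; have uW := gramian_unit ctrl eta0.
pose N s : 'M[R]_(m, d) := (impulse s)^T *m (invmx (gramian eta) *m mexp A (- eta)).
have cN i j : continuous (fun s => N s i j).
  apply: continuous_mulmx_entry => u v; last exact: continuous_cst_entry.
  by under eq_fun do rewrite mxE; exact: continuous_impulse.
have [k k0 hk] : exists2 k, 0 < k & forall s : R, 0 <= s <= eta -> `|N s| <= k.
  have /choice[b hb] (ij : 'I_m * 'I_d) : exists C, forall s : R, 0 <= s <= eta -> `|N s ij.1 ij.2| <= C.
    by apply: continuous_itv_bounded; exact: continuous_subspaceT.
  exists (1 + \sum_ij `|b ij|); first by rewrite ltr_pwDl// sumr_ge0.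
  move=> s s_eta; apply/mx_norm_leP => [|i j]; first by rewrite addr_ge0// sumr_ge0.
  apply: (le_trans (hb (i, j) s s_eta)); apply: (le_trans (ler_norm _)).
  rewrite (bigD1 (i, j))//= addrCA lerDl addr_ge0// sumr_ge0//.
(* Clamping the time to [0, eta] keeps the control bounded and continuous on the whole line without
   changing it where it acts. *)
pose cl (s : R) := Num.max 0 (Num.min eta s).
have clP s : 0 <= cl s <= eta.
  by rewrite /cl le_max lexx/= ge_max ge_min lexx (ltW eta0).
exists (1 + d%:R * k); first by rewrite ltr_pwDl// mulr_ge0// ltW.
move=> c; exists (fun s => N (cl s) *m c).
have bd s : `|N (cl s) *m c| <= (1 + d%:R * k) * `|c|.
  apply: (le_trans (mulmx_norm_le _ _)); rewrite ler_wpM2r//.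
  by apply: (@le_trans _ _ (d%:R * k)); rewrite ?lerDr// ler_wpM2l// hk.
split => //.
  split=> [i|]; last by exists ((1 + d%:R * k) * `|c|).
  apply: continuous_measurable_fun => s.
  apply: (@continuous_comp _ _ _ cl (fun r => (N r *m c) i ord0)).
    apply: continuous_max; first exact: cvg_cst.
    by apply: continuous_min; [exact: cvg_cst|exact: cvg_id].
  by apply: continuous_mulmx_entry => // u v; exact: continuous_cst_entry.
pose b := invmx (gramian eta) *m mexp A (- eta) *m c.
have pW := mprimitiveM mprimitive_gramian (mprimitive_cst b).
rewrite /flow add0r (_ : \col__ _ = gramian eta *m b).
  by rewrite /b !mulmxA -(mulmxA _ _ (invmx _)) mulmxV// mulmx1 mexpNK mul1mx.
apply/colP => i; have [_ ->] := pW i ord0; last exact: ltW.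
rewrite (_ : gramian 0 = 0) ?mul0mx ?[in RHS]mxE; last first.
  by apply/matrixP => u v; rewrite !mxE set_itv1 Rintegral_set1.
rewrite add0r [LHS]mxE; apply: eq_Rintegral => s; rewrite inE/= in_itv/= => s_eta.
rewrite mulmx0 addr0 /forcing; have -> : cl s = s.
  by rewrite /cl; case/andP: s_eta => s0 s1; rewrite min_r// max_r.
by rewrite /N /b /impulse !mulmxA.
Qed.

End Steering.

Lemma flow_zero (R : realType) d m (A : 'M[R]_d) (B : 'M[R]_(d, m)) (t : R) :
  flow A B 0 (fun=> 0) t = 0.
Proof.
rewrite /flow add0r (_ : \col__ _ = 0) ?mulmx0//; apply/colP => i; rewrite !mxE.
rewrite (_ : (fun s => _) = fun=> 0) ?Rintegral_cst ?mul0r//.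
by apply/funext => s; rewrite /forcing !mulmx0 mxE.
Qed.

(** * Control sets: absorption, local controllability, interior points *)

Section ControlSets.
Local Opaque flow mexp.
Variables (R : realType) (d m : nat) (A : 'M[R]_d) (B : 'M[R]_(d, m)).
Variables (U : set 'cV[R]_m) (D : set 'cV[R]_d).
Hypotheses (ctrlAB : controllable A B) (cptU : compact U) (U0 : nbhs (0 : 'cV[R]_m) U).
Hypothesis hD : control_set A B U D.
Local Notation flow := (flow A B).
Local Notation reach := (reach A B U).
Implicit Types (x y z p q : 'cV[R]_d) (w v : R -> 'cV[R]_m).

Lemma adm_control w : admissible U w -> control w.
Proof. exact: admissible_control. Qed.

Lemma adm_sol x w (t : R) : admissible U w -> 0 <= t -> sol A B x w t = flow x w t.
Proof. by move=> /adm_control; exact: sol_flow. Qed.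

Lemma reachP x y : reach x y <-> exists w, admissible U w /\ exists t, 0 <= t /\ y = flow x w t.
Proof.
split=> -[w [Uw [t [t0 ->]]]]; exists w; split => //; exists t; split => //.
  exact: adm_sol.
by rewrite adm_sol.
Qed.

Lemma reach_flow x w (t : R) : admissible U w -> 0 <= t -> reach x (flow x w t).
Proof. by move=> Uw t0; apply/reachP; exists w; split=> //; exists t. Qed.

Lemma flow_concat x w v (t s : R) : admissible U w -> admissible U v -> 0 <= t -> 0 <= s ->
  flow x (concat_control t w v) (t + s) = flow (flow x w t) v s.
Proof. by move=> /adm_control cw /adm_control cv; exact: flow_concat_right. Qed.

Lemma reach_trans x y z : reach x y -> reach y z -> reach x z.
Proof.
move=> /reachP[w [Uw [t [t0 ->]]]] /reachP[v [Uv [s [s0 ->]]]].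
by rewrite -flow_concat//; apply: reach_flow; [exact: admissible_concat|exact: addr_ge0].
Qed.

(** A control steering [y] near [z] does the same from all points near [y], by continuity in the
    initial state, and some of these are reached from [x]. *)
Lemma closure_reach_trans x y z : closure (reach x) y -> closure (reach y) z ->
  closure (reach x) z.
Proof.
move=> xy yz V /nbhs_interior Vz.
have [_ [/reachP[w [Uw [t [t0 ->]]]]]] := yz _ Vz.
move=> h; have Vy := (@continuous_flow_state _ _ _ A B w t y) _ h.
have [y' [xy' Vy']] := xy _ Vy.
exists (flow y' w t); split => //.
exact: reach_trans xy' (reach_flow _ Uw t0).
Qed.

Lemma stay_in_control_set x : D x -> exists2 w, admissible U w & forall t : R, 0 <= t -> D (flow x w t).
Proof.
move=> Dx; have [[h _] _] := hD; have [w [Uw wD]] := h _ Dx.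
by exists w => // t t0; rewrite -adm_sol//; exact: wD.
Qed.

Lemma control_set_reach x y : D x -> D y -> closure (reach x) y.
Proof. by move=> Dx; have [[_ h] _] := hD; exact: h. Qed.

(* By maximality: adding the trajectory from [y] to [D] would give a larger set with the
   defining properties of a control set. *)
Lemma control_set_absorbs x y w (T : R) : D x -> closure (reach x) y -> admissible U w ->
  0 <= T -> D (flow y w T) -> forall s, 0 <= s <= T -> D (flow y w s).
Proof.
move=> Dx xy Uw T0 DT.
pose D' := D `|` [set flow y w s | s in [set s : R | 0 <= s <= T]].
have cw := adm_control Uw.
suff -> : D = D' by move=> s sT; right; exists s.
apply/esym; have [_ maxD] := hD; apply: maxD; last by move=> z; left.
split.
  move=> z [Dz|[s /= /andP[s0 sT] <-]].
    have [v Uv vD] := stay_in_control_set Dz.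
    by exists v; split => // t t0; left; rewrite adm_sol//; exact: vD.
  have [v Uv vD] := stay_in_control_set DT.
  have Us := admissible_shift s Uw; have Ts : 0 <= T - s by rewrite subr_ge0.
  have Uc := admissible_concat (T - s) Us Uv.
  exists (concat_control (T - s) (shift_control s w) v); split => // t t0.
  rewrite adm_sol//; have [tT|/ltW Tt] := leP t (T - s).
    right; exists (s + t) => /=; first by rewrite addr_ge0//= -lerBrDl.
    by rewrite flow_concat_left//; [rewrite flow_shift|exact: adm_control..].
  left; have -> : t = (T - s) + (t - (T - s)) by rewrite addrC subrK.
  have tT : 0 <= t - (T - s) by rewrite subr_ge0.
  rewrite (flow_concat _ Us Uv Ts tT) -(flow_shift _ _ _ cw s0 Ts) (addrC s) subrK.
  exact: vD.
move=> z D'z z' D'z'.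
have [q Dq zq] : exists2 q, D q & reach z q.
  case: D'z => [Dz|[s /= /andP[s0 sT] <-]].
    by exists z => //; rewrite -{2}(flow0 A B z w); exact: reach_flow.
  exists (flow y w T) => //; have -> : T = s + (T - s) by rewrite addrC subrK.
  rewrite flow_shift ?subr_ge0//; apply: reach_flow; rewrite ?subr_ge0//.
  exact: admissible_shift.
apply: closure_reach_trans (subset_closure zq) _.
apply: closure_reach_trans (control_set_reach Dq Dx) _.
case: D'z' => [|[s /= /andP[s0 sT] <-]]; first exact: control_set_reach.
apply: closure_reach_trans xy _; apply: subset_closure; exact: reach_flow.
Qed.

Lemma control_set_no_return x w (T : R) : D x -> admissible U w -> 0 <= T ->
  D (flow x w T) -> forall s, 0 <= s <= T -> D (flow x w s).
Proof.
move=> Dx Uw T0 DT.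
exact: (control_set_absorbs Dx (control_set_reach Dx Dx) Uw T0 DT).
Qed.

Lemma U_ball : exists2 r : R, 0 < r & forall u, `|u| < r -> U u.
Proof.
have [r /= r0 h] := (nbhs_ballP _ _).1 U0; exists r => // u ur; apply: h.
by rewrite mx_norm_ball /ball_ /= sub0r normrN.
Qed.

Lemma admissible_cst u : U u -> admissible U (fun=> u).
Proof. by move=> Uu; split => [i|]; [exact: measurable_cst|exact: aeW]. Qed.

Lemma small_steering (eta : R) : 0 < eta -> exists2 r : R, 0 < r &
  forall c, `|c| < r -> exists2 v, admissible U v & flow 0 v eta = c.
Proof.
move=> eta0; have [k k0 hk] := steering ctrlAB eta0.
have [r r0 hr] := U_ball; exists (r / k); first exact: divr_gt0.
move=> c cr; have [v [[mv _] vc flc]] := hk c.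
exists v => //; split => //; apply: aeW => t /=; apply: hr.
by apply: le_lt_trans (vc t) _; rewrite mulrC -ltr_pdivlMr.
Qed.

Lemma mulmx_small n (M : 'M[R]_n) (r : R) : 0 < r -> exists2 e : R, 0 < e &
  forall x : 'cV[R]_n, `|x| < e -> `|M *m x| < r.
Proof.
move=> r0; have k0 : 0 < 1 + n%:R * `|M| by rewrite ltr_pwDl// mulr_ge0.
exists (r / (1 + n%:R * `|M|)); first exact: divr_gt0.
move=> x; rewrite ltr_pdivlMr// => h; apply: le_lt_trans h.
by apply: (le_trans (mulmx_norm_le _ _)); rewrite mulrC ler_wpM2l// lerDr.
Qed.

(** The equation for [p] describes a loop that ends with [eta] units of zero control. Replacing that
    zero piece by a small steering control corrects any small error in the start and in the target
    simultaneously. *)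
Lemma local_controllability p w (t eta : R) : admissible U w -> 0 <= t -> 0 < eta ->
  p = mexp A eta *m flow p w t ->
  exists2 r : R, 0 < r & forall x y, `|x - p| < r -> `|y - p| < r -> reach x y.
Proof.
move=> Uw t0 eta0 pE.
have [r r0 hr] := small_steering eta0.
have r20 : 0 < r / 2 by rewrite divr_gt0.
have [e e0 he] := mulmx_small (mexp A (t + eta)) r20.
exists (Num.min e (r / 2)); first by rewrite lt_min e0.
move=> x y; rewrite !lt_min => /andP[xe _] /andP[_ yr].
have [v Uv vE] : exists2 v, admissible U v & flow 0 v eta = y - mexp A eta *m flow x w t.
  apply: hr.
  have -> : y - mexp A eta *m flow x w t = (y - p) - mexp A (t + eta) *m (x - p).
    have -> : mexp A (t + eta) *m (x - p) = mexp A eta *m flow x w t - p.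
      by rewrite mexpD -mulmxA -(flowB A B x p w) mulmxBr -pE.
    by rewrite opprB addrA subrK.
  by apply: le_lt_trans (ler_normB _ _) _; rewrite [ltRHS]splitr ltrD// he.
have -> : y = flow x (concat_control t w v) (t + eta).
  by rewrite flow_concat ?(ltW eta0)// [RHS]flow_affine vE addrC subrK.
by apply: reach_flow; [exact: admissible_concat|rewrite addr_ge0// ltW].
Qed.

(** Every point of the ball lies on a trajectory from a point reachable from [D] back into [D],
    hence is absorbed. *)
Lemma control_set_ball p (r : R) : (forall x y, `|x - p| < r -> `|y - p| < r -> reach x y) ->
  (exists2 x, D x & `|x - p| < r) -> forall y, `|y - p| < r -> D y.
Proof.
move=> h [x Dx xp] y yp.
have /reachP[w [Uw [t [t0 xE]]]] := h y x yp xp.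
rewrite -(flow0 A B y w); apply: (@control_set_absorbs x y w t) => //.
- exact/subset_closure/h.
- by rewrite -xE.
- by rewrite lexx.
Qed.

Lemma interior_normP (X : set 'cV[R]_d) y : interior X y <->
  exists2 r : R, 0 < r & forall z, `|z - y| < r -> X z.
Proof.
split.
  move=> /nbhs_ballP[r /= r0 h]; exists r => // z zy; apply: h.
  by rewrite mx_norm_ball /ball_/= distrC.
move=> [r r0 h]; apply/nbhs_ballP; exists r => //= z.
by rewrite mx_norm_ball /ball_/= distrC; exact: h.
Qed.

Lemma closure_normP (X : set 'cV[R]_d) y (r : R) : closure X y -> 0 < r ->
  exists2 z, X z & `|z - y| < r.
Proof.
move=> Xy r0; have [z [Xz yz]] := Xy _ (nbhsx_ballx y r r0).
by exists z => //; move: yz; rewrite mx_norm_ball /ball_/= distrC.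
Qed.

(* [y] is reached exactly from all points near [exp(-eta A) y], and this point of [D] is
   approximately reachable from [y]. *)
Lemma interior_periodic y : interior D y ->
  exists w T, [/\ admissible U w, 0 < T & flow y w T = y].
Proof.
move=> iDy; have Dy := interior_subset iDy.
have [eta eta0 Dz0] : exists2 eta : R, 0 < eta & D (mexp A (- eta) *m y).
  have [r r0 hr] := (interior_normP _ _).1 iDy.
  have cE : mexp A (- s) *m y @[s --> 0] --> y.
    apply: (cvg_mxP (nbhs_filter _)) => i j.
    have := @continuous_mulmx_entry _ _ _ _ _ _ (@continuous_mexpN _ _ A) (@continuous_cst_entry _ _ _ y) i j.
    by move=> /(_ 0); rewrite /continuous_at oppr0 mexp0 mul1mx.
  have /cvgrPdist_lt/(_ r r0) [e /= e0 he] := cE.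
  have e20 : 0 < e / 2 by rewrite divr_gt0.
  exists (e / 2) => //; apply: hr; rewrite distrC; apply: he => /=.
  by rewrite sub0r normrN gtr0_norm// ltr_pdivrMr// ltr_pMr// ltr1n.
set z0 := mexp A (- eta) *m y in Dz0.
have [r r0 hr] := small_steering eta0.
have [e e0 he] := mulmx_small (mexp A eta) r0.
have [z /reachP[w [Uw [t [t0 zE]]]] ze] := closure_normP (control_set_reach Dy Dz0) e0.
have [v Uv vE] : exists2 v, admissible U v & flow 0 v eta = mexp A eta *m (z0 - z).
  by apply: hr; apply: he; rewrite distrC.
exists (concat_control t w v), (t + eta); split.
- exact: admissible_concat.
- by rewrite ltr_wpDl.
- rewrite flow_concat ?(ltW eta0)// -zE flow_affine vE -mulmxDr addrC subrK.
  by rewrite mulmxA mexpNK mul1mx.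
Qed.

(** * A path of periodic points between two periodic controls *)

Section Homotopy.
Variables (T eta : R) (w1 w0 : R -> 'cV[R]_m) (y : 'cV[R]_d).
Hypotheses (eta0 : 0 < eta) (etaT : eta <= T) (Uw1 : admissible U w1) (Uw0 : admissible U w0).
Hypothesis w00 : forall s : R, T - eta <= s -> w0 s = 0.
Hypothesis uT : 1%:M - mexp A T \in unitmx.
Hypotheses (iDy : interior D y) (yE : flow y w1 T = y).

Let T0 : 0 < T. Proof. exact: lt_le_trans etaT. Qed.

(** Follows [w1] until [th] and then [w0] in its own running time: the shift undoes the restart made
    by concatenation. On [0, T) the path leads from [w0] at [th = 0] to [w1] at [th = T]. *)
Definition switch (th : R) := concat_control th w1 (shift_control th w0).

(** The unique solution of x = exp(TA) x + flow 0 (switch th) T, with the last term expanded in [w0]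
    and [w1] so that its continuity in [th] becomes visible. *)
Let g th := invmx (1%:M - mexp A T) *m
  (flow 0 w0 T + mexp A (T - th) *m (flow 0 w1 th - flow 0 w0 th)).

Lemma admissible_switch th : admissible U (switch th).
Proof. by apply: admissible_concat => //; exact: admissible_shift. Qed.

Lemma switch_periodic th : 0 <= th <= T -> flow (g th) (switch th) T = g th.
Proof.
move=> /andP[th0 thT].
have E : flow 0 (switch th) T = (1%:M - mexp A T) *m g th.
  rewrite /g mulmxA mulmxV// mul1mx.
  have -> : flow 0 w0 T = mexp A (T - th) *m flow 0 w0 th + flow 0 (shift_control th w0) (T - th).
    have := @flow_shift _ _ _ A B 0 w0 th (T - th) (adm_control Uw0) th0.
    by rewrite (addrC th) subrK subr_ge0 => -> //; rewrite flow_affine.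
  have := @flow_concat 0 w1 (shift_control th w0) th (T - th) Uw1 (admissible_shift th Uw0) th0.
  rewrite (addrC th) subrK subr_ge0 => -> //; rewrite flow_affine mulmxBr.
  have gen (V : zmodType) (a b c : V) : c + b = (a + b) + (c - a).
    by rewrite [RHS]addrC -addrA addKr.
  exact: gen.
by rewrite flow_affine E mulmxBl mul1mx addrC subrK.
Qed.

Lemma fixed_point_unique x p w : flow x w T = x -> flow p w T = p -> x = p.
Proof.
move=> xE pE; have h : (1%:M - mexp A T) *m (x - p) = 0.
  by rewrite mulmxBl mul1mx -(flowB A B x p w T) xE pE addrN.
apply/eqP; rewrite -subr_eq0; apply/eqP.
by rewrite -[LHS]mul1mx -(mulVmx uT) -mulmxA h mulmx0.
Qed.

Lemma switch_end : g T = y.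
Proof.
apply: (@fixed_point_unique _ _ (switch T)).
  by rewrite switch_periodic// ltW//= lexx.
rewrite -[RHS]yE; apply: flow_concat_left => //; first exact: adm_control.
by apply: control_shift; exact: adm_control.
Qed.

(** For [th < T] the switched control still vanishes on the last min(eta, T - th) units of the
    period, which is the uncontrolled tail that local correction uses. At [th = T] this fails, and
    the hypothesis on [y] takes over. *)
Lemma switch_local th : 0 <= th < T ->
  exists2 r : R, 0 < r & forall x z, `|x - g th| < r -> `|z - g th| < r -> reach x z.
Proof.
move=> /andP[th0 thT]; pose e := Num.min eta (T - th).
have e0 : 0 < e by rewrite lt_min eta0 subr_gt0.
have eT : e <= T by rewrite ge_min etaT.
have Te : 0 <= T - e by rewrite subr_ge0.
apply: (@local_controllability (g th) (switch th) (T - e) e) => //.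
  exact: admissible_switch.
have cs : control (switch th) by apply: adm_control; exact: admissible_switch.
rewrite -[LHS](@switch_periodic th) ?th0 ?ltW//.
have -> : flow (g th) (switch th) T =
    flow (flow (g th) (switch th) (T - e)) (shift_control (T - e) (switch th)) e.
  by rewrite -flow_shift ?(ltW e0)// subrK.
have -> : flow (flow (g th) (switch th) (T - e)) (shift_control (T - e) (switch th)) e =
    flow (flow (g th) (switch th) (T - e)) (fun=> 0) e.
  apply: flow_local; first exact: control_shift.
    exact/bounded_control_control/control_cst.
  move=> s /andP[s0 se]; rewrite /shift_control /switch /concat_control.
  have h1 : th <= T - e by rewrite lerBrDl -lerBrDr ge_min lexx orbT.
  rewrite ltNge (le_trans h1) ?lerDl//= /shift_control addrC subrK w00//.
  apply: (@le_trans _ _ (T - e)); last by rewrite lerDl.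
  by rewrite lerB// ge_min lexx.
by rewrite flow_affine flow_zero addr0.
Qed.

Lemma within_continuous_switch_point : {within `[0, T], continuous g}.
Proof.
apply/subspace_continuousP => th th0T.
apply: cvg_mxP => i j.
have cflow w : admissible U w ->
    forall k, {within `[0, T], continuous (fun t => flow 0 w t k j)}.
  move=> Uw k; have [cf _] := flow_is_solution A B 0 (adm_control Uw).
  apply: within_continuous_entry; apply: continuous_subspaceW cf => t /=.
  by rewrite !in_itv/= andbT => /andP[].
have cE k l : (mexp A (T - t)) k l @[t --> within `[0, T] (nbhs th)] --> mexp A (T - th) k l.
  apply: cvg_within_filter.
  apply: (@continuous_comp _ _ _ (fun t => T - t) (fun t => mexp A t k l)).
    by apply: cvgB; [exact: cvg_cst|exact: cvg_id].
  exact: continuous_mexp_entry.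
have cD k : (flow 0 w1 t - flow 0 w0 t) k j @[t --> within `[0, T] (nbhs th)] -->
    (flow 0 w1 th - flow 0 w0 th) k j.
  have h1 : flow 0 w1 t k j @[t --> within `[0, T] (nbhs th)] --> flow 0 w1 th k j.
    exact: (subspace_continuousP _ _).1 (cflow _ Uw1 k) th th0T.
  have h0 : flow 0 w0 t k j @[t --> within `[0, T] (nbhs th)] --> flow 0 w0 th k j.
    exact: (subspace_continuousP _ _).1 (cflow _ Uw0 k) th th0T.
  have -> : (fun t => (flow 0 w1 t - flow 0 w0 t) k j) =
      fun t => flow 0 w1 t k j - flow 0 w0 t k j by apply/funext => t; rewrite !mxE.
  have -> : (flow 0 w1 th - flow 0 w0 th) k j = flow 0 w1 th k j - flow 0 w0 th k j.
    by rewrite !mxE.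
  exact: cvgB h1 h0.
have gE t : g t i j = \sum_k invmx (1%:M - mexp A T) i k *
    (flow 0 w0 T k j + \sum_l mexp A (T - t) k l * (flow 0 w1 t - flow 0 w0 t) l j).
  rewrite /g mxE; apply: eq_bigr => k _; congr (_ * _).
  by rewrite mxE; congr (_ + _); rewrite mxE.
change (g t i j @[t --> within `[0, T] (nbhs th)] --> g th i j).
rewrite (funext gE) gE.
apply: cvg_bigsum => k; apply: cvgMr; apply: cvgD; first exact: cvg_cst.
by apply: cvg_bigsum => l; apply: cvgM; [exact: cE|exact: cD].
Qed.

Lemma switch_start : flow (g 0) w0 T = g 0.
Proof.
have := @switch_periodic 0; rewrite lexx (ltW T0) => /(_ isT) {2}<-.
apply: flow_local; [exact: adm_control| |].
  by apply: adm_control; exact: admissible_switch.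
move=> s /andP[s0 _]; rewrite /switch /concat_control ltNge s0/=.
by rewrite /shift_control subr0 add0r.
Qed.

(** A point of the path in the closure of [D] is interior to [D]: for [th < T] a ball of mutually
    reachable points meets [D], and at [T] the point is [y]. So the part of the path in [D] is open,
    closed and nonempty, and connectedness carries membership to the other end. *)
Lemma periodic_interior p : flow p w0 T = p -> interior D p.
Proof.
move=> pE; have -> : p = g 0 by exact: (fixed_point_unique pE switch_start).
pose Z := g @` `[0, T].
have inT th : 0 <= th <= T -> th = T \/ 0 <= th < T.
  by move=> /andP[-> ]; rewrite le_eqVlt => /predU1P[|]; [left|right].
have loc th : 0 <= th <= T -> closure D (g th) -> interior D (g th).
  move=> /inT[->|/switch_local[r r0 hr]]; first by rewrite switch_end.
  move=> /closure_normP/(_ r0)[z Dz zr]; apply/interior_normP; exists r => //.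
  by apply: (control_set_ball hr); exists z.
have Zc : connected Z.
  apply: connected_continuous_connected within_continuous_switch_point.
  exact: segment_connected.
have ZD : Z `&` D = Z.
  apply: Zc.
  - exists (g T); split; first by exists T => //=; rewrite in_itv/= lexx ltW.
    by rewrite switch_end; exact: interior_subset.
  - exists (interior D); first exact: open_interior.
    apply/seteqP; split => [z [[th /=]]|z [Zz /interior_subset //]].
    rewrite in_itv/= => thT <- Dg; split; first by exists th => //=; rewrite in_itv.
    by apply: loc => //; exact: subset_closure.
  - exists (closure D); first exact: closed_closure.
    apply/seteqP; split => [z [Zz Dz]|z [[th /=]]].
      by split => //; exact: subset_closure.
    rewrite in_itv/= => thT <- Dg; split; first by exists th => //=; rewrite in_itv.
    by apply: interior_subset; exact: loc.
apply: loc; first by rewrite lexx ltW.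
apply: subset_closure; have : (Z `&` D) (g 0); last by case.
by rewrite ZD; exists 0 => //=; rewrite in_itv/= lexx ltW.
Qed.

End Homotopy.

Hypothesis uE : forall t : R, 0 < t -> 1%:M - mexp A t \in unitmx.
Hypothesis iD : interior D !=set0.

Lemma admissible0 : admissible U (fun=> 0).
Proof. by apply: admissible_cst; exact: nbhs_singleton. Qed.

(** The homotopy runs from a periodic control through an interior point to the zero control, whose
    periodic point is 0. The target control vanishes throughout, so [eta] may be the whole
    period. *)
Lemma interior0 : interior D 0.
Proof.
have [y iDy] := iD; have [w [T [Uw T0 yE]]] := interior_periodic iDy.
apply: (@periodic_interior T T w (fun=> 0) y) => //.
- exact: admissible0.
- exact: uE.
- exact: flow_zero.
Qed.

(** The homotopy now starts from the zero control and its interior periodic point 0. *)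
Lemma periodic_point_interior (T eta : R) w p : 0 < eta <= T -> admissible U w ->
  (forall s : R, T - eta <= s -> w s = 0) -> flow p w T = p -> interior D p.
Proof.
move=> /andP[eta0 etaT] Uw w0 pE.
apply: (@periodic_interior T eta (fun=> 0) w 0) => //.
- exact: admissible0.
- by apply: uE; exact: lt_le_trans etaT.
- exact: interior0.
- exact: flow_zero.
Qed.

End ControlSets.

(** * Counting grid points by residue classes *)

Section Counting.
Local Open Scope nat_scope.

Lemma card_box d (L : 'I_d -> nat) :
  #|{dffun forall j : 'I_d, 'I_(L j).+1 * 'I_(L j).+1}| = (\prod_j (L j).+1) ^ 2.
Proof.
rewrite card_dep_ffun foldrE big_map big_enum/= -mulnn -big_split/=.
by apply: eq_bigr => j _; rewrite card_prod !card_ord.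
Qed.

Lemma eq_mod_close (a b r : nat) : a <= b + r -> b <= a + r ->
  a %% r.+1 = b %% r.+1 -> a = b.
Proof.
wlog ab : a b / a <= b => [h|].
  by case: (leqP a b) => [/h|/ltnW /h h' ? ? ?]; [apply|apply/esym/h'].
move=> _ bar /eqP; rewrite eq_sym eqn_mod_dvd// => /dvdn_leq h.
apply/eqP; rewrite eqn_leq ab leqNgt; apply/negP => altb.
have := h; rewrite subn_gt0 => /(_ altb); rewrite leqNgt ltnS leq_subLR.
by rewrite bar.
Qed.

(* A block of [psi] is hashed injectively by the residues modulo [r_j + 1]. *)
Lemma grid_count n d (r : 'I_d -> nat) (X : finType) (psi : {ffun 'I_d -> 'I_n * 'I_n} -> X) :
  (forall u u', psi u = psi u' -> u != u' -> exists j, u j != u' j /\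
    [/\ (u j).1 <= (u' j).1 + r j, (u' j).1 <= (u j).1 + r j,
        (u j).2 <= (u' j).2 + r j & (u' j).2 <= (u j).2 + r j]) ->
  n ^ d * n ^ d <= #|X| * (\prod_j (r j).+1) ^ 2.
Proof.
move=> h.
pose f (u : {ffun 'I_d -> 'I_n * 'I_n}) :
    X * {dffun forall j : 'I_d, 'I_(r j).+1 * 'I_(r j).+1} :=
  (psi u, [ffun j : 'I_d => (inord ((u j).1 %% (r j).+1) : 'I_(r j).+1,
                             inord ((u j).2 %% (r j).+1) : 'I_(r j).+1)]).
have injf : injective f.
  move=> u u' [psiE /ffunP resE]; apply/eqP; apply: contraT => uu'.
  have [j [uj [h1 h2 h3 h4]]] := h u u' psiE uu'.
  have := resE j; rewrite !ffunE => -[].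
  rewrite -[X in X = _ -> _]/(inord ((u j).1 %% (r j).+1)).
  move=> /(congr1 val)/=; rewrite !inordK ?ltn_pmod// => e1.
  move=> /(congr1 val)/=; rewrite !inordK ?ltn_pmod// => e2.
  have E1 := eq_mod_close h1 h2 e1; have E2 := eq_mod_close h3 h4 e2.
  case/negP: uj; move: E1 E2; case: (u j) (u' j) => a b [a' b'] /= E1 E2.
  by rewrite (val_inj E1) (val_inj E2).
have := leq_card f injf.
by rewrite card_prod card_box card_ffun card_prod !card_ord expnMn.
Qed.

End Counting.

(** * Recovering norms from modes *)

Section ModeInverse.
Variables (R : realType) (d : nat).
Local Open Scope complex_scope.
Local Notation C := R[i].
Local Notation cn := (@ComplexField.Normc.normc R).
Variable P : 'M[C]_d.
Hypothesis uP : P \in unitmx.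

Definition inverse_bound := \sum_i \sum_j cn (invmx P i j).

Lemma inverse_bound_ge0 : 0 <= inverse_bound.
Proof. by apply: sumr_ge0 => i _; apply: sumr_ge0 => k _; exact: cn_ge0. Qed.

Lemma cn_invmx_le (z : 'cV[C]_d) (k : R) i : (forall j, cn (z j ord0) <= k) -> 0 <= k ->
  cn ((invmx P *m z) i ord0) <= inverse_bound * k.
Proof.
move=> hz k0; rewrite mxE; apply: (le_trans (cn_sum _ _ _)).
apply: (@le_trans _ _ ((\sum_j cn (invmx P i j)) * k)).
  rewrite mulr_suml; apply: ler_sum => j _.
  by rewrite ComplexField.Normc.normcM ler_wpM2l ?cn_ge0.
rewrite ler_wpM2r// /inverse_bound [leRHS](bigD1 i)//= lerDl.
by apply: sumr_ge0 => l _; apply: sumr_ge0 => j _; exact: cn_ge0.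
Qed.

(** Links a complex vector to the pair of real states formed by its real and imaginary parts, which
    are what the control system can act on. *)
Lemma mode_Re_Im (z : 'cV[C]_d) j :
  mode P (map_mx (@complex.Re R) z) j + 'i * mode P (map_mx (@complex.Im R) z) j =
  (P *m z) j ord0.
Proof.
rewrite /mode !mxE mulr_sumr -big_split/=; apply: eq_bigr => k _.
by rewrite !mxE mulrCA -mulrDr -complexE.
Qed.

Lemma norm_le_modes (x y : 'cV[R]_d) (k : R) : 0 <= k ->
  (forall j, cn (mode P x j + 'i * mode P y j) <= k) ->
  `|x| <= inverse_bound * k /\ `|y| <= inverse_bound * k.
Proof.
move=> k0 h; pose z : 'cV[C]_d := \col_j (x j ord0 +i* y j ord0).
have Rez : map_mx (@complex.Re R) z = x by apply/colP => j; rewrite !mxE.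
have Imz : map_mx (@complex.Im R) z = y by apply/colP => j; rewrite !mxE.
have hz i : cn (z i ord0) <= inverse_bound * k.
  have -> : z = invmx P *m (P *m z) by rewrite mulKmx.
  by apply: cn_invmx_le => // j; rewrite -mode_Re_Im Rez Imz.
have ib := mulr_ge0 inverse_bound_ge0 k0.
split; apply/mx_norm_leP => // i j; rewrite (ord1_ord0 j).
  by apply: le_trans (hz i); rewrite -{1}Rez mxE; exact: Re_le_cn.
by apply: le_trans (hz i); rewrite -{1}Imz mxE; exact: Im_le_cn.
Qed.

Lemma mode0 j : mode P 0 j = 0.
Proof. by rewrite /mode map_mx0 mulmx0 mxE. Qed.

Lemma norm_le_mode (x : 'cV[R]_d) (k : R) : 0 <= k -> (forall j, cn (mode P x j) <= k) ->
  `|x| <= inverse_bound * k.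
Proof.
move=> k0 h; suff [] : `|x| <= inverse_bound * k /\ `|0 : 'cV[R]_d| <= inverse_bound * k by [].
by apply: norm_le_modes => // j; rewrite mode0 mulr0 addr0.
Qed.

End ModeInverse.

(** * Boundedness of the control set *)

Section Boundedness.
Variables (R : realType) (d m : nat) (A : 'M[R]_d) (B : 'M[R]_(d, m)).
Variables (U : set 'cV[R]_m) (D : set 'cV[R]_d).
Hypotheses (cptU : compact U) (hD : control_set A B U D) (D0 : D 0).
Local Notation C := R[i].
Local Notation cn := (@ComplexField.Normc.normc R).
Variables (P T : 'M[C]_d) (e : R).
Hypotheses (uP : P \in unitmx) (PA : P *m map_mx (real_complex R) A = T *m P).
Hypothesis Tlow : forall i j : 'I_d, (i < j)%N -> T i j = 0.
Hypotheses (e0 : 0 < e) (he : forall j, e <= `|complex.Re (T j j)|).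

(** Points near [x] are reached from 0, and from there one can return near 0. On such an excursion
    the stable modes are bounded by the start, the unstable ones by the end, uniformly in its
    duration. *)
Lemma control_set_bounded : exists2 M : R, 0 < M & forall x, D x -> `|x| <= M.
Proof.
have [b b0 hb] : exists2 b : R, 0 <= b & forall u, U u -> `|u| <= b.
  have /compact_bounded[b [_ hb]] := cptU.
  exists (`|b| + 1); first by rewrite addr_ge0.
  by apply: hb; rewrite (le_lt_trans (ler_norm b))// ltrDl.
pose S := \sum_i \sum_k cn (P i k).
have S0 : 0 <= S by apply: sumr_ge0 => i _; apply: sumr_ge0 => k _; exact: cn_ge0.
pose G := S * (m%:R * `|B| * b).
have G0 : 0 <= G by rewrite !mulr_ge0.
have [c [c1 hc]] := mode_constants T e0 G0.
have c0 k : 0 <= c k by apply: le_trans (c1 k).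
pose K := \sum_(j < d) c j.
have K0 : 0 <= K by apply: sumr_ge0.
exists (inverse_bound P * K + 1); first by rewrite ltr_wpDl// mulr_ge0// inverse_bound_ge0.
move=> x Dx.
have S10 : 0 < S + 1 by rewrite ltr_wpDl.
pose r := (S + 1)^-1; have r0 : 0 < r by rewrite invr_gt0.
have small y j : `|y| < r -> cn (mode P y j) <= 1.
  move=> yr; apply: (le_trans (cn_mode_le P y j)); rewrite -/S.
  apply: (@le_trans _ _ (S * r)); first by rewrite ler_wpM2l// ltW.
  by rewrite /r ler_pdivrMr// mul1r lerDl.
have r20 : 0 < r / 2 by rewrite divr_gt0.
have [q /reachP[//|w [Uw [t [t0 qE]]]] qr] := closure_normP (control_set_reach hD Dx D0) r20.
(* The return control was chosen for [x]; a point within [s] of [x] still ends near 0 under it. *)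
have [s s0 hs] := mulmx_small (mexp A t) r20.
have s10 : 0 < Num.min s 1 by rewrite lt_min s0 ltr01.
have [y /reachP[//|v [Uv [t' [t'0 yE]]]]] := closure_normP (control_set_reach hD D0 Dx) s10.
rewrite lt_min => /andP[ys y1].
pose W := concat_control t' v w.
have UW : admissible U W by exact: admissible_concat.
have [mW hW] := UW.
have bW : {ae lebesgue_measure, forall t, `|W t| <= b} by apply: ae_imply hW => u; exact: hb.
have [W' [mW' bW' WW']] := truncate_control mW bW.
have bcW' : bounded_control W' by split=> //; exists `|b|.
have WE u : flow A B 0 W u = flow A B 0 W' u.
  apply: flow_ae_eq => //; last exact: bounded_control_control.
  exact: (admissible_control cptU UW).
have Wy : flow A B 0 W t' = y.
  by rewrite yE; apply: flow_concat_left => //; apply: (admissible_control cptU).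
have Wend : `|flow A B 0 W (t' + t)| < r.
  rewrite (flow_concat A B cptU)// -yE.
  have -> : flow A B y w t = mexp A t *m (y - x) + q.
    by rewrite qE -(flowB A B y x w t) subrK.
  rewrite subr0 in qr.
  by apply: le_lt_trans (ler_normD _ _) _; rewrite [ltRHS]splitr ltrD// hs.
have trap := @modes_trapped _ _ A P T PA Tlow e G (t' + t) c _ _ e0 (addr_ge0 t'0 t0) c1 hc he
  (mprimitive_flow A B 0 bcW').
have yb j : cn (mode P y j) <= c j.
  rewrite -Wy WE; apply: trap.
  - move=> u k _; apply: (le_trans (cn_mode_le P _ k)); rewrite -/S /G ler_wpM2l//.
    apply: (le_trans (mulmx_norm_le _ _)); rewrite ler_wpM2l ?mulr_ge0//.
    by rewrite (le_trans (bW' u))// ger0_norm.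
  - by move=> k _; rewrite flow0 mode0 ComplexField.Normc.normc0.
  - by move=> k _; rewrite -WE; apply: le_trans (c1 k); exact: small.
  - by rewrite t'0 lerDl.
have yK : `|y| <= inverse_bound P * K.
  apply: norm_le_mode => // j; apply: (le_trans (yb j)).
  by rewrite /K (bigD1 j)//= lerDl sumr_ge0.
rewrite -(subrK y x); apply: (le_trans (ler_normD _ _)); rewrite addrC lerD//.
by rewrite distrC ltW.
Qed.

End Boundedness.

(** * Lower count: points whose differences stay bounded *)

Section PieceCounting.
Variables (R : realType) (d : nat) (A : 'M[R]_d).
Local Open Scope complex_scope.
Local Notation C := R[i].
Local Notation cn := (@ComplexField.Normc.normc R).
Variables (P T : 'M[C]_d).
Hypotheses (uP : P \in unitmx) (PA : P *m map_mx (real_complex R) A = T *m P).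
Hypothesis Tlow : forall i j : 'I_d, (i < j)%N -> T i j = 0.

Definition unstable_sum := \sum_j Num.max 0 (complex.Re (T j j)).

Definition pair_mode (x y : 'cV[R]_d) j : C := mode P x j + 'i * mode P y j.

Lemma modal_system_pair x y :
  modal_system T (fun j t => pair_mode (mexp A t *m x) (mexp A t *m y) j).
Proof. by apply: modal_system_comb; exact: modal_system_mexp. Qed.

Definition mode_bound := \sum_i \sum_k cn (P i k).

Lemma mode_bound_ge0 : 0 <= mode_bound.
Proof. by apply: sumr_ge0 => i _; apply: sumr_ge0 => k _; exact: cn_ge0. Qed.

Lemma cn_pair_mode x y (k : R) j : `|x| <= k -> `|y| <= k ->
  cn (pair_mode x y j) <= 2 * (mode_bound * k).
Proof.
move=> xk yk; apply: (le_trans (le_normcD _ _)); rewrite mulr_natl mulr2n.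
have h z : `|z| <= k -> cn (mode P z j) <= mode_bound * k.
  by move=> zk; apply: (le_trans (cn_mode_le P z j)); rewrite ler_wpM2l// mode_bound_ge0.
rewrite lerD ?h// ComplexField.Normc.normcM.
by rewrite (_ : cn 'i = 1) ?mul1r ?h//= expr0n/= expr1n add0r sqrtr1.
Qed.

Lemma pair_modeB x y x' y' j :
  pair_mode (x - x') (y - y') j = pair_mode x y j - pair_mode x' y' j.
Proof. by rewrite /pair_mode !modeB; ring. Qed.

Lemma leq_truncn (a b : nat) (v : R) : 0 <= v -> a%:R - b%:R <= v ->
  (a <= b + Num.truncn v)%N.
Proof.
move=> v0 abv; case: (leqP a b) => [ab|/ltnW ba]; first by rewrite (leq_trans ab)// leq_addr.
by rewrite -leq_subLR truncn_ge_nat// natrB.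
Qed.

Lemma nat_sqr_le (a b : nat) : (a * a <= b ^ 2)%N -> (a <= b)%N.
Proof. by rewrite mulnn leq_exp2r. Qed.

Lemma map_ReB (a b : 'cV[C]_d) :
  map_mx (@complex.Re R) (a - b) = map_mx (@complex.Re R) a - map_mx (@complex.Re R) b.
Proof. by apply/matrixP => i j; rewrite !mxE; case: (a i j) (b i j) => ? ? []. Qed.

Lemma map_ImB (a b : 'cV[C]_d) :
  map_mx (@complex.Im R) (a - b) = map_mx (@complex.Im R) a - map_mx (@complex.Im R) b.
Proof. by apply/matrixP => i j; rewrite !mxE; case: (a i j) (b i j) => ? ? []. Qed.

(** The leading mode grows exactly like exp(t Re T_jj) and must still be bounded at [tau], so it was
    small at time 0. For a nonpositive real part the bound at time 0 itself is used, whence the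
    positive part. *)
Lemma pair_mode_leading x y (j : 'I_d) (M tau : R) : 0 <= tau -> 0 <= M ->
  (forall t, 0 <= t <= tau -> `|mexp A t *m x| <= M /\ `|mexp A t *m y| <= M) ->
  (forall k : 'I_d, (k < j)%N -> pair_mode x y k = 0) ->
  cn (pair_mode x y j) <=
    2 * (mode_bound * M) * expR (- (tau * Num.max 0 (complex.Re (T j j)))).
Proof.
move=> tau0 M0 hM hk; set R0 := 2 * _.
have R00 : 0 <= R0 by rewrite !mulr_ge0 ?mode_bound_ge0.
pose Z k t := pair_mode (mexp A t *m x) (mexp A t *m y) k.
have Z0 k : Z k 0 = pair_mode x y k by rewrite /Z mexp0 !mul1mx.
have sysZ : modal_system T Z by exact: modal_system_pair.
have Zk (k : 'I_d) : (k < j)%N -> Z k 0 = 0 by move=> kj; rewrite Z0 hk.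
have Zlead t : 0 <= t <= tau -> expR (complex.Re (T j j) * t) * cn (Z j 0) <= R0.
  move=> tt; have [h1 h2] := hM t tt; apply: le_trans (cn_pair_mode j h1 h2).
  have /andP[t0 _] := tt.
  rewrite -ler_sqr ?nnegrE ?mulr_ge0 ?expR_ge0 ?cn_ge0//.
  rewrite -/(Z j t) (modal_leading Tlow sysZ t0 Zk) exprMn -expRM_natl.
  by rewrite -mulrA.
rewrite -Z0 expRN ler_pdivlMr ?expR_gt0// mulrC.
have [l0|/ltW l0] := leP (complex.Re (T j j)) 0.
  by have := Zlead 0; rewrite lexx tau0 !mulr0 => /(_ isT).
by rewrite (mulrC tau); apply: Zlead; rewrite tau0 lexx.
Qed.

(* The grid points [P^-1 z] are complex: their real and imaginary parts are points of [K], so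
   that two controls are attached to each of them and the count is squared. *)
Lemma separated_lower_count (X : eqType) (x0 : 'cV[R]_d) (r M : R) (tau : R) (w : 'cV[R]_d -> X) :
  0 < r -> 0 < M -> 0 <= tau ->
  (forall x y, `|x - x0| < r -> `|y - x0| < r -> w x = w y ->
    forall t, 0 <= t <= tau -> `|mexp A t *m (x - y)| <= M) ->
  exists F : seq X, [/\ uniq F, forall v, v \in F -> exists2 x, `|x - x0| < r & v = w x &
    expR (tau * unstable_sum) <=
      (2 * (mode_bound * M) / (r / (4 * inverse_bound P + 1)) + 1) ^+ d * (size F)%:R].
Proof.
move=> r0 M0 tau0 hw.
have ib0 := inverse_bound_ge0 P.
(* Grid side in mode coordinates: grid values have modulus at most [2 * h], and
   [inverse_bound P * (2 * h) < r] keeps the points in the ball. The [+ 1] keeps the denominator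
   positive. *)
pose h := r / (4 * inverse_bound P + 1).
have h0 : 0 < h by rewrite divr_gt0// ltr_wpDl// mulr_ge0.
pose R0 := 2 * (mode_bound * M).
have R00 : 0 <= R0 by rewrite !mulr_ge0 ?mode_bound_ge0// ltW.
pose lp j := Num.max 0 (complex.Re (T j j)).
have lp0 j : 0 <= lp j by rewrite le_max lexx.
(* With [n] above every exp(tau lp_j), the extra 1 in each residue modulus costs no more than a
   constant factor. *)
have [n n0 nlp] : exists2 n : nat, 0 < n%:R :> R & forall j, expR (tau * lp j) <= n%:R.
  exists (Num.truncn (expR (tau * unstable_sum))).+1; first by rewrite ltr0n.
  move=> j; apply: (@le_trans _ _ (expR (tau * unstable_sum))); last by rewrite ltW// truncnS_gt.
  rewrite ler_expR ler_wpM2l// /unstable_sum (bigD1 j)//= lerDl.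
  by apply: sumr_ge0 => i _; exact: lp0.
pose z (u : {ffun 'I_d -> 'I_n * 'I_n}) : 'cV[C]_d :=
  \col_j ((h / n%:R * (u j).1%:R) +i* (h / n%:R * (u j).2%:R)).
have zE u j : z u j ord0 = (h / n%:R * (u j).1%:R) +i* (h / n%:R * (u j).2%:R) by rewrite mxE.
have eB (a b : 'cV[C]_d) i : (a - b) i ord0 = a i ord0 - b i ord0 by rewrite !mxE.
pose y u := invmx P *m z u.
pose x1 u := x0 + map_mx (@complex.Re R) (y u).
pose x2 u := x0 + map_mx (@complex.Im R) (y u).
have hn (k : 'I_n) : 0 <= h / n%:R * k%:R <= h.
  apply/andP; split; first by rewrite mulr_ge0// ltW// divr_gt0.
  by rewrite mulrAC ler_pdivrMr// ler_wpM2l ?(ltW h0)// ler_nat ltnW.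
have zh u j : cn (z u j ord0) <= 2 * h.
  rewrite mxE; apply: (le_trans (cn_le_ReIm _)) => /=.
  have /andP[a0 ah] := hn (u j).1; have /andP[b0 bh] := hn (u j).2.
  by rewrite !ger0_norm// mulr_natl mulr2n lerD.
have yr u i : cn (y u i ord0) < r.
  apply: (@le_lt_trans _ _ (inverse_bound P * (2 * h))).
    by apply: cn_invmx_le => //; rewrite mulr_ge0// ltW.
  rewrite /h mulrCA mulrA mulrA ltr_pdivrMr; last by rewrite ltr_wpDl// mulr_ge0.
  rewrite mulrC mulrDr mulr1 mulrCA; nra.
(* The starting value [r / 2] of the maximum preserves the strict inequality even when there are no
   coordinates. *)
have nr (v : 'cV[R]_d) : (forall i, `|v i ord0| < r) -> `|v| < r.
  move=> hv; pose b := \big[Num.max/(r / 2)]_i `|v i ord0|.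
  apply: (@le_lt_trans _ _ b).
    apply/mx_norm_leP => [|i j].
      by apply: le_trans (bigmax_ge_id _ _ _ _); rewrite divr_ge0// ltW.
    by rewrite (ord1_ord0 j); exact: (le_bigmax _ (fun i => `|v i ord0|)).
  by apply/bigmax_ltP; split => //; rewrite ltr_pdivrMr// ltr_pMr// ltr1n.
have x1r u : `|x1 u - x0| < r.
  by rewrite addrC addKr; apply: nr => i; rewrite mxE; exact: le_lt_trans (Re_le_cn _) (yr u i).
have x2r u : `|x2 u - x0| < r.
  by rewrite addrC addKr; apply: nr => i; rewrite mxE; exact: le_lt_trans (Im_le_cn _) (yr u i).
pose F := undup ([seq w (x1 u) | u : {ffun 'I_d -> 'I_n * 'I_n}] ++
                 [seq w (x2 u) | u : {ffun 'I_d -> 'I_n * 'I_n}]).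
have M1 u : w (x1 u) \in F by rewrite mem_undup mem_cat map_f// mem_enum.
have M2 u : w (x2 u) \in F by rewrite mem_undup mem_cat [X in _ || X]map_f ?orbT// mem_enum.
have F1 u : (index (w (x1 u)) F < size F)%N by rewrite index_mem.
have F2 u : (index (w (x2 u)) F < size F)%N by rewrite index_mem.
exists F; split; first exact: undup_uniq.
  move=> v; rewrite mem_undup mem_cat => /orP[] /mapP[u _ ->]; first by exists (x1 u).
  by exists (x2 u).
(* Largest possible index difference in the j-th coordinate when all earlier ones agree: the bound
   on the leading mode divided by the grid step [h / n]. *)
pose rr j := Num.truncn (R0 * n%:R / h * expR (- (tau * lp j))).
have rv0 j : 0 <= R0 * n%:R / h * expR (- (tau * lp j)).
  by rewrite mulr_ge0 ?expR_ge0// divr_ge0 ?(ltW h0)// mulr_ge0 ?(ltW n0).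
have count : (n ^ d * n ^ d <= #|{: 'I_(size F) * 'I_(size F)}| * (\prod_j (rr j).+1) ^ 2)%N.
  apply: (@grid_count _ _ _ _ (fun u => (Ordinal (F1 u), Ordinal (F2 u)))) => u u' E uu'.
  have E1 : index (w (x1 u)) F = index (w (x1 u')) F.
    exact: (congr1 (fun p : 'I_(size F) * 'I_(size F) => nat_of_ord p.1) E).
  have E2 : index (w (x2 u)) F = index (w (x2 u')) F.
    exact: (congr1 (fun p : 'I_(size F) * 'I_(size F) => nat_of_ord p.2) E).
  have {}E1 : w (x1 u) = w (x1 u').
    exact: etrans (esym (nth_index (w x0) (M1 u)))
      (etrans (congr1 (nth (w x0) F) E1) (nth_index (w x0) (M1 u'))).
  have {}E2 : w (x2 u) = w (x2 u').
    exact: etrans (esym (nth_index (w x0) (M2 u)))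
      (etrans (congr1 (nth (w x0) F) E2) (nth_index (w x0) (M2 u'))).
  have [j0 j0P] : exists j, u j != u' j.
    apply/existsP; apply: contraNT uu' => /existsPn h'; apply/eqP/ffunP => j.
    by apply/eqP; have := h' j; rewrite negbK.
  (* The first coordinate in which the two grid points differ carries the leading mode of their
     difference. *)
  case: (@arg_minnP _ j0 (fun j => u j != u' j) (fun j : 'I_d => nat_of_ord j) j0P) => j uj jmin.
  exists j; split; first exact: uj.
  pose Z k := pair_mode (x1 u - x1 u') (x2 u - x2 u') k.
  have Z0 k : Z k = z u k ord0 - z u' k ord0.
    rewrite /Z.
    have -> : x1 u - x1 u' = map_mx (@complex.Re R) (y u - y u').
      by rewrite map_ReB /x1 opprD addrACA subrr add0r.
    have -> : x2 u - x2 u' = map_mx (@complex.Im R) (y u - y u').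
      by rewrite map_ImB /x2 opprD addrACA subrr add0r.
    apply: etrans (mode_Re_Im P (y u - y u') k) _.
    have -> : P *m (y u - y u') = z u - z u' by rewrite -mulmxBr mulKVmx.
    exact: eB.
  have Zj : cn (Z j) <= R0 * expR (- (tau * lp j)).
    apply: (pair_mode_leading tau0 (ltW M0)) => [t tt|k kj].
      by split; [exact: (hw _ _ (x1r u) (x1r u') E1 t tt)|exact: (hw _ _ (x2r u) (x2r u') E2 t tt)].
    rewrite -/(Z k) Z0; have : u k == u' k.
      by apply: contraTT kj => /jmin; rewrite -leqNgt.
    by move=> /eqP uk; rewrite !zE uk subrr.
  have Rej : `|complex.Re (Z j)| <= R0 * expR (- (tau * lp j)) := le_trans (Re_le_cn _) Zj.
  have Imj : `|complex.Im (Z j)| <= R0 * expR (- (tau * lp j)) := le_trans (Im_le_cn _) Zj.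
  have key (a b : nat) : h / n%:R * a%:R - h / n%:R * b%:R <= R0 * expR (- (tau * lp j)) ->
      (a <= b + rr j)%N.
    move=> hab; apply: (leq_truncn (rv0 j)).
    have hn0 : 0 < h / n%:R by rewrite divr_gt0.
    rewrite -(ler_pM2l hn0) mulrBr; apply: (le_trans hab).
    have gen (p q s t : R) : p != 0 -> q != 0 -> s * t = q / p * (s * p / q * t).
      by move=> p0 q0; field; rewrite p0 q0.
    by rewrite -(gen _ _ _ _ (lt0r_neq0 n0) (lt0r_neq0 h0)) lexx.
  have := Rej; have := Imj; rewrite Z0 !zE/= !ler_norml => /andP[i1 i2] /andP[r1 r2].
  have key' (a b : nat) : - (R0 * expR (- (tau * lp j))) <= h / n%:R * a%:R - h / n%:R * b%:R ->
      (b <= a + rr j)%N.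
    by move=> hab; apply: key; rewrite -lerN2 opprB; exact: hab.
  by split; [exact: key r2|exact: key' r1|exact: key i2|exact: key' i1].
have {count} : (n ^ d <= size F * \prod_j (rr j).+1)%N.
  by apply: nat_sqr_le; rewrite (leq_trans count)// card_prod !card_ord expnMn mulnn.
rewrite -(ler_nat R) natrX natrM natr_prod => count.
have prodle : \prod_j (rr j).+1%:R <= \prod_(j < d) (n%:R * expR (- (tau * lp j)) * (R0 / h + 1)).
  apply: ler_prod => j _; rewrite ler0n/= -natr1 mulrDr mulr1 lerD//.
    have -> : n%:R * expR (- (tau * lp j)) * (R0 / h) = R0 * n%:R / h * expR (- (tau * lp j)).
      by ring.
    by rewrite truncn_le; exact: rv0.
  by rewrite expRN ler_pdivlMr ?expR_gt0// mul1r.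
rewrite big_split big_split/= !prodr_const card_ord in prodle.
have expprod : \prod_(j < d) expR (- (tau * lp j)) = expR (- (tau * unstable_sum)).
  by rewrite -expR_sum sumrN mulr_sumr.
rewrite expprod in prodle.
have := le_trans count (ler_wpM2l (ler0n _ _) prodle).
have nd0 : 0 < n%:R ^+ d :> R by rewrite exprn_gt0.
rewrite expRN -/R0 -/h => H.
have : 1 <= (size F)%:R * ((expR (tau * unstable_sum))^-1 * (R0 / h + 1) ^+ d).
  rewrite -(ler_pM2l nd0) mulr1; apply: (le_trans H).
  by rewrite le_eqVlt; apply/orP; left; apply/eqP; ring.
rewrite mulrCA -ler_pdivrMl ?invr_gt0 ?expR_gt0// invrK mulr1.
by rewrite [X in _ <= X -> _]mulrC.
Qed.

End PieceCounting.

(** * Upper count: covering a ball for the time-tau metric *)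

Section CoveringCounting.
Variables (R : realType) (d : nat) (A : 'M[R]_d).
Local Open Scope complex_scope.
Local Notation C := R[i].
Local Notation cn := (@ComplexField.Normc.normc R).
Variables (P T : 'M[C]_d).
Hypotheses (uP : P \in unitmx) (PA : P *m map_mx (real_complex R) A = T *m P).
Hypothesis Tlow : forall i j : 'I_d, (i < j)%N -> T i j = 0.
Local Notation pair_mode := (pair_mode P).
Local Notation mode_bound := (mode_bound P).
Local Notation unstable_sum := (unstable_sum T).

Lemma truncn_eq_close (a b : R) : 0 <= a -> 0 <= b -> Num.truncn a = Num.truncn b ->
  `|a - b| <= 1.
Proof.
move=> /truncn_itv/andP[a1 a2] /truncn_itv/andP[b1 b2] E; rewrite E in a1 a2.
rewrite ler_norml; rewrite -natr1 in a2 b2; apply/andP; split; lra.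
Qed.

Lemma separated_nth (M : 'M[R]_d) (r : R) (X : seq 'cV[R]_d) n (a b : 'I_n) :
  size X = n -> pairwise (fun x y : 'cV[R]_d => r < `|M *m (x - y)|) X ->
  `|M *m (nth 0 X a - nth 0 X b)| <= r -> a = b.
Proof.
move=> sX sepX hab; apply/val_inj/eqP; apply: contraT.
have nX (u : 'I_n) : nat_of_ord u \in gtn (size X) by rewrite inE sX.
have /(pairwiseP 0) sp := sepX.
rewrite neq_ltn => /orP[/(sp _ _ (nX a) (nX b))|/(sp _ _ (nX b) (nX a))].
  by rewrite ltNge hab.
by rewrite -opprB mulmxN normrN ltNge hab.
Qed.

Hypothesis Tsorted : forall j k : 'I_d, (j <= k)%N ->
  complex.Re (T k k) <= complex.Re (T j j).

(* A maximal separated family; [x_i + i x_k] injects into the cells of a polydisc. *)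
Lemma covering_upper_count (e : R) : 0 < e -> exists2 c : R, 0 < c &
  forall tau r : R, 0 <= tau -> 0 < r -> exists X : seq 'cV[R]_d,
    [/\ forall x, x \in X -> `|x| <= r,
        forall x, `|x| <= r -> exists2 y, y \in X & `|mexp A tau *m (x - y)| <= r &
        (size X)%:R <= c * expR (tau * (unstable_sum + d%:R * e))].
Proof.
move=> e0; have [c [c1 hc0]] := mode_constants T e0 (lexx 0).
have hc (j : 'I_d) : \sum_(k < d | (k < j)%N) cn (T j k) * c k <= e * c j.
  by have := hc0 j; rewrite addr0.
have c0 k : 0 <= c k by apply: le_trans (c1 k).
pose K := \sum_(j < d) c j; have K0 : 0 <= K by apply: sumr_ge0.
have ib0 := inverse_bound_ge0 P; have mb0 := mode_bound_ge0 P.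
(* Dividing [r] by [q] compensates for the constants [K] and [inverse_bound P] lost between mode
   bounds and the norm. *)
pose q := inverse_bound P * K + 1.
have q0 : 0 < q by rewrite ltr_wpDl// mulr_ge0.
(* The ratio [4 * (mode_bound * r) / rho j] equals [8 * mode_bound * q] times exp(tau mu_j); the
   final 1 pays for rounding. *)
pose c' := 8 * mode_bound * q + 1.
have c'0 : 0 < c' by rewrite ltr_wpDl// !mulr_ge0// ltW.
exists (c' ^+ d); first exact: exprn_gt0.
move=> tau r tau0 r0; set E := mexp A tau.
pose mu := growth_rate T e.
pose r' := r / q; have r'0 : 0 < r' by rewrite divr_gt0.
(* Cell side: half the initial size allowed by [modal_growth], as real and imaginary parts each
   contribute one side. *)
pose rho j := r' / 2 * expR (- (tau * mu j)).
have rho0 j : 0 < rho j by rewrite mulr_gt0 ?expR_gt0// divr_gt0.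
pose L j := Num.truncn (4 * (mode_bound * r) / rho j).
(* Separation at time [tau]; a family of maximal size must cover, since an uncovered point could be
   added to it. *)
pose sep := pairwise (fun a b : 'cV[R]_d => r < `|E *m (a - b)|).
pose Q n := `[< exists X : seq 'cV[R]_d,
  [/\ size X = n, sep X & forall x, x \in X -> `|x| <= r] >].
have Qmax n : Q n -> (n <= \prod_j (L j).+1)%N.
  move=> /asboolP[X [sX sepX Xr]].
  apply: nat_sqr_le; rewrite -(card_box L) -{1 2}(card_ord n) -card_prod.
  pose xi (i : 'I_n) := nth 0 X i.
  have xir i : `|xi i| <= r by apply: Xr; rewrite mem_nth// sX.
  pose pz (ik : 'I_n * 'I_n) j := pair_mode (xi ik.1) (xi ik.2) j.
  have pzb ik j : cn (pz ik j) <= 2 * (mode_bound * r) by exact: cn_pair_mode.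
  pose cell (a : R) j : 'I_(L j).+1 := inord (Num.truncn ((a + 2 * (mode_bound * r)) / rho j)).
  have cellP a b j : `|a| <= 2 * (mode_bound * r) -> `|b| <= 2 * (mode_bound * r) ->
      cell a j = cell b j -> `|a - b| <= rho j.
    have nn v : `|v| <= 2 * (mode_bound * r) -> 0 <= (v + 2 * (mode_bound * r)) / rho j /\
        (Num.truncn ((v + 2 * (mode_bound * r)) / rho j) < (L j).+1)%N.
      rewrite ler_norml => /andP[v1 v2]; split.
        by apply: divr_ge0; [lra|exact: ltW].
      rewrite ltnS; apply: le_truncn; rewrite ler_pM2r ?invr_gt0//; lra.
    move=> /nn[a0 aL] /nn[b0 bL] /(congr1 val)/=; rewrite !inordK// => h.
    have := truncn_eq_close a0 b0 h.
    rewrite -mulrBl opprD addrACA subrr addr0 normrM normfV (gtr0_norm (rho0 j)).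
    by rewrite ler_pdivrMr// mul1r.
  pose f (ik : 'I_n * 'I_n) : {dffun forall j : 'I_d, 'I_(L j).+1 * 'I_(L j).+1} :=
    [ffun j : 'I_d => (cell (complex.Re (pz ik j)) j, cell (complex.Im (pz ik j)) j)].
  (* If two index pairs share a cell, both differences of points stay within [r] at time [tau], and
     separation identifies the indices. *)
  apply: (@leq_card _ _ f) => -[i k] [i' k'] /ffunP fE.
  pose Z j t := pair_mode (mexp A t *m (xi i - xi i')) (mexp A t *m (xi k - xi k')) j.
  have sysZ : modal_system T Z by exact: (modal_system_pair PA).
  have Z0 j : cn (Z j 0) <= c j * r' * expR (- (tau * mu j)).
    have -> : Z j 0 = pz (i, k) j - pz (i', k') j.
      by rewrite /Z mexp0 !mul1mx pair_modeB.
    have := fE j; rewrite !ffunE => -[].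
    move=> /cellP h1 /cellP h2.
    have {}h1 := h1 (le_trans (Re_le_cn _) (pzb _ _)) (le_trans (Re_le_cn _) (pzb _ _)).
    have {}h2 := h2 (le_trans (Im_le_cn _) (pzb _ _)) (le_trans (Im_le_cn _) (pzb _ _)).
    apply: (@le_trans _ _ (rho j + rho j)).
      apply: (le_trans (cn_le_ReIm _)); apply: lerD.
        by move: h1; case: (pz (i, k) j) (pz (i', k') j) => ? ? [].
      by move: h2; case: (pz (i, k) j) (pz (i', k') j) => ? ? [].
    rewrite /rho -mulrDl -splitr -mulrA ler_peMl// mulr_ge0 ?expR_ge0// ltW//.
  have Ztau j : cn (Z j tau) <= K * r'.
    apply: (le_trans (modal_growth Tlow sysZ e0 (ltW r'0) tau0 c1 hc Tsorted Z0 j)).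
    by rewrite ler_wpM2r ?(ltW r'0)// /K [leRHS](bigD1 j)//= lerDl sumr_ge0.
  have [] := norm_le_modes uP (mulr_ge0 K0 (ltW r'0)) Ztau.
  have Kq : inverse_bound P * (K * r') <= r.
    have -> : inverse_bound P * (K * r') = r * (inverse_bound P * K / q) by rewrite /r'; ring.
    by rewrite ler_piMr ?(ltW r0)// ler_pdivrMr// mul1r lerDl.
  move=> /le_trans/(_ Kq) H1 /le_trans/(_ Kq) H2.
  by rewrite (separated_nth sX sepX H1) (separated_nth sX sepX H2).
have Q0 : exists n, Q n by exists 0%N; apply/asboolP; exists [::].
case: (ex_maxnP Q0 Qmax) => n /asboolP[X [sX sepX Xr]] nmax.
exists X; split => // [x xr|].
  apply: contrapT => hx.
  have : Q n.+1.
    apply/asboolP; exists (x :: X); split; first by rewrite /= sX.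
      apply/andP; split; last exact: sepX.
      apply/allP => y yX; rewrite ltNge; apply/negP => le.
      by apply: hx; exists y.
    by move=> y; rewrite inE => /predU1P[->//|]; exact: Xr.
  by move/nmax; rewrite ltnn.
have : (size X <= \prod_j (L j).+1)%N by rewrite sX; apply: Qmax; apply/asboolP; exists X.
rewrite -(ler_nat R) natr_prod => /le_trans; apply.
apply: (@le_trans _ _ (\prod_(j < d) (c' * expR (tau * mu j)))).
  apply: ler_prod => j _; rewrite ler0n/= -natr1 /c' mulrDl mul1r lerD//.
    apply: (@le_trans _ _ (4 * (mode_bound * r) / rho j)).
      by rewrite truncn_le divr_ge0 ?(ltW (rho0 j))// !mulr_ge0// ltW.
    rewrite /rho /r' expRN le_eqVlt; apply/orP; left; apply/eqP; field.
    by rewrite !gt_eqF ?expR_gt0.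
  rewrite -expR0 ler_expR mulr_ge0// /mu /growth_rate addr_ge0 ?(ltW e0)//.
  by rewrite le_max lexx.
rewrite big_split/= prodr_const card_ord ler_wpM2l ?exprn_ge0 ?(ltW c'0)//.
rewrite -expR_sum -mulr_sumr ler_expR ler_wpM2l// /mu /growth_rate big_split/=.
by rewrite sumr_const card_ord mulr_natl.
Qed.

End CoveringCounting.

(** * Comparing integrals of possibly nonmeasurable functions *)

Section ArbitraryIntegrands.
Context {R : realType}.
Notation mu := (@lebesgue_measure R).
Import HBNNSimple.
Local Open Scope ereal_scope.

(* The integral of a nonnegative function that need not be measurable is still
   a supremum over the simple functions below it, so it can be compared with
   integrals of measurable functions. *)
Lemma ge0_integral_le_measurable (D : set R) (u v : R -> \bar R) : measurable D ->
  (forall t, 0 <= u t) -> (forall t, 0 <= v t) -> measurable_fun setT v ->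
  {ae mu, forall t, u t <= v t} ->
  \int[mu]_(t in D) u t <= \int[mu]_(t in D) v t.
Proof.
move=> mD u0 v0 mv uv; rewrite ge0_integralE//; apply: ge_ereal_sup => _ [h hu <-].
rewrite -integralT_nnsfun [leRHS]integral_mkcond; apply: ae_ge0_le_integral => //.
- by move=> t _; rewrite lee_fin.
- exact/measurable_EFinP.
- by move=> t _; apply: erestrict_ge0 => s _; exact: v0.
- by apply/(measurable_restrictT _ mD); exact: measurable_funS mv.
- apply: ae_imply uv => t uvt _; apply: (le_trans (hu t)).
  by rewrite /patch; case: ifP.
Qed.

(** The exceptional null set is dropped from the integral of the measurable [v]; every simple
    function below what remains also lies below [u]. *)
Lemma ge0_integral_ge_measurable (D : set R) (u v : R -> \bar R) : measurable D ->
  (forall t, 0 <= u t) -> (forall t, 0 <= v t) -> measurable_fun setT v ->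
  {ae mu, forall t, v t <= u t} ->
  \int[mu]_(t in D) v t <= \int[mu]_(t in D) u t.
Proof.
move=> mD u0 v0 mv [N [mN N0 uvN]].
rewrite (ge0_negligible_integral mN)//; last exact: measurable_funS mv.
rewrite 2?ge0_integralE//; apply: le_ereal_sup => _ [h hv <-]; exists h => // t.
apply: (le_trans (hv t)); rewrite /patch.
case: ifPn => [|_]; last by case: ifP.
rewrite inE => -[Dt Nt]; rewrite mem_set//.
by apply: contrapT => nle; apply: Nt; exact: uvN.
Qed.

Local Close Scope ereal_scope.

Lemma funepos_le_bound (g : R -> R) M t : `|g t| <= M ->
  ((EFin \o g)^\+ t <= M%:E /\ (EFin \o g)^\- t <= M%:E)%E.
Proof.
move=> gM; rewrite funeposE funenegE /= -!EFin_max !lee_fin.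
move: gM; rewrite ler_norml !ge_max => /andP[gM Mg]; rewrite Mg lerNl gM /=.
by split; apply: le_trans (normr_ge0 (g t)) _; rewrite ler_norml gM.
Qed.

(** Since [f] is unrestricted off [U] and a control may leave [U] on a null set, measurability of
    the running cost is not at hand. Finiteness of both parts turns the real integral into a true
    difference, so each part can be compared separately. *)
Lemma Rintegral_pos_neg (D : set R) (g : R -> R) M : measurable D ->
  (mu D < +oo)%E -> {ae mu, forall t, `|g t| <= M} ->
  exists a b, [/\ (\int[mu]_(t in D) (EFin \o g)^\+ t = a%:E)%E,
    (\int[mu]_(t in D) (EFin \o g)^\- t = b%:E)%E &
    \int[mu]_(t in D) g t = a - b].
Proof.
move=> mD muD gM.
have fin (u : R -> \bar R) : (forall t, 0 <= u t)%E ->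
    {ae mu, forall t, (u t <= M%:E)%E} -> (\int[mu]_(t in D) u t \is a fin_num)%E.
  move=> u0 uM; have uN : {ae mu, forall t, (u t <= `|M|%:E)%E}.
    by apply: ae_imply uM => t /le_trans; apply; rewrite lee_fin ler_norm.
  rewrite ge0_fin_numE; last by apply: integral_ge0 => t _; exact: u0.
  apply: le_lt_trans (ge0_integral_le_measurable mD u0 _ _ uN) _ => //.
  by rewrite integral_cst// lte_mul_pinfty.
have gp := ae_imply (fun t h => proj1 (@funepos_le_bound g M t h)) gM.
have gn := ae_imply (fun t h => proj2 (@funepos_le_bound g M t h)) gM.
have fp := fin _ (fun t => funepos_ge0 _ t) gp.
have fn := fin _ (fun t => funeneg_ge0 _ t) gn.
exists (fine (\int[mu]_(t in D) (EFin \o g)^\+ t)%E).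
exists (fine (\int[mu]_(t in D) (EFin \o g)^\- t)%E); split; rewrite ?fineK//.
by rewrite /Rintegral integralE fineB.
Qed.

Lemma Rintegral_le_measurable (D : set R) (g h : R -> R) M : measurable D ->
  (mu D < +oo)%E -> measurable_fun setT h -> (forall t, `|h t| <= M) ->
  {ae mu, forall t, `|g t| <= M} -> {ae mu, forall t, g t <= h t} ->
  \int[mu]_(t in D) g t <= \int[mu]_(t in D) h t.
Proof.
move=> mD muD mh hM gM gh.
have [a [b [aE bE ->]]] := Rintegral_pos_neg mD muD gM.
have [|a' [b' [a'E b'E ->]]] := @Rintegral_pos_neg _ h M mD muD; first exact: aeW.
have meh : measurable_fun setT (EFin \o h) by exact/measurable_EFinP.
rewrite lerB// -lee_fin -?aE -?a'E -?bE -?b'E.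
  apply: ge0_integral_le_measurable => //; first exact: measurable_funepos.
  by apply: ae_imply gh => t ght; rewrite !funeposE ge_max !le_max !lee_fin ght !lexx/= orbT.
apply: ge0_integral_ge_measurable => //; first exact: measurable_funeneg.
by apply: ae_imply gh => t ght; rewrite !funenegE ge_max !le_max -!EFinN !lee_fin lerN2 ght !lexx/= orbT.
Qed.

Lemma Rintegral_ge_measurable (D : set R) (g h : R -> R) M : measurable D ->
  (mu D < +oo)%E -> measurable_fun setT h -> (forall t, `|h t| <= M) ->
  {ae mu, forall t, `|g t| <= M} -> {ae mu, forall t, h t <= g t} ->
  \int[mu]_(t in D) h t <= \int[mu]_(t in D) g t.
Proof.
move=> mD muD mh hM gM hg.
have [a [b [aE bE ->]]] := Rintegral_pos_neg mD muD gM.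
have [|a' [b' [a'E b'E ->]]] := @Rintegral_pos_neg _ h M mD muD; first exact: aeW.
have meh : measurable_fun setT (EFin \o h) by exact/measurable_EFinP.
rewrite lerB// -lee_fin -?aE -?a'E -?bE -?b'E.
  apply: ge0_integral_ge_measurable => //; first exact: measurable_funepos.
  by apply: ae_imply hg => t ght; rewrite !funeposE ge_max !le_max !lee_fin ght !lexx/= orbT.
apply: ge0_integral_le_measurable => //; first exact: measurable_funeneg.
by apply: ae_imply hg => t ght; rewrite !funenegE ge_max !le_max -!EFinN !lee_fin lerN2 ght !lexx/= orbT.
Qed.
End ArbitraryIntegrands.

(** * Bounds on the running cost *)

Section RunningCost.
Context {R : realType} {m : nat}.
Notation mu := (@lebesgue_measure R).
Variables (U : set 'cV[R]_m) (f : 'cV[R]_m -> R) (c M : R).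
Hypothesis fU : forall u, U u -> c <= f u <= M.
Implicit Types (w : R -> 'cV[R]_m) (s : seq (R * R)).

Let cost_bounded w : admissible U w -> {ae mu, forall t, `|f (w t)| <= `|c| + `|M|}.
Proof.
move=> [_]; apply: ae_imply => t /fU /andP[cf fM]; rewrite ler_norml; apply/andP; split.
  by apply: le_trans cf; rewrite lerNl (le_trans (ler_norm _))// normrN lerDl.
by apply: le_trans fM _; rewrite (le_trans (ler_norm _))// lerDr.
Qed.

Let itv_finite (tau : R) : (mu `[0%R, tau] < +oo)%E.
Proof. by rewrite /= lebesgue_measure_itv/=; case: ifP => _; rewrite ?ltry// -EFinB ltry. Qed.

Lemma running_cost_ge w tau : admissible U w -> 0 <= tau ->
  c * tau <= \int[mu]_(t in `[0, tau]) f (w t).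
Proof.
move=> Uw tau0; rewrite -[tau in c * tau]subr0 -Rintegral_cst_itv//.
apply: (@Rintegral_ge_measurable _ _ _ _ (`|c| + `|M|) _ (itv_finite tau)) => //.
- by move=> t; rewrite lerDl.
- exact: cost_bounded.
- by case: Uw => _; apply: ae_imply => t /fU /andP[].
Qed.

(** Counts overlaps with multiplicity: it dominates the indicator of the union while its integral is
    at most the sum of the lengths. *)
Definition itv_count s (t : R) : R := \sum_(p <- s) \1_`[p.1, p.2] t.

Lemma itv_count_ge0 s t : 0 <= itv_count s t.
Proof. by apply: sumr_ge0 => p _; rewrite indicE. Qed.

Lemma itv_count_ge1 s t p : p \in s -> p.1 <= t <= p.2 -> 1 <= itv_count s t.
Proof.
move=> ps pt; rewrite /itv_count (big_rem p)//= indicE mem_set/= ?in_itv//=.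
by rewrite lerDl; apply: sumr_ge0 => q _; rewrite indicE.
Qed.

Lemma itv_count_le s t : itv_count s t <= (size s)%:R.
Proof.
rewrite /itv_count; elim: s => [|p s IH]; first by rewrite big_nil.
by rewrite big_cons /= -[(size s).+1]add1n natrD lerD// indicE lern1 leq_b1.
Qed.

Lemma measurable_itv_count s : measurable_fun setT (itv_count s).
Proof.
by apply: measurable_sum => p; exact: measurable_indic.
Qed.

Lemma locally_bounded_itv_count s : locally_bounded (itv_count s).
Proof.
move=> T; split; first exact: measurable_funS (measurable_itv_count s).
by exists (size s)%:R => t _; rewrite ger0_norm ?itv_count_ge0// itv_count_le.
Qed.

Lemma Rintegral_itv_count_le s tau : (forall p, p \in s -> p.1 <= p.2) ->
  \int[mu]_(t in `[0, tau]) itv_count s t <= \sum_(p <- s) (p.2 - p.1).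
Proof.
elim: s => [_|p s IH hs].
  rewrite big_nil (@eq_Rintegral _ _ _ mu _ (fun=> 0)) ?Rintegral_cst//= ?mul0r//.
  by move=> t _; rewrite /itv_count big_nil.
rewrite big_cons (@eq_Rintegral _ _ _ mu _ (fun t => \1_`[p.1, p.2] t + itv_count s t)); last first.
  by move=> t _; rewrite /itv_count big_cons.
rewrite RintegralD//; last 2 first.
- have := @locally_bounded_integrable _ _ 0 tau (locally_bounded_itv_count [:: p]) (lexx _).
  by apply: eq_integrable => // t _ /=; rewrite /itv_count big_seq1.
- exact: locally_bounded_integrable (locally_bounded_itv_count s) (lexx _).
apply: lerD; last by apply: IH => q qs; apply: hs; rewrite inE qs orbT.
have pp : p.1 <= p.2 by apply: hs; rewrite inE eqxx.
rewrite /Rintegral integral_indic//.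
have mE : mu `[p.1, p.2] = (p.2 - p.1)%:E.
  rewrite /= lebesgue_measure_itv/= lte_fin -EFinB; case: ltP => // q12.
  by congr EFin; apply/esym/eqP; rewrite subr_eq0 eq_le pp q12.
have le : (mu (`[p.1, p.2] `&` `[0%R, tau]) <= (p.2 - p.1)%:E)%E.
  by rewrite -mE; apply: le_measure; rewrite ?inE//; exact: measurableI.
rewrite -lee_fin fineK//; rewrite ge0_fin_numE//.
by apply: le_lt_trans le (ltry _).
Qed.

(** The list [s] holds the exceptional intervals; on them the cost exceeds [c] by at most [M - c],
    elsewhere not at all. *)
Lemma running_cost_le w tau s : c <= M -> admissible U w -> 0 <= tau ->
  (forall p, p \in s -> p.1 <= p.2) ->
  (forall t, 0 <= t <= tau -> (forall p, p \in s -> ~~ (p.1 <= t <= p.2)) -> f (w t) <= c) ->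
  \int[mu]_(t in `[0, tau]) f (w t) <= c * tau + (M - c) * \sum_(p <- s) (p.2 - p.1).
Proof.
(* The value [c] outside [0, tau] makes the pointwise bounds hold almost everywhere on the line, as
   the comparison lemma asks. *)
move=> cM Uw tau0 hs wc; pose g t := if 0 <= t <= tau then f (w t) else c.
rewrite (@eq_Rintegral _ _ _ mu _ g); last first.
  by move=> t; rewrite inE/= in_itv/= /g => ->.
pose h t := c + (M - c) * itv_count s t.
have Mc : 0 <= M - c by rewrite subr_ge0.
have gh : \int[mu]_(t in `[0, tau]) g t <= \int[mu]_(t in `[0, tau]) h t.
  apply: (@Rintegral_le_measurable _ _ _ _ (`|c| + `|M| + (M - c) * (size s)%:R) _ (itv_finite tau)) => //.
  - apply: measurable_funD => //; apply: measurable_funM => //.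
    exact: measurable_itv_count.
  - move=> t; apply: le_trans (ler_normD _ _) _; apply: lerD; first by rewrite lerDl.
    by rewrite normrM !ger0_norm ?itv_count_ge0// ler_wpM2l// itv_count_le.
  - apply: ae_imply (cost_bounded Uw) => t ft; rewrite /g; case: ifP => _.
      by apply: le_trans ft _; rewrite lerDl mulr_ge0.
    by rewrite -addrA lerDl addr_ge0// mulr_ge0.
  - case: Uw => _; apply: ae_imply => t /fU /andP[_ fM]; rewrite /g /h; case: ifP => t0; last first.
      by rewrite lerDl mulr_ge0// itv_count_ge0.
    have [[p ps pt]|np] := pselect (exists2 p, p \in s & p.1 <= t <= p.2).
      apply: le_trans fM _; rewrite -lerBlDl -[leLHS]mulr1 ler_wpM2l//.
      exact: itv_count_ge1 pt.
    apply: le_trans (wc t t0 _) _; last by rewrite lerDl mulr_ge0// itv_count_ge0.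
    by move=> p ps; apply/negP => pt; apply: np; exists p.
apply: le_trans gh _; rewrite /h RintegralD//; last 2 first.
- exact: locally_bounded_integrable (locally_bounded_cst c) (lexx _).
- exact: locally_bounded_integrable (locally_boundedZ _ (locally_bounded_itv_count s)) (lexx _).
rewrite Rintegral_cst_itv// subr0 lerD2l RintegralZl//; last first.
  exact: locally_bounded_integrable (locally_bounded_itv_count s) (lexx _).
by rewrite ler_wpM2l// Rintegral_itv_count_le.
Qed.
End RunningCost.

(** * Spectral data of a hyperbolic matrix *)

Section SpectralData.
Variables (R : realType) (d : nat) (A : 'M[R]_d).
Local Open Scope complex_scope.
Local Notation C := R[i].
Local Notation cn := (@ComplexField.Normc.normc R).

Lemma char_poly_complexification :
  char_poly (map_mx (real_complex R) A) = map_poly (fun r : R => r%:C) (char_poly A).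
Proof. by rewrite -map_char_poly. Qed.

Lemma sorted_triangularization (s : seq C) : hyperbolic A ->
  map_poly (fun r : R => r%:C) (char_poly A) = \prod_(z <- s) ('X - z%:P) ->
  exists (P T : 'M[C]_d) (e : R),
    [/\ P \in unitmx, P *m map_mx (real_complex R) A = T *m P,
        forall i j : 'I_d, (i < j)%N -> T i j = 0,
        forall j k : 'I_d, (j <= k)%N -> complex.Re (T k k) <= complex.Re (T j j) &
        [/\ 0 < e, forall j : 'I_d, e <= `|complex.Re (T j j)| &
            unstable_sum T = \sum_(z <- s) Num.max 0 (complex.Re z)]].
Proof.
move=> hypA chA; pose ler := [rel x y : C | complex.Re y <= complex.Re x].
have lertot : total ler by move=> x y /=; exact: le_total.
have lertr : transitive ler by move=> y x z /= xy yz; exact: le_trans yz xy.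
pose s' := sort ler s; have ss' : perm_eq s' s by rewrite /s' perm_sort.
have chA' : char_poly (map_mx (real_complex R) A) = \prod_(z <- s') ('X - z%:P).
  by rewrite char_poly_complexification chA; apply: perm_big; rewrite perm_sym.
have sz : size s' = d.
  by apply: succn_inj; rewrite -(size_prod_XsubC s' id) -chA' size_char_poly.
have [P [T [uP PA Tlow Tdiag]]] := triangularize chA'.
have Tne (j : 'I_d) : complex.Re (T j j) != 0.
  apply: hypA; rewrite /eigenvalueC -char_poly_complexification chA' Tdiag root_prod_XsubC.
  by rewrite mem_nth ?sz.
(* The starting value 1 keeps the spectral gap positive in dimension zero. *)
exists P, T, (\big[Num.min/1]_(j < d) `|complex.Re (T j j)|); split => //.
  move=> j k jk; rewrite !Tdiag; apply: (sorted_leq_nth lertr (fun x => lexx _) 0 (sort_sorted lertot s)) => //; rewrite inE -/s' sz ltn_ord//.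
split.
- by apply: lt_bigmin => // j _; rewrite normr_gt0.
- by move=> j; apply: bigmin_le_cond.
- rewrite -(perm_big _ ss') /unstable_sum (big_nth 0) sz big_mkord.
  by apply: eq_bigr => j _; rewrite Tdiag.
Qed.

(** For a vector fixed by exp(tA), the modulus of its first nonzero mode would be multiplied by
    exp(t Re T_jj), which differs from 1. *)
Lemma unitmx_1_sub_mexp (P T : 'M[C]_d) (t : R) :
  P \in unitmx -> P *m map_mx (real_complex R) A = T *m P ->
  (forall i j : 'I_d, (i < j)%N -> T i j = 0) ->
  (forall j : 'I_d, complex.Re (T j j) != 0) -> 0 < t ->
  1%:M - mexp A t \in unitmx.
Proof.
move=> uP PA Tlow Tne t0; apply: unitmx_inj => x.
rewrite mulmxBl mul1mx => /eqP; rewrite subr_eq0 => /eqP xE.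
have z0 (j : 'I_d) : mode P x j = 0.
  have [k] := ubnP (nat_of_ord j); elim: k j => // k IH j; rewrite ltnS => jk.
  have := @modal_leading _ _ _ Tlow _ j t (modal_system_mexp PA x) (ltW t0) _.
  rewrite -xE mexp0 mul1mx => /(_ _) -/(_ (fun i ij => IH i (leq_trans ij jk))) h.
  apply: contraTeq isT => zj; exfalso.
  have z2 : cn (mode P x j) ^+ 2 != 0.
    by rewrite expf_neq0//; apply: contra zj => /eqP/ComplexField.Normc.eq0_normc ->.
  have e1 : expR (2 * complex.Re (T j j) * t) = 1 by apply: (mulIf z2); rewrite mul1r -h.
  have /eqP := expR_inj (etrans e1 (esym (expR0 R))).
  by rewrite !mulf_eq0 (negPf (Tne j)) pnatr_eq0/= (gt_eqF t0).
apply/eqP; rewrite -normr_le0 -(mulr0 (inverse_bound P)).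
by apply: norm_le_mode => // j; rewrite z0 ComplexField.Normc.normc0.
Qed.
End SpectralData.

(** * Sums over finite families of controls *)

Section SumsOverControls.
Variables (R : realType) (X : choiceType).
Implicit Types (a : X -> R) (s : seq X).

Lemma esum_ge_size (S : set X) s a (b : R) : uniq s -> (forall x, x \in s -> S x) ->
  (forall x, x \in s -> b <= a x) -> (((size s)%:R * b)%:E <= \esum_(x in S) (a x)%:E)%E.
Proof.
move=> us sS hb; apply: esum_ge; exists [set` s].
  by split; [exact: finite_seq|move=> x /= xs; exact: sS].
rewrite -fsbig_seq// sumEFin lee_fin {us sS}; elim: s hb => [_|x s IH hb].
  by rewrite big_nil mul0r.
rewrite big_cons /= -[(size s).+1]add1n natrD mulrDl mul1r lerD//.
  by apply: hb; rewrite inE eqxx.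
by apply: IH => y ys; apply: hb; rewrite inE ys orbT.
Qed.

Lemma sum_seq_le_size s a (b : R) : (forall x, x \in s -> a x <= b) ->
  \sum_(x <- s) a x <= (size s)%:R * b.
Proof.
elim: s => [_|x s IH hb]; first by rewrite big_nil mul0r.
rewrite big_cons /= -[(size s).+1]add1n natrD mulrDl mul1r lerD//.
  by apply: hb; rewrite inE eqxx.
by apply: IH => y ys; apply: hb; rewrite inE ys orbT.
Qed.

(** The list may repeat controls; the sum over the underlying set only drops repeated nonnegative
    terms. *)
Lemma esum_seq_le s a : (forall x, 0 <= a x) ->
  (\esum_(x in [set` s]) (a x)%:E <= (\sum_(x <- s) a x)%:E)%E.
Proof.
move=> a0; have -> : [set` s] = [set` undup s].
  by apply/seteqP; split=> x /=; rewrite mem_undup.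
rewrite esum_fset//; last by move=> x _; rewrite lee_fin.
rewrite -fsbig_seq ?undup_uniq// sumEFin lee_fin.
elim: s => // x s IH; rewrite big_cons /=; case: ifP => _.
  by apply: le_trans IH _; rewrite lerDr.
by rewrite big_cons lerD2l.
Qed.
End SumsOverControls.

(** * Exponential lower bound for the spanning cost *)

Section LowerBound.
Variables (R : realType) (d m : nat) (A : 'M[R]_d) (B : 'M[R]_(d, m)).
Variables (U : set 'cV[R]_m) (D K : set 'cV[R]_d) (P T : 'M[R[i]]_d).
Hypothesis cptU : compact U.
Hypotheses (uP : P \in unitmx) (PA : P *m map_mx (real_complex R) A = T *m P).
Hypothesis Tlow : forall i j : 'I_d, (i < j)%N -> T i j = 0.
Variables (f : 'cV[R]_m -> R) (c M : R).
Hypothesis fU : forall u, U u -> c <= f u <= M.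

Lemma a_tau_ge : (exists2 b : R, 0 < b & forall x, D x -> `|x| <= b) ->
  interior K !=set0 ->
  exists2 k : R, 0 < k & forall tau, 0 <= tau ->
    ((k * expR (tau * (c + unstable_sum T)))%:E <= a_tau A B U f tau K D)%E.
Proof.
move=> [b b0 bD] [x0 /interior_normP[r r0 rK]].
have b20 : 0 < b + b by rewrite addr_gt0.
(* The constant of the separated count for the bound [b + b], as two points of [D] differ by at most
   twice its radius; it does not depend on [tau]. *)
pose q := (2 * (mode_bound P * (b + b)) / (r / (4 * inverse_bound P + 1)) + 1) ^+ d.
have q0 : 0 < q.
  rewrite exprn_gt0// ltr_wpDl// !mulr_ge0 ?mode_bound_ge0 ?(ltW b20)// invr_ge0.
  by rewrite mulr_ge0 ?(ltW r0)// invr_ge0 addr_ge0// mulr_ge0// inverse_bound_ge0.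
exists q^-1; first by rewrite invr_gt0.
move=> tau tau0; apply: le_ereal_inf_tmp => _ [S [SU SK] <-].
have /choice[w hw] : forall x, exists w, K x ->
    S w /\ forall t, 0 <= t <= tau -> D (flow A B x w t).
  move=> x.
  have [Kx|nKx] := pselect (K x); last by exists (fun=> 0).
  have [w Sw wD] := SK _ Kx; exists w => _; split=> // t tt.
  have /andP[t0 _] := tt.
  by rewrite -(@adm_sol _ _ _ A B U cptU x w t (SU _ Sw) t0); exact: wD.
have [|F [uF FK Fq]] := @separated_lower_count _ _ _ _ _ uP PA Tlow _ x0 r (b + b) tau w r0 b20 tau0.
  move=> x y /rK Kx /rK Ky wxy t tt; rewrite -(flowB A B x y (w x)).
  apply: (le_trans (ler_normB _ _)); apply: lerD; apply: bD.
    by case: (hw x Kx) => _; apply.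
  by rewrite wxy; case: (hw y Ky) => _; apply.
apply: le_trans (@esum_ge_size _ _ S F _ (expR (c * tau)) uF _ _); first last.
- by move=> v /FK[x /rK Kx ->]; rewrite ler_expR (running_cost_ge fU)//; apply: SU; case: (hw x Kx).
- by move=> v /FK[x /rK Kx ->]; case: (hw x Kx).
rewrite lee_fin mulrDr expRD [tau * c]mulrC [expR (c * tau) * _]mulrC mulrA.
by rewrite ler_wpM2r ?expR_ge0// mulrC ler_pdivrMr// [leRHS]mulrC.
Qed.
End LowerBound.

(** * Bookkeeping of the time intervals with uncontrolled cost *)

Section BadIntervals.
Variable R : realType.
Implicit Types (t T : R) (s : seq (R * R)).

Definition avoids s t := forall p, p \in s -> ~~ (p.1 <= t <= p.2).

Definition delay T s := [seq (T + p.1, T + p.2) | p <- s].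

Lemma avoids_delay T s t : avoids (delay T s) t -> avoids s (t - T).
Proof.
move=> h p ps; have := h _ (map_f (fun p => (T + p.1, T + p.2)) ps).
by rewrite /= lerBrDl lerBlDl.
Qed.

Lemma avoids_cons p s t : avoids (p :: s) t -> ~~ (p.1 <= t <= p.2) /\ avoids s t.
Proof.
by move=> h; split=> [|q qs]; apply: h; rewrite inE ?eqxx// qs orbT.
Qed.

Lemma delay_length T s : \sum_(p <- delay T s) (p.2 - p.1) = \sum_(p <- s) (p.2 - p.1).
Proof. by rewrite big_map; apply: eq_bigr => p _ /=; rewrite opprD addrACA subrr add0r. Qed.

Lemma delay_ordered T s : (forall p, p \in s -> p.1 <= p.2) ->
  forall p, p \in delay T s -> p.1 <= p.2.
Proof. by move=> h _ /mapP[p ps ->] /=; rewrite lerD2l h. Qed.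

(** The last unit of each of [k] consecutive blocks of length [T], where corrections are made; total
    length [k], whence the O(k) surplus in cost. *)
Fixpoint block_ends T k : seq (R * R) :=
  if k is k'.+1 then (T - 1, T) :: delay T (block_ends T k') else [::].

Lemma block_ends_length T k : \sum_(p <- block_ends T k) (p.2 - p.1) = k%:R.
Proof.
elim: k => [|k IH] /=; first by rewrite big_nil.
by rewrite /= big_cons delay_length IH -[k.+1]add1n natrD /=; congr (_ + _); ring.
Qed.

Lemma block_ends_ordered T k p : p \in block_ends T k -> p.1 <= p.2.
Proof.
elim: k p => // k IH p; rewrite inE => /predU1P[->|]; last exact: delay_ordered.
by rewrite /= gerBl.
Qed.
End BadIntervals.

(** * Exponential upper bound for the spanning cost *)

Section UpperBound.
Variables (R : realType) (d m : nat) (A : 'M[R]_d) (B : 'M[R]_(d, m)).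
Variables (U : set 'cV[R]_m) (D : set 'cV[R]_d).
Hypotheses (ctrlAB : controllable A B) (cptU : compact U) (U0 : nbhs (0 : 'cV[R]_m) U).
Hypothesis hD : control_set A B U D.
Hypothesis uE : forall t : R, 0 < t -> 1%:M - mexp A t \in unitmx.
Hypothesis iD : interior D !=set0.
Variables (f : 'cV[R]_m -> R) (c M : R) (u0 : 'cV[R]_m).
Hypotheses (fU : forall u, U u -> c <= f u <= M) (Uu0 : U u0) (fu0 : f u0 = c).
Local Opaque flow mexp.
Local Notation flow := (flow A B).

Definition rest (T : R) (v : R -> 'cV[R]_m) := concat_control (T - 1) (fun=> u0) v.

Lemma admissible_rest T v : admissible U v -> admissible U (rest T v).
Proof. by move=> Uv; apply: admissible_concat => //; exact: admissible_cst. Qed.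

(** By linearity the correction made on the last unit enters the endpoint additively and
    independently of [x]. *)
Lemma flow_rest T v x : 1 < T -> admissible U v ->
  flow x (rest T v) T = flow x (rest T (fun=> 0)) T + flow 0 v 1.
Proof.
move=> T1 Uv; have T10 : 0 <= T - 1 by rewrite subr_ge0 ltW.
have E v' : admissible U v' ->
    flow x (rest T v') T = mexp A 1 *m flow x (fun=> u0) (T - 1) + flow 0 v' 1.
  move=> Uv'.
  have := @flow_concat _ _ _ A B U cptU x (fun=> u0) v' (T - 1) 1 (admissible_cst Uu0) Uv' T10 ler01.
  rewrite subrK => ->.
  exact: flow_affine.
by rewrite (E v Uv) (E (fun=> 0) (admissible0 U0)) flow_zero addr0.
Qed.

(** The fixed point of the affine time-[T] map; its control vanishes on the last unit, so the
    homotopy from 0 applies with [eta = 1]. *)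
Lemma hub_exists T : 1 < T -> exists2 p, interior D p & flow p (rest T (fun=> 0)) T = p.
Proof.
move=> T1; have T0 : 0 < T by rewrite (lt_trans ltr01).
pose p := invmx (1%:M - mexp A T) *m flow 0 (rest T (fun=> 0)) T.
have pE : flow p (rest T (fun=> 0)) T = p.
  rewrite flow_affine; have : (1%:M - mexp A T) *m p = flow 0 (rest T (fun=> 0)) T.
    by rewrite /p mulmxA mulmxV ?mul1mx//; exact: uE.
  by move=> <-; rewrite mulmxBl mul1mx addrC subrK.
exists p => //; apply: (@periodic_point_interior _ _ _ A B U D ctrlAB cptU U0 hD uE iD T 1 (rest T (fun=> 0)) p) => //.
- by rewrite ltr01 ltW.
- exact/admissible_rest/admissible0.
- by move=> s sT; rewrite /rest /concat_control ltNge sT.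
Qed.

Section Blocks.
Variables (T r : R) (p : 'cV[R]_d) (X : seq 'cV[R]_d).
Hypotheses (T1 : 1 < T) (pE : flow p (rest T (fun=> 0)) T = p).
Hypothesis steerX : forall y, y \in X -> exists2 v, admissible U v & flow 0 v 1 = - (mexp A T *m y).
Hypothesis coverX : forall x, `|x| <= r -> exists2 y, y \in X & `|mexp A T *m (x - y)| <= r.

Lemma one_block : exists W : seq (R -> 'cV[R]_m), [/\ size W = size X,
  forall w, w \in W -> admissible U w,
  forall w t, w \in W -> t < T - 1 -> w t = u0 &
  forall x, `|x - p| <= r -> exists2 w, w \in W & `|flow x w T - p| <= r].
Proof.
have /choice[v hv] : forall y, exists v, y \in X ->
    admissible U v /\ flow 0 v 1 = - (mexp A T *m y).
  move=> y; case: (boolP (y \in X)) => [/steerX[v Uv vE]|_]; last by exists (fun=> 0).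
  by exists v.
exists [seq rest T (v y) | y <- X]; split; first by rewrite size_map.
- by move=> _ /mapP[y yX ->]; apply: admissible_rest; case: (hv y yX).
- by move=> _ t /mapP[y yX ->] tT; rewrite /rest /concat_control tT.
move=> x /coverX[y yX le]; exists (rest T (v y)); first exact: map_f.
have [Uv vE] := hv y yX; rewrite (flow_rest x T1 Uv) vE -[p in _ - p]pE addrAC.
rewrite (flowB A B x p (rest T (fun=> 0)) T).
by rewrite -mulmxBr.
Qed.

Lemma many_blocks k : exists W : seq (R -> 'cV[R]_m), [/\ size W = (size X ^ k)%N,
  forall w, w \in W -> admissible U w,
  forall w t, w \in W -> avoids (block_ends T k) t -> w t = u0 &
  forall x, `|x - p| <= r -> exists2 w, w \in W & `|flow x w (k%:R * T) - p| <= r].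
Proof.
have T0 : 0 <= T by rewrite ltW// (lt_trans ltr01).
have [W1 [sW1 UW1 W1u hW1]] := one_block.
elim: k => [|k [W [sW UW Wu hW]]].
  exists [:: fun=> u0]; split=> //.
  - by move=> w; rewrite inE => /eqP ->; exact: admissible_cst.
  - by move=> w t; rewrite inE => /eqP ->.
  - by move=> x xr; exists (fun=> u0); rewrite ?inE// mul0r flow0.
exists [seq concat_control T w1 w | w1 <- W1, w <- W]; split.
- by rewrite size_allpairs sW1 sW expnS.
- move=> _ /allpairsP[[w1 w] /= [w1W wW ->]]; apply: admissible_concat.
    exact: UW1.
  exact: UW.
- move=> _ t /allpairsP[[w1 w] /= [w1W wW ->]] /avoids_cons[/= nt /avoids_delay tT].
  rewrite /concat_control; case: ltP => [tlt|_]; last exact: Wu.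
  apply: W1u => //; rewrite ltNge; apply: contra nt => ->/=; exact: ltW.
- move=> x /hW1[w1 w1W /hW[w wW h]].
  exists (concat_control T w1 w); first exact: allpairs_f.
  rewrite -[k.+1]add1n natrD mulrDl mul1r.
  rewrite (@flow_concat _ _ _ A B U cptU x w1 w T (k%:R * T) (UW1 _ w1W) (UW _ wW) T0)//.
  by rewrite mulr_ge0.
Qed.
End Blocks.

(** The starts that a fixed control brings into the ball's interior at a fixed time form an open
    set; approximate reachability makes these sets cover [K]. *)
Lemma finite_approach (K : set 'cV[R]_d) p r : compact K -> K `<=` D -> D p -> 0 < r ->
  exists G : seq ((R -> 'cV[R]_m) * R),
    (forall g, g \in G -> admissible U g.1 /\ 0 <= g.2) /\
    forall x, K x -> exists2 g, g \in G & `|flow x g.1 g.2 - p| <= r.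
Proof.
move=> cptK KD Dp r0.
pose O := interior [set z : 'cV[R]_d | `|z - p| <= r].
pose V (g : (R -> 'cV[R]_m) * R) := (fun x => flow x g.1 g.2) @^-1` O.
pose I := [set g : (R -> 'cV[R]_m) * R | admissible U g.1 /\ 0 <= g.2].
have oV g : I g -> open (V g).
  move=> _; apply: open_comp; last exact: open_interior.
  by move=> x _; exact: (@continuous_flow_state _ _ _ A B g.1 g.2).
have KV : K `<=` cover I V.
  move=> x Kx; have := control_set_reach hD (KD _ Kx) Dp.
  move=> /closure_normP/(_ r0)[z /(reachP A B cptU)[w [Uw [t [t0 zE]]]] zp].
  exists (w, t) => //; rewrite /V /= -zE; apply/interior_normP.
  exists (r - `|z - p|); first by rewrite subr_gt0.
  move=> y yz /=; rewrite -(subrK z y) -addrA (le_trans (ler_normD _ _))//.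
  by rewrite -lerBrDr ltW.
have := cptK; rewrite compact_cover => /(_ _ I V oV KV)[G GI KG].
exists (finmap.enum_fset G); split.
  by move=> g gG; have := GI g gG; rewrite inE.
move=> x /KG[g gG /interior_subset h]; exists g => //.
Qed.

Hypothesis cM : c <= M.

(** Each control is an approach from [G] followed by [k] blocks from [W]. The approach adds at most
    [(M - c) * g.2] to the cost and the block ends at most [(M - c) * k]. *)
Lemma a_tau_le_blocks (K : set 'cV[R]_d) T r p (G : seq ((R -> 'cV[R]_m) * R))
    (W : seq (R -> 'cV[R]_m)) k tau : K `<=` D -> 0 <= T -> 0 <= tau <= k%:R * T ->
  (forall z, `|z - p| <= r -> D z) ->
  (forall g, g \in G -> admissible U g.1 /\ 0 <= g.2) ->
  (forall x, K x -> exists2 g, g \in G & `|flow x g.1 g.2 - p| <= r) ->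
  (forall w, w \in W -> admissible U w) ->
  (forall w t, w \in W -> avoids (block_ends T k) t -> w t = u0) ->
  (forall x, `|x - p| <= r -> exists2 w, w \in W & `|flow x w (k%:R * T) - p| <= r) ->
  (a_tau A B U f tau K D <=
   ((\sum_(g <- G) expR ((M - c) * g.2)) * (size W)%:R * expR (c * tau + (M - c) * k%:R))%:E)%E.
Proof.
move=> KD T0 /andP[tau0 tauT] rD UG KG UW Wu hW.
have kT : 0 <= k%:R * T by exact: le_trans tauT.
pose L := [seq concat_control g.2 g.1 w | g <- G, w <- W].
have UL l : l \in L -> admissible U l.
  move=> /allpairsP[[g w] /= [gG wW ->]]; apply: admissible_concat; last exact: UW.
  by case: (UG g gG).
have spL : spanning A B U tau K D [set` L].
  split=> [l /= lL|x Kx]; first exact: UL.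
  have [g gG /hW[w wW]] := KG x Kx; have [Ug g0] := UG g gG.
  rewrite -(@flow_concat _ _ _ A B U cptU x g.1 w g.2 (k%:R * T) Ug (UW _ wW) g0 kT) => /rD Dend.
  have lL : concat_control g.2 g.1 w \in L by exact: (allpairs_f (fun g w => concat_control g.2 g.1 w)).
  exists (concat_control g.2 g.1 w) => // t /andP[t0 tt].
  rewrite (@adm_sol _ _ _ A B U cptU x _ t (UL _ lL) t0).
  (* The trajectory starts in [K] and ends in the ball, both inside [D]; since its duration is at
     least [tau], it lies in [D] up to [tau]. *)
  apply: (@control_set_no_return _ _ _ A B U D cptU hD x _ (g.2 + k%:R * T) (KD _ Kx) (UL _ lL) _ Dend).
    exact: addr_ge0.
  by rewrite t0 (le_trans tt)// (le_trans tauT)// lerDr.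
apply: (@le_trans _ _ (\esum_(w in [set` L]) (expR (\int[@lebesgue_measure R]_(t in `[0, tau]) f (w t)))%:E)%E).
  by apply: ereal_inf_lbound; exists [set` L].
apply: (le_trans (esum_seq_le _ _)) => [w|]; first exact: expR_ge0.
rewrite lee_fin big_allpairs_dep mulr_suml mulr_suml.
rewrite big_seq [leRHS]big_seq; apply: ler_sum => g gG; have [Ug g0] := UG g gG.
rewrite -mulrA mulrCA -expRD; apply: sum_seq_le_size => w wW; rewrite ler_expR.
pose s := (0, g.2) :: delay g.2 (block_ends T k).
have -> : (M - c) * g.2 + (c * tau + (M - c) * k%:R) =
    c * tau + (M - c) * \sum_(q <- s) (q.2 - q.1).
  rewrite /s big_cons delay_length block_ends_length /= subr0; ring.
have lL : concat_control g.2 g.1 w \in L by exact: (allpairs_f (fun g w => concat_control g.2 g.1 w)).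
apply: (running_cost_le fU cM (UL _ lL) tau0) => [q|t /andP[t0 _]].
  rewrite inE => /predU1P[->//|]; apply: delay_ordered => q'; exact: block_ends_ordered.
move=> /avoids_cons[/= nt /avoids_delay at_]; rewrite /concat_control; case: ltP => [tg|_].
  by move: nt; rewrite t0 (ltW tg).
by rewrite (Wu w _ wW at_) fu0.
Qed.

Lemma a_tau_le (P T : 'M[R[i]]_d) (K : set 'cV[R]_d) eps : P \in unitmx ->
  P *m map_mx (real_complex R) A = T *m P ->
  (forall i j : 'I_d, (i < j)%N -> T i j = 0) ->
  (forall j k : 'I_d, (j <= k)%N -> complex.Re (T k k) <= complex.Re (T j j)) ->
  compact K -> K `<=` D -> 0 < eps ->
  exists2 C : R, 0 < C & forall tau, 0 <= tau ->
    (a_tau A B U f tau K D <= (C * expR (tau * (c + unstable_sum T + eps)))%:E)%E.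
Proof.
move=> uP PA Tlow Tsorted cptK KD eps0.
(* Half of [eps] pays for the surplus rate [d * e] of the cover, the other half for the overhead of
   each block. *)
pose e := eps / 2 / (d%:R + 1).
have d1 : 0 < d%:R + 1 :> R by rewrite ltr_wpDl.
have eps20 : 0 < eps / 2 by rewrite divr_gt0.
have e0 : 0 < e by rewrite divr_gt0.
have de : d%:R * e <= eps / 2.
  by rewrite /e mulrCA ler_piMr ?(ltW eps20)// ler_pdivrMr// mul1r lerDl.
have [C0 C00 cover] := covering_upper_count uP PA Tlow Tsorted e0.
(* Overhead of one block: the logarithm of the covering constant plus the cost surplus of the last
   unit. The block length [S] is then chosen so large that [b <= S * (eps / 2)]. *)
pose b := ln (Num.max 1 C0) + (M - c).
have b0 : 0 <= b by rewrite addr_ge0 ?subr_ge0// ln_ge0// le_max lexx.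
pose S := 2 + b / (eps / 2).
have S1 : 1 < S by rewrite ltr_wpDr ?ltr1n// divr_ge0// ltW.
have S0 : 0 < S by rewrite (lt_trans ltr01).
have bS : b <= S * (eps / 2).
  by rewrite mulrDl divfK ?gt_eqF// lerDr mulr_ge0// ltW.
have [p /interior_normP[r1 r10 rD] pE] := hub_exists S1.
have [r2 r20 hst] := small_steering ctrlAB U0 ltr01.
have [r3 r30 hr3] := mulmx_small (mexp A S) r20.
(* Strictly below both radii, so that the closed ball lies in [D] and its corrections can be steered
   in unit time by admissible controls. *)
pose r := Num.min r1 r3 / 2.
have r0 : 0 < r by rewrite divr_gt0// lt_min r10 r30.
have rlt : r < Num.min r1 r3 by rewrite ltr_pdivrMr// mulr_natr mulr2n ltrDl lt_min r10 r30.
have rD' z : `|z - p| <= r -> D z.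
  by move=> h; apply: rD; apply: (le_lt_trans h); apply: (lt_le_trans rlt); rewrite ge_min lexx.
have Dp : D p by apply: rD; rewrite subrr normr0.
have [X [Xr Xcov sX]] := cover S r (ltW S0) r0.
have Xst y : y \in X -> exists2 v, admissible U v & flow 0 v 1 = - (mexp A S *m y).
  move=> /Xr yr; apply: hst; rewrite normrN; apply: hr3; apply: (le_lt_trans yr).
  by apply: (lt_le_trans rlt); rewrite ge_min lexx orbT.
have [G [UG KG]] := finite_approach cptK KD Dp r0.
pose C1 := \sum_(g <- G) expR ((M - c) * g.2).
have C10 : 0 <= C1 by apply: sumr_ge0 => g _; exact: expR_ge0.
pose L := unstable_sum T.
have L0 : 0 <= L + d%:R * e.
  apply: addr_ge0; last exact: mulr_ge0 (ler0n _ _) (ltW e0).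
  by rewrite /L /unstable_sum; apply: sumr_ge0 => j _; rewrite le_max lexx.
exists ((C1 + 1) * expR (b + S * (L + d%:R * e))).
  by rewrite mulr_gt0 ?expR_gt0// ltr_wpDl.
move=> tau tau0.
(* The number of blocks is rounded up past [tau / S]; the at most one extra block goes into the
   constant. *)
have [k /andP[k1 k2]] : exists k, (k%:R <= tau / S + 1) && (tau / S <= k%:R).
  exists (Num.truncn (tau / S)).+1; apply/andP; split.
    by rewrite -natr1 lerD2r truncn_le// divr_ge0// ltW.
  by rewrite ltW// truncnS_gt.
have [W [sW UW Wu hW]] := many_blocks S1 pE Xst Xcov k.
have tk : 0 <= tau <= k%:R * S by rewrite tau0 -ler_pdivrMr.
apply: (le_trans (a_tau_le_blocks KD (ltW S0) tk rD' UG KG UW Wu hW)).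
have sWle : (size W)%:R <= expR (k%:R * (ln (Num.max 1 C0) + S * (L + d%:R * e))).
  rewrite sW natrX expRM_natl; apply: lerXn2r; rewrite ?nnegrE ?expR_ge0//.
  apply: (le_trans sX); rewrite expRD lnK ?posrE ?lt_max ?ltr01//.
  by rewrite ler_wpM2r ?expR_ge0// le_max lexx orbT.
rewrite lee_fin -!mulrA -/C1; apply: ler_pM => //.
  by rewrite lerDl.
apply: (le_trans (ler_wpM2r (expR_ge0 _) sWle)); rewrite -!expRD ler_expR.
have kb : k%:R * b <= b + tau * (eps / 2).
  apply: (le_trans (ler_wpM2r b0 k1)); rewrite mulrDl mul1r addrC lerD2l mulrAC -mulrA.
  by rewrite ler_wpM2l// mulrC ler_pdivrMl// mulrC.
have kL : k%:R * S * (L + d%:R * e) <= (tau + S) * (L + d%:R * e).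
  rewrite ler_wpM2r//; apply: (le_trans (ler_wpM2r (ltW S0) k1)).
  by rewrite mulrDl divfK ?gt_eqF// mul1r.
have tde : tau * (d%:R * e) <= tau * (eps / 2) by rewrite ler_wpM2l.
move: kb kL tde; rewrite /b -/L; move: (ln _) => l; lra.
Qed.
End UpperBound.

(** * From exponential bounds to the limit superior *)

Section ExponentialRate.
Variable R : realType.

Lemma limf_esup_exponential_rate (a : R -> \bar R) (g : R) :
  (exists2 k : R, 0 < k & forall t, 0 <= t -> ((k * expR (t * g))%:E <= a t)%E) ->
  (forall e, 0 < e -> exists2 C : R, 0 < C &
     forall t, 0 <= t -> (a t <= (C * expR (t * (g + e)))%:E)%E) ->
  limf_esup (fun t : R => (t^-1)%:E * lne (a t))%E (pinfty_nbhs R) = g%:E.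
Proof.
move=> [k k0 ka] aC; rewrite limf_esupE.
have lnE (b t h : R) : 0 < b -> ln (b * expR (t * h)) = ln b + t * h.
  by move=> b0; rewrite lnM ?posrE ?expR_gt0// expRK.
(* The two bounds confine [a t] to positive reals, so the extended logarithm becomes the real
   one. *)
have fina t : 0 <= t -> exists2 r : R, 0 < r & a t = r%:E.
  move=> t0; have [C _ /(_ t t0)] := aC 1 ltr01; have := ka t t0.
  case: (a t) => [r||]//= kr _; exists r => //; rewrite -lte_fin.
  by apply: lt_le_trans kr; rewrite lte_fin mulr_gt0 ?expR_gt0.
apply/eqP; rewrite eq_le; apply/andP; split.
  apply/lee_addgt0Pr => e e0; have e20 : 0 < e / 2 by rewrite divr_gt0.
  have [C C0 hC] := aC _ e20; apply: le_trans (ereal_inf_lbound _) _.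
    (* Beyond this threshold [ln C] is below [t * (e / 2)]; the other half of [e] is the slack in
       the exponent. *)
    exists [set t : R | Num.max 1 (ln C / (e / 2)) < t] => //.
    by exists (Num.max 1 (ln C / (e / 2))); split; first exact: num_real.
  apply: ge_ereal_sup => _ [t Vt <-].
  have : Num.max 1 (ln C / (e / 2)) < t by exact: Vt.
  rewrite gt_max => /andP[t1 tC].
  have t0 : 0 < t by rewrite (lt_trans ltr01).
  have [r r0 aE] := fina t (ltW t0); rewrite aE lne_EFin// -EFinM -EFinD lee_fin.
  rewrite mulrC ler_pdivrMr//; have := hC t (ltW t0); rewrite aE lee_fin.
  rewrite -ler_ln ?posrE// ?mulr_gt0 ?expR_gt0// lnE// => /le_trans; apply.
  by move: tC; rewrite ltr_pdivrMr//; nra.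
apply: le_ereal_inf_tmp => _ [V [N [_ NV]] <-].
apply/lee_subgt0Pr => e e0.
(* One time in [V] suffices to bound the supremum from below; [t >= - ln k / e] makes the constant
   [k] cost at most [e]. *)
pose t := Num.max 1 (Num.max (N + 1) (- ln k / e)).
have t1 : 1 <= t by rewrite /t le_max lexx.
have t0 : 0 < t by rewrite (lt_le_trans ltr01).
have tN : N + 1 <= t by rewrite /t !le_max lexx orbT.
have tk : - ln k / e <= t by rewrite /t !le_max lexx !orbT.
apply: (@le_trans _ _ ((t^-1)%:E * lne (a t))%E); last first.
  apply: ereal_sup_ubound; exists t => //; apply: NV.
  by apply: lt_le_trans tN; rewrite ltrDl.
have [r r0 aE] := fina t (ltW t0); rewrite aE lne_EFin// -EFinM -EFinB lee_fin.
rewrite [leRHS]mulrC ler_pdivlMr//; have := ka t (ltW t0); rewrite aE lee_fin.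
rewrite -ler_ln ?posrE// ?mulr_gt0 ?expR_gt0// lnE// => kr; apply: le_trans kr.
by move: tk; rewrite ler_pdivrMr//; lra.
Qed.
End ExponentialRate.

Unset Implicit Arguments.

Local Open Scope complex_scope.

Theorem theorem5p2 (R : realType) (d m : nat)
    (A : 'M[R]_d) (B : 'M[R]_(d, m)) (U : set 'cV[R]_m)
    (D K : set 'cV[R]_d) (f : 'cV[R]_m -> R) (s : seq R[i]) :
  controllable A B ->
  hyperbolic A ->
  compact U -> nbhs (0 : 'cV[R]_m) U ->
  control_set A B U D -> interior D !=set0 ->
  map_poly (fun r : R => r%:C) (char_poly A) = \prod_(z <- s) ('X - z%:P) ->
  compact K -> K `<=` D -> interior K !=set0 ->
  {within U, continuous f} ->
  inv_pressure A B U f K D =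
    (inf [set f u | u in U] + \sum_(z <- s) Num.max 0 (complex.Re z))%:E.
Proof.
move=> ctrlAB hypA cptU U0 hD iD chA cptK KD iK cf.
have [P [T [e [uP PA Tlow Tsorted [e0 he <-]]]]] := sorted_triangularization hypA chA.
have Tne (j : 'I_d) : complex.Re (T j j) != 0.
  by rewrite -normr_gt0; exact: lt_le_trans e0 (he j).
have uE t : 0 < t -> 1%:M - mexp A t \in unitmx by exact: unitmx_1_sub_mexp uP PA Tlow Tne.
have Un0 : U !=set0 by exists 0; exact: nbhs_singleton.
have [u0 /set_mem Uu0 fmin] := compact_EVT_min Un0 cptU cf.
have [u1 /set_mem Uu1 fmax] := compact_EVT_max Un0 cptU cf.
have -> : inf [set f u | u in U] = f u0.
  apply/eqP; rewrite eq_le; apply/andP; split.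
    apply: ge_inf; last by exists u0.
    by exists (f u0) => _ [u Uu <-]; apply: fmin; rewrite inE.
  apply: lb_le_inf; first by exists (f u0), u0.
  by move=> _ [u Uu <-]; apply: fmin; rewrite inE.
have fU u : U u -> f u0 <= f u <= f u1 by move=> /mem_set Uu; rewrite fmin ?fmax.
have D0 : D 0 by apply: interior_subset; exact: interior0 ctrlAB cptU U0 hD uE iD.
apply: limf_esup_exponential_rate.
  apply: (a_tau_ge B cptU uP PA Tlow fU _ iK).
  exact: (control_set_bounded cptU hD D0 uP PA Tlow e0 he).
move=> eps eps0.
exact: (a_tau_le ctrlAB cptU U0 hD uE iD fU Uu0 erefl (fmax _ (mem_set Uu0)) uP PA Tlow Tsorted cptK KD eps0).
Qed.
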